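(* The adjunction $$L:\mathrm{Set}_\Delta^{\mathrm{sc}}\rightleftarrows \mathrm{Set}_\Delta^{\mathbf{mb}}:U,$$ where $L(X,T_X)=(X,\flat,T_X\subseteq T_X)$ and $U(X,E_X,T_X\subseteq C_X)=(X,T_X)$, is a Quillen equivalence, where the left-hand side carries Lurie's model structure on scaled simplicial sets and the right-hand side carries the model structure on marked biscaled simplicial sets over the point $\Delta^0$, i.e. the model structure whose cofibrations are the maps that are monomorphisms on underlying simplicial sets and whose fibrant objects are the 2-Cartesian fibrations over $\Delta^0$.
   Context: A scaled simplicial set $(S,T_S)$ is a simplicial set $S$ with a set $T_S\subseteq S_2$ of thin triangles containing all degenerate ones; the category $\mathrm{Set}_\Delta^{\mathrm{sc}}$ carries Lurie's model structure, whose cofibrations are the monomorphisms and whose fibrant objects are the $\infty$-bicategories. A marked biscaled (mb) simplicial set $(X,E_X,T_X\subseteq C_X)$ is a simplicial set $X$ with a set $E_X\subseteq X_1$ of marked edges containing all degenerate edges, and sets $T_X\subseteq C_X\subseteq X_2$ of thin, resp. lean, triangles, with $T_X$ containing all degenerate triangles. Morphisms are simplicial maps preserving the three collections; the category is $\mathrm{Set}_\Delta^{\mathbf{mb}}$. In any slot $\flat$ means only degenerate simplices, $\sharp$ means all simplices; $(X,E,T)$ abbreviates $(X,E,T\subseteq T)$; only nondegenerate members of collections are listed, and a listed triangle not contained in the simplicial set is ignored. The $\mathbf{MB}$-anodyne maps are the weakly saturated class generated by: (A1) $(\Lambda^n_i,\flat,\{\Delta^{\{i-1,i,i+1\}}\})\to(\Delta^n,\flat,\{\Delta^{\{i-1,i,i+1\}}\})$,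 $n\ge2$, $0<i<n$; (A2) $(\Delta^4,\flat,T)\to(\Delta^4,\flat,T\cup\{\Delta^{\{0,3,4\}},\Delta^{\{0,1,4\}}\})$, $T=\{\Delta^{\{0,2,4\}},\Delta^{\{1,2,3\}},\Delta^{\{0,1,3\}},\Delta^{\{1,3,4\}},\Delta^{\{0,1,2\}}\}$; (A3) $(\Lambda^n_0\coprod_{\Delta^{\{0,1\}}}\Delta^0,\flat,\flat\subseteq\{\Delta^{\{0,1,n\}}\})\to(\Delta^n\coprod_{\Delta^{\{0,1\}}}\Delta^0,\flat,\flat\subseteq\{\Delta^{\{0,1,n\}}\})$, $n\ge2$; (A4) $(\Lambda^n_n,\{\Delta^{\{n-1,n\}}\},\flat\subseteq\{\Delta^{\{0,n-1,n\}}\})\to(\Delta^n,\{\Delta^{\{n-1,n\}}\},\flat\subseteq\{\Delta^{\{0,n-1,n\}}\})$, $n\ge2$; (A5) the inclusion of the terminal vertex $(\Delta^0,\sharp,\sharp)\to(\Delta^1,\sharp,\sharp)$; (S1) $(\Delta^2,\{\Delta^{\{0,1\}},\Delta^{\{1,2\}}\},\sharp)\to(\Delta^2,\sharp,\sharp)$; (S2) $(\Delta^2,\flat,\flat\subseteq\sharp)\to(\Delta^2,\flat,\sharp)$; (S3) $(\Delta^3,\flat,\{\Delta^{\{i-1,i,i+1\}}\}\subseteq U_i)\to(\Delta^3,\flat,\{\Delta^{\{i-1,i,i+1\}}\}\subseteq\sharp)$, $0<i<3$; (S4) $(\Delta^3\coprod_{\Delta^{\{0,1\}}}\Delta^0,\flat,\flat\subseteq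 U_0)\to(\Delta^3\coprod_{\Delta^{\{0,1\}}}\Delta^0,\flat,\flat\subseteq\sharp)$; (S5) $(\Delta^3,\{\Delta^{\{2,3\}}\},\flat\subseteq U_3)\to(\Delta^3,\{\Delta^{\{2,3\}}\},\flat\subseteq\sharp)$; (E) $(K,\flat,\sharp)\to(K,\sharp,\sharp)$ for every Kan complex $K$; where $U_i$ is the collection of all triangles except the face missing vertex $i$. A 2-Cartesian fibration over a scaled simplicial set $S$ is an mb simplicial set $X$ with a map to $(S,\sharp,T_S\subseteq\sharp)$ having the right lifting property against all $\mathbf{MB}$-anodyne maps. For every scaled simplicial set $S$ there is a unique model structure on mb simplicial sets over $(S,\sharp,T_S\subseteq\sharp)$ whose cofibrations are the monomorphisms on underlying simplicial sets and whose fibrant objects are the 2-Cartesian fibrations over $S$; it is used here for $S=\Delta^0$. *)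

(* Defs.v *)
From mathcomp Require Import all_boot.
From mathcomp Require Import boolp.

Set Implicit Arguments.
Unset Strict Implicit.
Unset Printing Implicit Defensive.

Record category := Category {
  ob :> Type;
  hom : ob -> ob -> Type;
  idm : forall X, hom X X;
  comp : forall X Y Z, hom Y Z -> hom X Y -> hom X Z;
  comp1m : forall X Y (f : hom X Y), comp (idm Y) f = f;
  compm1 : forall X Y (f : hom X Y), comp f (idm X) = f;
  compA : forall W X Y Z (h : hom Y Z) (g : hom X Y) (f : hom W X),
    comp h (comp g f) = comp (comp h g) f }.

Arguments hom {c} _ _.
Arguments idm {c} _.
Arguments comp {c} {X Y Z} _ _.

Declare Scope cat_scope.
Delimit Scope cat_scope with cat.
Local Open Scope cat_scope.
Notation "g \* f" := (comp g f) (at level 40, left associativity) : cat_scope.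

Definition mor_class (C : category) := forall X Y : C, hom X Y -> Prop.

Section CategoryNotions.
Variable C : category.
Implicit Types X Y Z A B : C.

Definition monomorphism X Y (f : hom X Y) : Prop :=
  forall W (g h : hom W X), f \* g = f \* h -> g = h.

Definition is_terminal T : Prop :=
  forall X, exists! f : hom X T, True.

Definition is_initial I : Prop :=
  forall X, exists! f : hom I X, True.

Definition has_lift A B X Y (i : hom A B) (p : hom X Y) : Prop :=
  forall (u : hom A X) (v : hom B Y), p \* u = v \* i ->
    exists h : hom B X, h \* i = u /\ p \* h = v.

Definition rlp (S : mor_class C) X Y (p : hom X Y) : Prop :=
  forall A B (i : hom A B), S A B i -> has_lift i p.

Definition is_retract A B X Y (f : hom A B) (g : hom X Y) : Prop :=
  exists (i : hom A X) (r : hom X A) (j : hom B Y) (s : hom Y B),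
    [/\ r \* i = idm A, s \* j = idm B, g \* i = j \* f & f \* r = s \* g].

Definition is_pushout A B X Y
    (f : hom A B) (g : hom A X) (g' : hom B Y) (f' : hom X Y) : Prop :=
  g' \* f = f' \* g /\
  forall Z (b : hom B Z) (x : hom X Z), b \* f = x \* g ->
    exists! h : hom Y Z, h \* g' = b /\ h \* f' = x.

Definition closed_retract (S : mor_class C) : Prop :=
  forall A B X Y (f : hom A B) (g : hom X Y),
    is_retract f g -> S _ _ g -> S _ _ f.

Definition closed_pushout (S : mor_class C) : Prop :=
  forall A B X Y (f : hom A B) (g : hom A X) (g' : hom B Y) (f' : hom X Y),
    is_pushout f g g' f' -> S _ _ f -> S _ _ f'.

Record chain (I : Type) (lt : I -> I -> Prop) := Chain {
  chain_ob :> I -> C;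
  chain_map : forall i j, lt i j -> hom (chain_ob i) (chain_ob j);
  chain_comp : forall i j k (ij : lt i j) (jk : lt j k) (ik : lt i k),
    chain_map ik = chain_map jk \* chain_map ij }.

(* [c] exhibits [Y] as the colimit of the restriction of [F] to [P]. *)
Definition is_chain_colimit (I : Type) (lt : I -> I -> Prop) (F : chain lt)
    (P : I -> Prop) Y (c : forall i, P i -> hom (F i) Y) : Prop :=
  (forall i j (ij : lt i j) (pi : P i) (pj : P j),
      c j pj \* chain_map F ij = c i pi) /\
  forall Z (d : forall i, P i -> hom (F i) Z),
    (forall i j (ij : lt i j) (pi : P i) (pj : P j),
        d j pj \* chain_map F ij = d i pi) ->
    exists! u : hom Y Z, forall i (pi : P i), u \* c i pi = d i pi.

Definition is_well_order (I : Type) (lt : I -> I -> Prop) : Prop :=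
  [/\ well_founded lt,
      forall i j k, lt i j -> lt j k -> lt i k
    & forall i j, [\/ lt i j, i = j | lt j i]].

Definition is_succ (I : Type) (lt : I -> I -> Prop) (i j : I) : Prop :=
  lt i j /\ forall k, ~ (lt i k /\ lt k j).

Definition is_limit (I : Type) (lt : I -> I -> Prop) (j : I) : Prop :=
  (exists i, lt i j) /\ forall i, ~ is_succ lt i j.

Definition closed_transfinite (S : mor_class C) : Prop :=
  forall (I : Type) (lt : I -> I -> Prop) (F : chain lt) (o : I),
    is_well_order lt ->
    (forall i, ~ lt i o) ->
    (forall i j (ij : lt i j), is_succ lt i j -> S _ _ (chain_map F ij)) ->
    (forall j, is_limit lt j ->
       is_chain_colimit (P := fun i => lt i j) (fun i ij => chain_map F ij)) ->
    forall Y (c : forall i, True -> hom (F i) Y),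
      is_chain_colimit c -> S _ _ (c o Logic.I).

Definition weakly_saturated (S : mor_class C) : Prop :=
  [/\ closed_pushout S, closed_transfinite S & closed_retract S].

Definition saturation (G : mor_class C) : mor_class C :=
  fun X Y f => forall S : mor_class C,
    weakly_saturated S -> (forall A B (i : hom A B), G A B i -> S A B i) ->
    S X Y f.

End CategoryNotions.

Record model_structure (C : category) := ModelStructure {
  weq : mor_class C;
  cof : mor_class C;
  fib : mor_class C;
  weq_comp : forall (X Y Z : C) (f : hom X Y) (g : hom Y Z),
    weq f -> weq g -> weq (g \* f);
  weq_cancell : forall (X Y Z : C) (f : hom X Y) (g : hom Y Z),
    weq g -> weq (g \* f) -> weq f;
  weq_cancelr : forall (X Y Z : C) (f : hom X Y) (g : hom Y Z),
    weq f -> weq (g \* f) -> weq g;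
  weq_retract : closed_retract weq;
  cof_retract : closed_retract cof;
  fib_retract : closed_retract fib;
  lift_cof_tfib : forall (A B X Y : C) (i : hom A B) (p : hom X Y),
    cof i -> fib p -> weq p -> has_lift i p;
  lift_tcof_fib : forall (A B X Y : C) (i : hom A B) (p : hom X Y),
    cof i -> weq i -> fib p -> has_lift i p;
  factor_cof_tfib : forall (X Y : C) (f : hom X Y),
    exists (Z : C) (i : hom X Z) (p : hom Z Y),
      [/\ f = p \* i, cof i, fib p & weq p];
  factor_tcof_fib : forall (X Y : C) (f : hom X Y),
    exists (Z : C) (i : hom X Z) (p : hom Z Y),
      [/\ f = p \* i, cof i, weq i & fib p] }.

Definition fibrant (C : category) (M : model_structure C) (X : C) : Prop :=
  forall (T : C) (f : hom X T), is_terminal T -> fib M f.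

Definition cofibrant (C : category) (M : model_structure C) (X : C) : Prop :=
  forall (I : C) (f : hom I X), is_initial I -> cof M f.

Record functor (C D : category) := Functor {
  fob :> C -> D;
  fmap : forall X Y : C, hom X Y -> hom (fob X) (fob Y);
  fmap1 : forall X : C, fmap (idm X) = idm (fob X);
  fmap_comp : forall (X Y Z : C) (g : hom Y Z) (f : hom X Y),
    fmap (g \* f) = fmap g \* fmap f }.

Record adjunction (C D : category) (F : functor C D) (G : functor D C) :=
  Adjunction {
  adj : forall (X : C) (Y : D), hom (F X) Y -> hom X (G Y);
  adj_inv : forall (X : C) (Y : D), hom X (G Y) -> hom (F X) Y;
  adjK : forall (X : C) (Y : D), cancel (@adj X Y) (@adj_inv X Y);
  adj_invK : forall (X : C) (Y : D), cancel (@adj_inv X Y) (@adj X Y);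
  adj_nat : forall (X X' : C) (Y Y' : D)
      (f : hom X' X) (g : hom (F X) Y) (h : hom Y Y'),
    adj (h \* g \* fmap F f) = fmap G h \* adj g \* f }.

Section Quillen.
Variables (C D : category) (M : model_structure C) (N : model_structure D).
Variables (F : functor C D) (G : functor D C) (a : adjunction F G).

Definition quillen_adjunction : Prop :=
  (forall (X Y : C) (f : hom X Y), cof M f -> cof N (fmap F f)) /\
  (forall (X Y : C) (f : hom X Y), cof M f -> weq M f ->
     cof N (fmap F f) /\ weq N (fmap F f)).

Definition quillen_equivalence : Prop :=
  quillen_adjunction /\
  forall (X : C) (Y : D) (f : hom (F X) Y),
    cofibrant M X -> fibrant N Y -> (weq N f <-> weq M (adj a f)).

End Quillen.

(* Monotone maps [m] -> [n], where [n] is the ordinal 'I_n.+1. *)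
Definition monotoneb m n (f : {ffun 'I_m.+1 -> 'I_n.+1}) : bool :=
  [forall i : 'I_m.+1, forall j : 'I_m.+1, (i <= j) ==> (f i <= f j)].

Record delta m n := Delta {
  dfun :> {ffun 'I_m.+1 -> 'I_n.+1};
  dfunP : monotoneb dfun }.

Lemma monotonebP m n (f : {ffun 'I_m.+1 -> 'I_n.+1}) :
  reflect (forall i j : 'I_m.+1, i <= j -> f i <= f j) (monotoneb f).
Proof.
apply: (iffP forallP) => [H i j|H i]; last first.
  by apply/forallP => j; apply/implyP/H.
by move/forallP: (H i) => /(_ j)/implyP.
Qed.

Lemma delta_eq m n (f g : delta m n) : f =1 g -> f = g.
Proof.
case: f g => [f fP] [g gP] /= /ffunP fg; move: fP gP; rewrite fg => fP gP.
by congr Delta; apply: bool_irrelevance.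
Qed.

Lemma did_subproof m : monotoneb [ffun i : 'I_m.+1 => i].
Proof. by apply/monotonebP => i j; rewrite !ffunE. Qed.
Definition did m : delta m m := Delta (did_subproof m).

Lemma dcomp_subproof m n p (g : delta n p) (f : delta m n) :
  monotoneb [ffun i => g (f i)].
Proof.
apply/monotonebP => i j ij; rewrite !ffunE.
by apply: (monotonebP _ (dfunP g)); apply: (monotonebP _ (dfunP f)).
Qed.
Definition dcomp m n p (g : delta n p) (f : delta m n) : delta m p :=
  Delta (dcomp_subproof g f).

Lemma dconst_subproof m n (k : 'I_n.+1) : monotoneb [ffun _ : 'I_m.+1 => k].
Proof. by apply/monotonebP => i j; rewrite !ffunE. Qed.
Definition dconst m n (k : 'I_n.+1) : delta m n :=
  Delta (dconst_subproof m k).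

Lemma dcomp1m m n (f : delta m n) : dcomp (did n) f = f.
Proof. by apply: delta_eq => i; rewrite !ffunE. Qed.

Lemma dcompm1 m n (f : delta m n) : dcomp f (did m) = f.
Proof. by apply: delta_eq => i; rewrite !ffunE. Qed.

Lemma dcompA m n p q (h : delta p q) (g : delta n p) (f : delta m n) :
  dcomp h (dcomp g f) = dcomp (dcomp h g) f.
Proof. by apply: delta_eq => i; rewrite !ffunE. Qed.

Record sset := SSet {
  sx :> nat -> Type;
  act : forall m n, delta m n -> sx n -> sx m;
  act_id : forall n (x : sx n), act (did n) x = x;
  act_comp : forall m n p (g : delta n p) (f : delta m n) (x : sx p),
    act (dcomp g f) x = act f (act g x) }.

Arguments act {s m n} _ _.

Record smap (X Y : sset) := SMap {
  smap_fun :> forall n, X n -> Y n;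
  smap_act : forall m n (f : delta m n) (x : X n),
    smap_fun (act f x) = act f (smap_fun x) }.

Lemma smap_eq (X Y : sset) (f g : smap X Y) :
  (forall n (x : X n), f n x = g n x) -> f = g.
Proof.
case: f g => [f fP] [g gP] /= fg.
have E : f = g by apply: functional_extensionality_dep => n; apply/funext/fg.
by move: fP gP; rewrite E => fP gP; congr SMap; apply: Prop_irrelevance.
Qed.

Definition smap_id (X : sset) : smap X X :=
  @SMap X X (fun _ x => x) (fun _ _ _ _ => erefl).

Lemma smap_comp_subproof (X Y Z : sset) (g : smap Y Z) (f : smap X Y)
    m n (a : delta m n) (x : X n) :
  g m (f m (act a x)) = act a (g n (f n x)).
Proof. by rewrite !smap_act. Qed.
Definition smap_comp (X Y Z : sset) (g : smap Y Z) (f : smap X Y) : smap X Z :=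
  @SMap X Z (fun n x => g n (f n x)) (smap_comp_subproof g f).

Definition sset_cat : category :=
  @Category sset smap smap_id smap_comp
    (fun X Y f => @smap_eq X Y (smap_comp (smap_id Y) f) f
      (fun _ _ => erefl))
    (fun X Y f => @smap_eq X Y (smap_comp f (smap_id X)) f
      (fun _ _ => erefl))
    (fun W X Y Z h g f => @smap_eq W Z (smap_comp h (smap_comp g f))
      (smap_comp (smap_comp h g) f) (fun _ _ => erefl)).

Definition degenerate (X : sset) n (x : X n) : Prop :=
  exists m (f : delta n m) (y : X m), m < n /\ x = act f y.

Lemma degenerate_map (X Y : sset) (f : smap X Y) n (x : X n) :
  degenerate x -> degenerate (f n x).
Proof.
by move=> [m [a [y [mn ->]]]]; exists m, a, (f m y); split; rewrite ?smap_act.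
Qed.

Definition simplex (n : nat) : sset :=
  @SSet (fun m => delta m n) (fun _ _ f x => dcomp x f)
    (fun m x => dcompm1 x) (fun _ _ _ g f x => dcompA x g f).

Definition simplex_map_subproof p q (a : delta p q) m n (f : delta m n)
    (x : simplex p n) :
    dcomp a (act f x) = @act (simplex q) m n f (dcomp a x) :=
  dcompA a x f.
Definition simplex_map p q (a : delta p q) : smap (simplex p) (simplex q) :=
  @SMap (simplex p) (simplex q) (fun m x => dcomp a x)
    (simplex_map_subproof a).

Record subsset (X : sset) := SubSSet {
  in_sub :> forall n, X n -> bool;
  in_sub_act : forall m n (f : delta m n) (x : X n),
    in_sub x -> in_sub (act f x) }.

Section Sub.
Variables (X : sset) (A : subsset X).

Definition sub_act m n (f : delta m n) (x : {x : X n | A n x}) :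
  {x : X m | A m x} :=
  exist (fun y => A m y) (act f (val x)) (in_sub_act f (valP x)).

Lemma sub_act_id n (x : {x : X n | A n x}) : sub_act (did n) x = x.
Proof. by apply: val_inj; rewrite /= act_id. Qed.

Lemma sub_act_comp m n p (g : delta n p) (f : delta m n)
  (x : {x : X p | A p x}) : sub_act (dcomp g f) x = sub_act f (sub_act g x).
Proof. by apply: val_inj; rewrite /= act_comp. Qed.

Definition sub_sset : sset := SSet sub_act_id sub_act_comp.

Definition sub_incl : smap sub_sset X :=
  @SMap sub_sset X (fun n x => val x) (fun _ _ _ _ => erefl).

End Sub.

Lemma preim_sub_subproof (X Y : sset) (f : smap X Y) (B : subsset Y)
    m n (a : delta m n) (x : X n) : B n (f n x) -> B m (f m (act a x)).
Proof. by rewrite smap_act; apply: in_sub_act. Qed.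
Definition preim_sub (X Y : sset) (f : smap X Y) (B : subsset Y) : subsset X :=
  @SubSSet X (fun n x => B n (f n x)) (@preim_sub_subproof X Y f B).

(* The faces of Delta^n other than the one opposite to i generate the horn: a
   simplex belongs to it iff it misses some vertex j <> i. *)
Lemma horn_subproof n (i : 'I_n.+1) m p (f : delta m p) (x : simplex n p) :
  [exists j, (j != i) && [forall k, x k != j]] ->
  [exists j, (j != i) && [forall k, (act f x : delta m n) k != j]].
Proof.
case/existsP=> j /andP [ji /forallP H]; apply/existsP; exists j; rewrite ji /=.
by apply/forallP => k; rewrite ffunE.
Qed.
Definition horn n (i : 'I_n.+1) : subsset (simplex n) :=
  @SubSSet (simplex n)
    (fun m x => [exists j, (j != i) && [forall k, x k != j]])
    (@horn_subproof n i).

(* The edge on the vertices 0 and 1; only used for n >= 1. *)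
Lemma edge01_subproof n m p (f : delta m p) (x : simplex n p) :
  [forall k, x k <= 1] -> [forall k, (act f x : delta m n) k <= 1].
Proof. by move/forallP=> H; apply/forallP => k; rewrite ffunE. Qed.
Definition edge01 n : subsset (simplex n) :=
  @SubSSet (simplex n) (fun m x => [forall k, x k <= 1]) (@edge01_subproof n).

(* The pushout of X <- A -> Delta^0 (see [collapse_pushout] below), computed
   levelwise: the m-simplices are those of X outside A, plus one simplex [None]
   that all m-simplices of A are sent to. *)
Section Collapse.
Variables (X : sset) (A : subsset X).

Definition collapse_sx n : Type := option {x : X n | ~~ A n x}.

Definition collapse_act m n (f : delta m n) (x : collapse_sx n) :
    collapse_sx m :=
  obind (fun y => insub (act f (val y))) x.

Lemma collapse_act_id n (x : collapse_sx n) : collapse_act (did n) x = x.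
Proof. by case: x => //= x; rewrite act_id valK. Qed.

Lemma collapse_act_comp m n p (g : delta n p) (f : delta m n)
    (x : collapse_sx p) :
  collapse_act (dcomp g f) x = collapse_act f (collapse_act g x).
Proof.
case: x => //= x; rewrite act_comp.
case: (insubP _ (act g (val x))) => [u _ <- //|/=].
rewrite negbK => H; rewrite insubN // negbK; exact: in_sub_act.
Qed.

Definition collapse : sset := SSet collapse_act_id collapse_act_comp.

Lemma collapse_proj_subproof m n (f : delta m n) (x : X n) :
  insub (act f x) = collapse_act f (insub x : collapse_sx n).
Proof.
case: (insubP _ x) => [u _ <- //|/=].
rewrite negbK => H; rewrite insubN // negbK; exact: in_sub_act.
Qed.
Definition collapse_proj : smap X collapse :=
  @SMap X collapse (fun n x => insub x) collapse_proj_subproof.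

Definition collapse_point_subproof m n (f : delta m n) (x : simplex 0 n) :
  (None : collapse_sx m) = @collapse_act m n f None := erefl.
Definition collapse_point : smap (simplex 0) collapse :=
  @SMap (simplex 0) collapse (fun n _ => None) collapse_point_subproof.

End Collapse.

Lemma to_simplex0_subproof (X : sset) m n (f : delta m n) (x : X n) :
  dconst m ord0 = @act (simplex 0) m n f (dconst n ord0).
Proof. by apply: delta_eq => i; rewrite !ffunE. Qed.
Definition to_simplex0 (X : sset) : smap X (simplex 0) :=
  @SMap X (simplex 0) (fun n _ => dconst n ord0) (@to_simplex0_subproof X).

Lemma simplex0_uniq n (x y : simplex 0 n) : x = y.
Proof. by apply: delta_eq => i; rewrite !ord1. Qed.

Lemma collapse_pushout (X : sset) (A : subsset X) :
  is_pushout (C := sset_cat) (to_simplex0 (sub_sset A)) (sub_incl A)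
    (collapse_point A) (collapse_proj A).
Proof.
split=> [|Z b x bx].
  by apply: smap_eq => n [y Ay] /=; rewrite insubN ?negbK.
have bxE n (y : X n) : A n y -> x n y = b n (dconst n ord0).
  by move=> Ay; have /(congr1 (fun h : smap (sub_sset A) Z =>
    h n (exist (fun z => A n z) y Ay))) := bx.
pose h n (y : collapse A n) : Z n :=
  if y is Some z then x n (val z) else b n (dconst n ord0).
have hproj n (y : X n) : h n (insub y) = x n y.
  rewrite /h; case: insubP => [u _ -> //|]; rewrite negbK => Ay.
  by rewrite bxE.
have hP m n (f : delta m n) (y : collapse A n) : h m (act f y) = act f (h n y).
  case: y => [y|] /=; first by rewrite hproj smap_act.
  by rewrite -smap_act; congr (b m _); apply: simplex0_uniq.
exists (SMap hP); split=> [|k [kb kx]].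
  split; apply: smap_eq => n y //=.
  by congr (b n _); apply: simplex0_uniq.
apply: smap_eq => n [y|] /=.
  by rewrite -kx /=; congr (k n _); rewrite valK.
by rewrite -kb.
Qed.

Section CollapseMap.
Variables (X Y : sset) (f : smap X Y) (B : subsset Y).

Definition collapse_map_fun n (x : collapse (preim_sub f B) n) : collapse B n :=
  obind (fun y => insub (f n (val y))) x.

Lemma collapse_map_act m n (a : delta m n) (x : collapse (preim_sub f B) n) :
  collapse_map_fun (act a x) = act a (collapse_map_fun x).
Proof.
case: x => //= x; rewrite (insubT (fun z => ~~ B n z) (valP x)) /=.
case: insubP => [u _ uE /=|H]; last by rewrite -smap_act insubN.
by rewrite uE smap_act.
Qed.

Definition collapse_map : smap (collapse (preim_sub f B)) (collapse B) :=
  SMap collapse_map_act.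

End CollapseMap.

(* The simplicial sets Delta^n and Lambda^n_0 with the edge {0,1} collapsed. *)
Definition csimplex n : sset := collapse (edge01 n).
Definition csimplex_proj n : smap (simplex n) (csimplex n) :=
  collapse_proj (edge01 n).
Definition chorn0_incl n :
    smap (collapse (preim_sub (sub_incl (@horn n ord0)) (edge01 n)))
         (csimplex n) :=
  collapse_map (sub_incl (horn ord0)) (edge01 n).

Inductive horn_inclusion : mor_class sset_cat :=
| HornInclusion n (i : 'I_n.+1) : 0 < n ->
    @horn_inclusion _ _ (sub_incl (horn i)).

Definition kan_complex (K : sset) : Prop :=
  rlp (C := sset_cat) horn_inclusion (to_simplex0 K).

Section Collections.
Variables (X Y : sset) (n : nat).

Definition none (x : X n) : Prop := False.
Definition all_simp (x : X n) : Prop := True.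

Definition image_coll (f : smap X Y) (P : X n -> Prop) (y : Y n) : Prop :=
  exists2 x, P x & f n x = y.

Definition preim_coll (f : smap X Y) (P : Y n -> Prop) (x : X n) : Prop :=
  P (f n x).

(* Only nondegenerate members of a collection are listed. *)
Definition with_degenerate (P : X n -> Prop) (x : X n) : Prop :=
  degenerate x \/ P x.

End Collections.

Arguments none {X n} x.
Arguments all_simp {X n} x.

(* The simplices of Delta^n whose vertex lists are in s. *)
Definition faces n m (s : seq (seq nat)) (x : simplex n m) : Prop :=
  [seq val (x k) | k <- enum 'I_m.+1] \in s.

Record scsset := ScSSet {
  sc_sset :> sset;
  sc_thin : sc_sset 2 -> Prop;
  sc_thin_deg : forall x : sc_sset 2, degenerate x -> sc_thin x }.

Record scmap (X Y : scsset) := ScMap {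
  sc_smap :> smap X Y;
  sc_mapP : forall x : X 2, sc_thin x -> sc_thin (sc_smap 2 x) }.

Lemma scmap_eq (X Y : scsset) (f g : scmap X Y) :
  (forall n (x : X n), f n x = g n x) -> f = g.
Proof.
case: f g => [f fP] [g gP] /= /smap_eq fg.
by move: fP gP; rewrite fg => fP gP; congr ScMap; apply: Prop_irrelevance.
Qed.

Definition scmap_id (X : scsset) : scmap X X :=
  @ScMap X X (smap_id X) (fun _ => id).
Definition scmap_comp (X Y Z : scsset) (g : scmap Y Z) (f : scmap X Y) :
    scmap X Z :=
  @ScMap X Z (smap_comp g f) (fun x tx => sc_mapP g (sc_mapP f tx)).

Definition sc_cat : category :=
  @Category scsset scmap scmap_id scmap_comp
    (fun X Y f => @scmap_eq X Y (scmap_comp (scmap_id Y) f) f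
      (fun _ _ => erefl))
    (fun X Y f => @scmap_eq X Y (scmap_comp f (scmap_id X)) f
      (fun _ _ => erefl))
    (fun W X Y Z h g f => @scmap_eq W Z (scmap_comp h (scmap_comp g f))
      (scmap_comp (scmap_comp h g) f) (fun _ _ => erefl)).

Definition sc_of (X : sset) (T : X 2 -> Prop) : scsset :=
  @ScSSet X (with_degenerate T) (fun _ dx => or_introl dx).

Lemma sc_of_map_subproof (X Y : sset) (f : smap X Y)
    (T : X 2 -> Prop) (T' : Y 2 -> Prop) (hT : forall x, T x -> T' (f 2 x)) x :
  with_degenerate T x -> with_degenerate T' (f 2 x).
Proof. by case=> [/degenerate_map|/hT]; [left|right]. Qed.
Definition sc_of_map (X Y : sset) (f : smap X Y)
    (T : X 2 -> Prop) (T' : Y 2 -> Prop) (hT : forall x, T x -> T' (f 2 x)) :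
    scmap (sc_of T) (sc_of T') :=
  @ScMap (sc_of T) (sc_of T') f (sc_of_map_subproof hT).

Definition sc_restrict (X Y : sset) (f : smap X Y) (T : Y 2 -> Prop) :
    scmap (sc_of (preim_coll f T)) (sc_of T) :=
  sc_of_map (f := f) (fun _ h => h).

Definition sc_enlarge (X : sset) (T T' : X 2 -> Prop)
    (hT : forall x, T x -> T' x) : scmap (sc_of T) (sc_of T') :=
  sc_of_map (f := smap_id X) hT.

Definition T4 : seq (seq nat) :=
  [:: [:: 0; 2; 4]; [:: 1; 2; 3]; [:: 0; 1; 3]; [:: 1; 3; 4]; [:: 0; 1; 2]].
Definition T4' : seq (seq nat) := T4 ++ [:: [:: 0; 3; 4]; [:: 0; 1; 4]].

Lemma faces_sub n m (s t : seq (seq nat)) (st : {subset s <= t})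
  (x : simplex n m) : faces s x -> faces t x.
Proof. exact: st. Qed.

Lemma T4_sub : {subset T4 <= T4'}.
Proof. by move=> l lT; rewrite mem_cat lT. Qed.

Inductive scaled_generator : mor_class sc_cat :=
| ScInner n (i : 'I_n.+1) : 2 <= n -> 0 < i < n ->
    @scaled_generator _ _ (sc_restrict (sub_incl (horn i))
      (faces [:: [:: i.-1; nat_of_ord i; i.+1]]))
| ScSaturate :
    @scaled_generator _ _ (sc_enlarge (@faces_sub 4 2 _ _ T4_sub))
| ScOuter n : 2 < n ->
    @scaled_generator _ _ (sc_restrict (chorn0_incl n)
      (image_coll (csimplex_proj n) (faces [:: [:: 0; 1; n]]))).

Definition scaled_anodyne : mor_class sc_cat := saturation scaled_generator.

Definition sc_point : scsset := sc_of (X := simplex 0) all_simp.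

Definition sc_to_point (X : scsset) : scmap X sc_point :=
  @ScMap X sc_point (to_simplex0 X) (fun _ _ => or_intror Logic.I).

(* Lurie's weak oo-bicategories; by a theorem of Gagna, Harpaz and Lanari, they
   are the fibrant objects of Lurie's model structure. *)
Definition infty_bicategory (X : scsset) : Prop :=
  rlp (C := sc_cat) scaled_anodyne (sc_to_point X).

Record mbsset := MbSSet {
  mb_sset :> sset;
  mb_marked : mb_sset 1 -> Prop;
  mb_thin : mb_sset 2 -> Prop;
  mb_lean : mb_sset 2 -> Prop;
  mb_marked_deg : forall x : mb_sset 1, degenerate x -> mb_marked x;
  mb_thin_deg : forall x : mb_sset 2, degenerate x -> mb_thin x;
  mb_thin_lean : forall x : mb_sset 2, mb_thin x -> mb_lean x }.

Record mbmap (X Y : mbsset) := MbMap {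
  mb_smap :> smap X Y;
  mb_map_marked : forall x : X 1, mb_marked x -> mb_marked (mb_smap 1 x);
  mb_map_thin : forall x : X 2, mb_thin x -> mb_thin (mb_smap 2 x);
  mb_map_lean : forall x : X 2, mb_lean x -> mb_lean (mb_smap 2 x) }.

Lemma mbmap_eq (X Y : mbsset) (f g : mbmap X Y) :
  (forall n (x : X n), f n x = g n x) -> f = g.
Proof.
case: f g => [f f1 f2 f3] [g g1 g2 g3] /= /smap_eq fg.
move: f1 f2 f3 g1 g2 g3; rewrite fg => *.
by congr MbMap; apply: Prop_irrelevance.
Qed.

Definition mbmap_id (X : mbsset) : mbmap X X :=
  @MbMap X X (smap_id X) (fun _ => id) (fun _ => id) (fun _ => id).
Definition mbmap_comp (X Y Z : mbsset) (g : mbmap Y Z) (f : mbmap X Y) :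
    mbmap X Z :=
  @MbMap X Z (smap_comp g f)
    (fun x h => mb_map_marked g (mb_map_marked f h))
    (fun x h => mb_map_thin g (mb_map_thin f h))
    (fun x h => mb_map_lean g (mb_map_lean f h)).

Definition mb_cat : category :=
  @Category mbsset mbmap mbmap_id mbmap_comp
    (fun X Y f => @mbmap_eq X Y (mbmap_comp (mbmap_id Y) f) f
      (fun _ _ => erefl))
    (fun X Y f => @mbmap_eq X Y (mbmap_comp f (mbmap_id X)) f
      (fun _ _ => erefl))
    (fun W X Y Z h g f => @mbmap_eq W Z (mbmap_comp h (mbmap_comp g f))
      (mbmap_comp (mbmap_comp h g) f) (fun _ _ => erefl)).

(* (X, E, T <= C); the members of T are added to C, so that when T is contained
   in C up to degenerate triangles, this is C with the degenerate ones. *)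
Definition mb_of (X : sset) (E : X 1 -> Prop) (T C : X 2 -> Prop) : mbsset :=
  @MbSSet X (with_degenerate E) (with_degenerate T)
    (fun x => with_degenerate T x \/ C x)
    (fun _ dx => or_introl dx) (fun _ dx => or_introl dx)
    (fun _ tx => or_introl tx).

Section MbOfMap.
Variables (X Y : sset) (f : smap X Y).
Variables (E : X 1 -> Prop) (T C : X 2 -> Prop).
Variables (E' : Y 1 -> Prop) (T' C' : Y 2 -> Prop).
Hypothesis hE : forall x, E x -> E' (f 1 x).
Hypothesis hT : forall x, T x -> T' (f 2 x).
Hypothesis hC : forall x, C x -> C' (f 2 x).

Lemma mb_of_map_marked x : with_degenerate E x -> with_degenerate E' (f 1 x).
Proof. by case=> [/degenerate_map|/hE]; [left|right]. Qed.

Lemma mb_of_map_lean x :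
  with_degenerate T x \/ C x -> with_degenerate T' (f 2 x) \/ C' (f 2 x).
Proof. by case=> [/(sc_of_map_subproof hT)|/hC]; [left|right]. Qed.

Definition mb_of_map : mbmap (mb_of E T C) (mb_of E' T' C') :=
  @MbMap (mb_of E T C) (mb_of E' T' C') f
    mb_of_map_marked (sc_of_map_subproof hT) mb_of_map_lean.
End MbOfMap.

Definition mb_restrict (X Y : sset) (f : smap X Y)
    (E : Y 1 -> Prop) (T C : Y 2 -> Prop) :
    mbmap (mb_of (preim_coll f E) (preim_coll f T) (preim_coll f C))
          (mb_of E T C) :=
  mb_of_map (f := f) (fun _ h => h) (fun _ h => h) (fun _ h => h).

Definition mb_enlarge (X : sset) (E E' : X 1 -> Prop) (T T' C C' : X 2 -> Prop)
    (hE : forall x, E x -> E' x) (hT : forall x, T x -> T' x)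
    (hC : forall x, C x -> C' x) : mbmap (mb_of E T C) (mb_of E' T' C') :=
  mb_of_map (f := smap_id X) hE hT hC.

Definition same (X : sset) n (P : X n -> Prop) x (h : P x) : P x := h.
Definition to_all (X : sset) n (P : X n -> Prop) x (h : P x) :
  @all_simp X n x := Logic.I.
Arguments same {X n P} x h.
Arguments to_all {X n P} x h.

Definition all_but n (s : seq nat) (x : simplex n 2) : Prop :=
  ~ faces [:: s] x.

Definition U0 : simplex 3 2 -> Prop := @all_but 3 [:: 1; 2; 3].
Definition U1 : simplex 3 2 -> Prop := @all_but 3 [:: 0; 2; 3].
Definition U2 : simplex 3 2 -> Prop := @all_but 3 [:: 0; 1; 3].
Definition U3 : simplex 3 2 -> Prop := @all_but 3 [:: 0; 1; 2].

Inductive MB_generator : mor_class mb_cat :=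
| A1 n (i : 'I_n.+1) : 2 <= n -> 0 < i < n ->
    let T := faces [:: [:: i.-1; nat_of_ord i; i.+1]] in
    @MB_generator _ _ (mb_restrict (sub_incl (horn i)) none T T)
| A2 :
    let hT := @faces_sub 4 2 _ _ T4_sub in
    @MB_generator _ _ (@mb_enlarge (simplex 4) none none _ _ _ _ same hT hT)
| A3 n : 2 <= n ->
    @MB_generator _ _ (mb_restrict (chorn0_incl n) none none
      (image_coll (csimplex_proj n) (faces [:: [:: 0; 1; n]])))
| A4 n : 2 <= n ->
    @MB_generator _ _ (mb_restrict (sub_incl (@horn n ord_max))
      (faces [:: [:: n.-1; n]]) none (faces [:: [:: 0; n.-1; n]]))
| A5 :
    @MB_generator _ _ (@mb_of_map (simplex 0) (simplex 1)
      (simplex_map (dconst 0 ord_max))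
      all_simp all_simp all_simp all_simp all_simp all_simp
      (fun _ => id) (fun _ => id) (fun _ => id))
| S1 :
    @MB_generator _ _ (@mb_enlarge (simplex 2)
      (faces [:: [:: 0; 1]; [:: 1; 2]]) all_simp
      all_simp all_simp all_simp all_simp to_all same same)
| S2 :
    @MB_generator _ _ (@mb_enlarge (simplex 2)
      none none none all_simp all_simp all_simp same to_all same)
| S3_1 :
    let T := faces [:: [:: 0; 1; 2]] in
    @MB_generator _ _ (@mb_enlarge (simplex 3)
      none none T T U1 all_simp same same to_all)
| S3_2 :
    let T := faces [:: [:: 1; 2; 3]] in
    @MB_generator _ _ (@mb_enlarge (simplex 3)
      none none T T U2 all_simp same same to_all)
| S4 :
    @MB_generator _ _ (@mb_enlarge (csimplex 3)
      none none none none (image_coll (csimplex_proj 3) U0) all_simp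
      same same to_all)
| S5 :
    let E := faces [:: [:: 2; 3]] in
    @MB_generator _ _ (@mb_enlarge (simplex 3)
      E E none none U3 all_simp same same to_all)
| SE (K : sset) : kan_complex K ->
    @MB_generator _ _ (@mb_enlarge K
      none all_simp all_simp all_simp all_simp all_simp to_all same same).

Definition MB_anodyne : mor_class mb_cat := saturation MB_generator.

(* (S, #, T_S <= #) *)
Definition mb_base (S : scsset) : mbsset :=
  @MbSSet S (fun _ => True) (@sc_thin S) (fun _ => True)
    (fun _ _ => Logic.I) (@sc_thin_deg S) (fun _ _ => Logic.I).

Definition two_cartesian_fibration (S : scsset) (X : mbsset)
    (p : mbmap X (mb_base S)) : Prop :=
  rlp (C := mb_cat) MB_anodyne p.

Definition mb_to_point (X : mbsset) : mbmap X (mb_base sc_point) :=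
  @MbMap X (mb_base sc_point) (to_simplex0 X) (fun _ _ => Logic.I)
    (fun _ _ => or_intror Logic.I) (fun _ _ => Logic.I).

Lemma sc_point_terminal : is_terminal (C := sc_cat) sc_point.
Proof.
move=> X; exists (sc_to_point X); split=> // f _.
by apply: scmap_eq => n x; apply: simplex0_uniq.
Qed.

Program Definition sc_empty : scsset :=
  @ScSSet (@SSet (fun _ => void) (fun _ _ _ x => x) _ _) (fun _ => True) _.

Lemma sc_empty_initial : is_initial (C := sc_cat) sc_empty.
Proof.
move=> X; have fP m n (f : delta m n) (x : sc_empty n) :
    match act f x return X m with end = act f (match x return X n with end).
  by case: x.
exists (@ScMap sc_empty X (SMap fP) (fun x : void => match x with end)).
by split=> // g _; apply: scmap_eq => n [].
Qed.

(* Hence mb simplicial sets over the point are just mb simplicial sets. *)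
Lemma mb_point_terminal : is_terminal (C := mb_cat) (mb_base sc_point).
Proof.
move=> X; exists (mb_to_point X); split=> // f _.
by apply: mbmap_eq => n x; apply: simplex0_uniq.
Qed.

(* A model structure is determined by its cofibrations and fibrant objects. *)
Definition is_lurie_model_structure (M : model_structure sc_cat) : Prop :=
  (forall (X Y : scsset) (f : scmap X Y),
     cof M (f : @hom sc_cat X Y) <-> monomorphism (C := sc_cat) f) /\
  (forall X : scsset, fibrant M X <-> infty_bicategory X).

Definition is_mb_model_structure_over_point (M : model_structure mb_cat) :
    Prop :=
  (forall (X Y : mbsset) (f : mbmap X Y),
     cof M (f : @hom mb_cat X Y) <->
     monomorphism (C := sset_cat) (mb_smap f)) /\
  (forall X : mbsset, fibrant M X <-> two_cartesian_fibration (mb_to_point X)).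

Definition L_ob (X : scsset) : mbsset :=
  @MbSSet X (@degenerate X 1) (@sc_thin X) (@sc_thin X)
    (fun _ => id) (@sc_thin_deg X) (fun _ => id).

Definition L_map (X Y : scsset) (f : scmap X Y) : mbmap (L_ob X) (L_ob Y) :=
  @MbMap (L_ob X) (L_ob Y) f (@degenerate_map X Y f 1)
    (@sc_mapP X Y f) (@sc_mapP X Y f).

Definition L : functor sc_cat mb_cat :=
  @Functor sc_cat mb_cat L_ob L_map (fun X => @mbmap_eq (L_ob X) (L_ob X)
      (L_map (scmap_id X)) (mbmap_id (L_ob X)) (fun _ _ => erefl))
    (fun X Y Z g f => @mbmap_eq (L_ob X) (L_ob Z) (L_map (scmap_comp g f))
      (mbmap_comp (L_map g) (L_map f)) (fun _ _ => erefl)).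

Definition U_ob (X : mbsset) : scsset :=
  @ScSSet X (@mb_thin X) (@mb_thin_deg X).

Definition U_map (X Y : mbsset) (f : mbmap X Y) : scmap (U_ob X) (U_ob Y) :=
  @ScMap (U_ob X) (U_ob Y) f (@mb_map_thin X Y f).

Definition U : functor mb_cat sc_cat :=
  @Functor mb_cat sc_cat U_ob U_map (fun X => @scmap_eq (U_ob X) (U_ob X)
      (U_map (mbmap_id X)) (scmap_id (U_ob X)) (fun _ _ => erefl))
    (fun X Y Z g f => @scmap_eq (U_ob X) (U_ob Z) (U_map (mbmap_comp g f))
      (scmap_comp (U_map g) (U_map f)) (fun _ _ => erefl)).

Definition LU_adj_fun (X : scsset) (Y : mbsset) (f : mbmap (L_ob X) Y) :
    scmap X (U_ob Y) :=
  @ScMap X (U_ob Y) f (@mb_map_thin (L_ob X) Y f).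

Lemma LU_inv_marked (X : scsset) (Y : mbsset) (f : smap X Y) (x : X 1) :
  degenerate x -> mb_marked (f 1 x).
Proof. by move/(degenerate_map f); apply: mb_marked_deg. Qed.

Definition LU_adj_inv (X : scsset) (Y : mbsset) (f : scmap X (U_ob Y)) :
    mbmap (L_ob X) Y :=
  @MbMap (L_ob X) Y f (@LU_inv_marked X Y f) (@sc_mapP X (U_ob Y) f)
    (fun x tx => mb_thin_lean (@sc_mapP X (U_ob Y) f x tx)).

Definition LU_adj : adjunction L U :=
  @Adjunction sc_cat mb_cat L U LU_adj_fun LU_adj_inv
    (fun X Y f => @mbmap_eq (L_ob X) Y (LU_adj_inv (LU_adj_fun f)) f
      (fun _ _ => erefl))
    (fun X Y f => @scmap_eq X (U_ob Y) (LU_adj_fun (LU_adj_inv f)) f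
      (fun _ _ => erefl))
    (fun X X' Y Y' f g h => @scmap_eq X' (U_ob Y')
      (LU_adj_fun (mbmap_comp (mbmap_comp h g) (L_map f)))
      (scmap_comp (scmap_comp (U_map h) (LU_adj_fun g)) f) (fun _ _ => erefl)).

(* Main.v *)
From mathcomp Require Import all_boot.
From mathcomp Require Import boolp zify.
Require Import Defs.

(* Let J be the nerve of the walking isomorphism, all of whose triangles are
   thin.  In both model structures the product with J (with all edges marked) is
   a cylinder.  For Y fibrant, (E) shows that a map from X x J to U(Y) is the same
   as a map from the cylinder of L(X) to Y; as U(Y) is an oo-bicategory, L
   preserves weak equivalences.

   In a fibrant Y all lean triangles are thin, and a marked edge extends to J: the
   simplices ...0101 of J are filled one after the other along horns (A4).  By (E),
   a scaled map between fibrant objects thus preserves marked edges, so that the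
   counit of a fibrant object is a weak equivalence.

   For L to reflect weak equivalences it remains to mark the edges of an
   oo-bicategory so that it becomes fibrant, and the point is that an edge e which
   extends to J satisfies (A4).  Given such a horn, with thin triangle 0, n-1, n,
   copies of the vertex n-1 are inserted, and joined to the vertices before them
   by thin triangles, until the face opposite to 0 is degenerate on e.  Then all
   triangles that do not contain 0 are thin, and going back and forth along J
   reduces the last horn to inner horns. *)

Set Implicit Arguments.
Unset Strict Implicit.
Unset Printing Implicit Defensive.

Local Open Scope cat_scope.

(** * Model categories *)

(** Of the two model structures only the cofibrations and the fibrant objects are given, so weak
    equivalences have to be recognized by maps into fibrant objects: it suffices that such maps
    extend along [i], and that any two extensions of one map are homotopic on the cylinder. Every
    comparison of [M] and [N] thereby becomes a statement about fibrant objects.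

    The marking put on an oo-bicategory is the largest one possible: an edge is marked when it has
    the lifting properties (A4) and (S5). These two generators then hold by definition, and the work
    moves to the degenerate edges, to (S1), which is closure under composition, and to (E). For (E),
    the extension of special edges to J is applied inside the Kan complex itself, where all
    triangles count as thin.

    Adding a copy of a vertex to a horn means extending a map from a subcomplex of Delta^n to a
    larger one. This is always done at one vertex v: the new faces pair off as a face containing v
    and the same face without v, and each pair is one horn at v. The delicate point is the thin
    triangle that each horn requires, which may itself be one of the new faces. *)

Section ModelCategory.
Variables (C : category) (M : model_structure C).

Lemma weq_idm (X : C) : weq M (idm X).
Proof.
have [Z [i [p [E _ _ wp]]]] := factor_cof_tfib M (idm X).
apply: (weq_retract _ wp); exists i, p, (idm X), (idm X).
by split; rewrite ?comp1m ?compm1.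
Qed.

(** Retract argument: [p] lifts against the first factor of its own factorization, and so is a
    retract of the second. *)
Lemma fib_of_lift (X Y : C) (p : hom X Y) :
  (forall (A B : C) (i : hom A B), cof M i -> weq M i -> has_lift i p) ->
  fib M p.
Proof.
move=> lp; have [Z [i [q [E ci wi fq]]]] := factor_tcof_fib M p.
have sq : p \* idm X = q \* i by rewrite compm1.
have [r [ri pr]] := lp _ _ i ci wi (idm X) q sq.
apply: (fib_retract _ fq); exists i, r, (idm Y), (idm Y).
by split; rewrite ?comp1m ?compm1.
Qed.

Lemma weq_of_lift (X Y : C) (p : hom X Y) :
  (forall (A B : C) (i : hom A B), cof M i -> has_lift i p) -> weq M p.
Proof.
move=> lp; have [Z [i [q [E ci fq wq]]]] := factor_cof_tfib M p.
have sq : p \* idm X = q \* i by rewrite compm1.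
have [r [ri pr]] := lp _ _ i ci (idm X) q sq.
apply: (weq_retract _ wq); exists i, r, (idm Y), (idm Y).
by split; rewrite ?comp1m ?compm1.
Qed.

Lemma fib_comp (X Y Z : C) (p : hom X Y) (q : hom Y Z) :
  fib M p -> fib M q -> fib M (q \* p).
Proof.
move=> fp fq; apply: fib_of_lift => A B i ci wi u v sq.
have [h [hi qh]] := lift_tcof_fib ci wi fq (etrans (compA q p u) sq).
have [k [ki pk]] := lift_tcof_fib ci wi fp (esym hi).
by exists k; rewrite ki -compA pk qh.
Qed.

Variables (T : C) (T_terminal : is_terminal T).

Lemma to_terminal_eq (X : C) (f g : hom X T) : f = g.
Proof. by have [h [_ hP]] := T_terminal X; rewrite -(hP f) // -(hP g). Qed.

Lemma fibrant_fib (X Y : C) (p : hom X Y) :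
  fib M p -> fibrant M Y -> fibrant M X.
Proof.
move=> fp fY S f S_terminal; have [t _] := S_terminal Y.
have -> : f = t \* p.
  by have [g [_ gP]] := S_terminal X; rewrite -(gP f) // -(gP (t \* p)).
by apply: fib_comp fp _; apply: fY.
Qed.

Lemma extend_tcof (A B Z : C) (i : hom A B) (u : hom A Z) :
  cof M i -> weq M i -> fibrant M Z -> exists h : hom B Z, h \* i = u.
Proof.
move=> ci wi fZ; have [t _] := T_terminal Z; have [s _] := T_terminal B.
have [h [hi _]] := lift_tcof_fib ci wi (fZ _ t T_terminal)
  (to_terminal_eq (t \* u) (s \* i)).
by exists h.
Qed.

Lemma fibrant_replacement (X : C) :
  exists (Y : C) (j : hom X Y), [/\ cof M j, weq M j & fibrant M Y].
Proof.
have [t _] := T_terminal X.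
have [Y [j [p [_ cj wj fp]]]] := factor_tcof_fib M t.
exists Y, j; split=> // S f S_terminal.
apply: fib_of_lift => A B i ci wi u v sq.
have [r _] := T_terminal B.
have [h [hi _]] := lift_tcof_fib ci wi fp (to_terminal_eq (p \* u) (r \* i)).
exists h; split=> //.
by have [g [_ gP]] := S_terminal B; rewrite -(gP v) // -(gP (f \* h)).
Qed.

(** * Homotopies on a natural cylinder *)

Variables (Cyl : C -> C) (cmap : forall A B : C, hom A B -> hom (Cyl A) (Cyl B)).
Variables (c0 c1 : forall A : C, hom A (Cyl A)) (pr : forall A, hom (Cyl A) A).
Hypothesis c0_nat : forall A B (f : hom A B), cmap f \* c0 A = c0 B \* f.
Hypothesis c1_nat : forall A B (f : hom A B), cmap f \* c1 A = c1 B \* f.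
Hypothesis pr_c0 : forall A, pr A \* c0 A = idm A.
Hypothesis pr_c1 : forall A, pr A \* c1 A = idm A.
Hypothesis weq_pr : forall A, weq M (pr A).
Hypothesis cof_c0 : forall A, cof M (c0 A).

Definition homotopic (A Z : C) (u v : hom A Z) : Prop :=
  exists H : hom (Cyl A) Z, H \* c0 A = u /\ H \* c1 A = v.

Lemma homotopic_refl (A Z : C) (u : hom A Z) : homotopic u u.
Proof. by exists (u \* pr A); rewrite -!compA pr_c0 pr_c1 compm1. Qed.

Lemma weq_c0 A : weq M (c0 A).
Proof.
by apply: (weq_cancell (g := pr A)) => //; rewrite pr_c0; apply: weq_idm.
Qed.

Lemma weq_c1 A : weq M (c1 A).
Proof.
by apply: (weq_cancell (g := pr A)) => //; rewrite pr_c1; apply: weq_idm.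
Qed.

Lemma weq_homotopic (A Z : C) (u v : hom A Z) :
  homotopic u v -> weq M u -> weq M v.
Proof.
move=> [H [<- <-]] wu; apply: weq_comp (weq_c1 A) _.
exact: weq_cancelr (weq_c0 A) wu.
Qed.

(* Factor j \* i = q \* k with j a fibrant replacement of B, k a trivial
   cofibration and q a fibration: the hypotheses produce a section s of q such
   that s \* q is a weak equivalence, and q is a retract of s \* q. *)
Lemma weq_of_extension (A B : C) (i : hom A B) :
  (forall (Z : C) (u : hom A Z), fibrant M Z -> exists h, h \* i = u) ->
  (forall (Z : C) (u v : hom B Z),
     fibrant M Z -> u \* i = v \* i -> homotopic u v) ->
  weq M i.
Proof.
move=> ext inj; have [B' [j [cj wj fB']]] := fibrant_replacement B.
have [A'' [k [q [E ck wk fq]]]] := factor_tcof_fib M (j \* i).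
have fA'' : fibrant M A'' by apply: fibrant_fib fq fB'.
have [r ri] := ext _ k fA''.
have /inj-/(_ fB') [H [H0 H1]] : (q \* r) \* i = j \* i.
  by rewrite -compA ri E.
(* The homotopy from [q \* r] to [j] lifts along [q], starting at [r]. Its other end is a lift of
   [j] through [q], which [s] extends to [B']. *)
have [H' [H'0 qH']] := lift_tcof_fib (cof_c0 B) (weq_c0 B) fq (esym H0).
have sq : q \* (H' \* c1 B) = idm B' \* j by rewrite compA qH' H1 comp1m.
have [s [sj qs]] := lift_tcof_fib cj wj fq sq.
have wsq : weq M (s \* q).
  (* Restricted along [i], the lifted homotopy joins [k = r \* i] to [s \* j \* i = s \* q \* k],
     and [k] is a weak equivalence. *)
  apply: (weq_cancelr wk); apply: (weq_homotopic (u := k)) => //.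
  exists (H' \* cmap i); split.
    by rewrite -compA c0_nat compA H'0.
  by rewrite -!compA c1_nat -E !compA sj.
have wq : weq M q.
  apply: (weq_retract _ wsq); exists (idm _), (idm _), s, q.
  by split; rewrite ?comp1m ?compm1 // compA qs comp1m.
by apply: (weq_cancell wj); rewrite E; apply: weq_comp.
Qed.

Hypothesis products : forall Z : C, exists (P : C) (p0 p1 : hom P Z),
  (forall W (u v : hom W Z), exists w, p0 \* w = u /\ p1 \* w = v) /\
  (forall W (w w' : hom W P), p0 \* w = p0 \* w' -> p1 \* w = p1 \* w' -> w = w').

Hypothesis codiagonal : forall B : C,
  exists (S : C) (j0 j1 : hom B S) (c : hom S (Cyl B)),
  [/\ forall W (u v : hom B W), exists w, w \* j0 = u /\ w \* j1 = v,
      forall W (w w' : hom S W), w \* j0 = w' \* j0 -> w \* j1 = w' \* j1 -> w = w',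
      cof M c & c \* j0 = c0 B /\ c \* j1 = c1 B].

(** A path object [PZ] gives a right homotopy [h] from [u] to [v], by lifting [i] against the
    fibration from [PZ] to the product. The constant path at [u] on one end of the cylinder and [h]
    on the other extend to the whole cylinder, because the first projection of [PZ] is a trivial
    fibration. The second projection makes this a left homotopy. *)
Lemma homotopic_of_tcof (A B Z : C) (i : hom A B) (u v : hom B Z) :
  cof M i -> weq M i -> fibrant M Z -> u \* i = v \* i -> homotopic u v.
Proof.
move=> ci wi fZ uv.
have [P [p0 [p1 [pair pair_eq]]]] := products Z.
(* [p0] is a base change of the map from [Z] to the terminal object. *)
have fp0 : fib M p0.
  apply: fib_of_lift => A' B' i' ci' wi' u' v' sq.
  have [x xi] := extend_tcof (p1 \* u') ci' wi' fZ.
  have [w [w0 w1]] := pair _ v' x.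
  by exists w; split=> //; apply: pair_eq; rewrite compA ?w0 ?w1.
have [diag [diag0 diag1]] := pair _ (idm Z) (idm Z).
have [PZ [d [pp [dE cd wd fpp]]]] := factor_tcof_fib M diag.
have fq0 : fib M (p0 \* pp) by apply: fib_comp.
have d0 : p0 \* pp \* d = idm Z by rewrite -compA -dE.
have d1 : p1 \* pp \* d = idm Z by rewrite -compA -dE.
have wq0 : weq M (p0 \* pp).
  by apply: (weq_cancelr wd); rewrite d0; apply: weq_idm.
have [uv' [uv0 uv1]] := pair _ u v.
have sq : pp \* (d \* (u \* i)) = uv' \* i.
  apply: pair_eq.
    by rewrite !compA d0 comp1m uv0.
  by rewrite !compA d1 comp1m uv1.
have [h [hi ph]] := lift_tcof_fib ci wi fpp sq.
have [S [j0 [j1 [c [copair copair_eq cc [cj0 cj1]]]]]] := codiagonal B.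
have [w [w0 w1]] := copair _ (d \* u) h.
have sq' : p0 \* pp \* w = u \* pr B \* c.
  apply: copair_eq; rewrite -!compA ?w0 ?w1 ?cj0 ?cj1 ?pr_c0 ?pr_c1 compm1.
    by rewrite !compA d0 comp1m.
  by rewrite ph uv0.
have [K [Kc _]] := lift_cof_tfib cc fq0 wq0 sq'.
exists (p1 \* pp \* K); split.
  by rewrite -compA -cj0 [K \* _]compA Kc w0 !compA d1 comp1m.
by rewrite -compA -cj1 [K \* _]compA Kc w1 -compA ph.
Qed.

End ModelCategory.

(** * Lifting along transfinite compositions *)

Section TransfiniteLifting.
Variables (C : category) (X Z : C) (p : hom X Z).
Variables (I : Type) (lt : I -> I -> Prop) (F : chain C lt) (o : I).
Hypothesis lt_wo : is_well_order lt.
Hypothesis o_min : forall i, ~ lt i o.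
Hypothesis F_succ : forall i j (ij : lt i j),
  is_succ lt i j -> has_lift (chain_map F ij) p.
Hypothesis F_lim : forall j, is_limit lt j ->
  is_chain_colimit (P := fun i => lt i j) (fun i ij => chain_map F ij).
Variables (u : hom (F o) X) (v : forall i, hom (F i) Z).
Hypothesis v_nat : forall i j (ij : lt i j), v j \* chain_map F ij = v i.
Hypothesis pu : p \* u = v o.

(** The lift at [j] is defined by well-founded recursion, but it exists only if the lifts below [j]
    are compatible. Hence the optional values: [step] chooses a good lift if there is one, and
    [lift_good] shows afterwards that there always is. *)
Let good j (below : forall i, lt i j -> option (hom (F i) X)) (h : hom (F j) X) :=
  [/\ p \* h = v j, (forall e : o = j, h = ecast k (hom (F k) X) e u)
    & forall i (ij : lt i j), below i ij = Some (h \* chain_map F ij)].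

Let step j (below : forall i, lt i j -> option (hom (F i) X)) :
    option (hom (F j) X) :=
  if pselect (exists h, good below h) is left H then Some (sval (cid H))
  else None.

Let lt_wf : well_founded lt. Proof. by case: lt_wo. Qed.

Let lift : forall j, option (hom (F j) X) := Fix lt_wf _ step.

Let liftE j : lift j = step (fun i _ => lift i).
Proof.
rewrite /lift Fix_eq // => x f g fg; congr step.
by apply: functional_extensionality_dep => y;
  apply: functional_extensionality_dep => yx.
Qed.

Let lift_good j : exists2 h, lift j = Some h & good (fun i (_ : lt i j) => lift i) h.
Proof.
elim/(well_founded_ind lt_wf): j => j IH.
suff H : exists h, good (fun i (_ : lt i j) => lift i) h.
  rewrite liftE /step; case: pselect => // H'.
  by exists (sval (cid H')) => //; case: (cid H').
have [_ lt_trans lt_total] := lt_wo.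
have [oj|oj] := pselect (o = j).
  case: j / oj IH => IH; exists u; split=> // [e|i io]; last by case: (o_min io).
  by rewrite (Prop_irrelevance e erefl).
have lt_oj : lt o j by case: (lt_total o j) => // jo; case: (o_min jo).
have below i : lt i j -> {h | lift i = Some h /\ good (fun k (_ : lt k i) => lift k) h}.
  by move=> ij; apply: cid; have [h] := IH i ij; exists h.
have below_nat i k (ik : lt i k) (ij : lt i j) (kj : lt k j) :
    sval (below k kj) \* chain_map F ik = sval (below i ij).
  case: (below k kj) (below i ij) => h [_ [_ _ /(_ i ik) hik]] [h' [h'E _]] /=.
  by move: hik; rewrite h'E => -[].
have belowE i (ij : lt i j) : lift i = Some (sval (below i ij)).
  by case: (below i ij) => h /= [].
have below_p i (ij : lt i j) : p \* sval (below i ij) = v i.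
  by case: (below i ij) => h /= [_ [ph _ _]].
(* Beyond [o], a successor uses the lifting property of its step, and a limit glues the lifts below
   it. *)
have [[i ij]|jlim] := pselect (exists i, is_succ lt i j).
  have [lt_ij no] := ij.
  have sq : p \* sval (below i lt_ij) = v j \* chain_map F lt_ij.
    by rewrite v_nat below_p.
  have [h [hi ph]] := F_succ ij sq.
  exists h; split=> // k kj; rewrite belowE.
  have [ki|e|ik] := lt_total k i; last by case: (no k).
    by rewrite (chain_comp F ki lt_ij) compA hi (below_nat _ _ ki kj lt_ij).
  by case: i / e lt_ij hi {ij no sq} => lt_ij hi;
    rewrite (Prop_irrelevance kj lt_ij) hi.
have [|_ univ] := @F_lim j.
  by split=> [|i ij]; [exists o|apply: jlim; exists i].
have [h [hE _]] := univ X (fun i ij => sval (below i ij))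
  (fun i k ik ij kj => below_nat i k ik ij kj).
exists h; split=> // [|i ij]; last by rewrite belowE hE.
have [w [_ w_uniq]] := univ Z (fun i _ => v i) (fun i k ik _ _ => v_nat ik).
rewrite -(w_uniq (v j)) => [|i ij]; last exact: v_nat.
by rewrite -(w_uniq (p \* h)) // => i ij; rewrite -compA hE below_p.
Qed.

Lemma transfinite_lift : exists h : forall i, hom (F i) X,
  [/\ h o = u, forall i, p \* h i = v i
    & forall i j (ij : lt i j), h j \* chain_map F ij = h i].
Proof.
pose h j := sval (cid2 (lift_good j)).
have hE j : lift j = Some (h j) by rewrite /h; case: cid2.
have hG j : good (fun i (_ : lt i j) => lift i) (h j) by rewrite /h; case: cid2.
exists h; split=> [|i|i j ij].
- by have [_ /(_ erefl)] := hG o.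
- by have [] := hG i.
- by have [_ _ /(_ i ij)] := hG j; rewrite hE => -[].
Qed.

End TransfiniteLifting.

(** The maps with the left lifting property against [p] form a weakly saturated class. *)
Lemma saturation_lift (C : category) (G : mor_class C) (X Z : C) (p : hom X Z) :
  rlp G p -> rlp (saturation G) p.
Proof.
move=> Gp A B i satGi; apply: (satGi (fun A B f => has_lift f p)) => {A B i satGi} //.
split=> {Gp}.
- move=> A B A' B' f g g' f' [sq univ] fp u v puv.
  have [|h [hf ph]] := fp (u \* g) (v \* g').
    by rewrite compA puv -!compA sq.
  have [k [[kg kf] _]] := univ _ h u hf.
  exists k; split=> //.
  have [w [_ w_uniq]] := univ _ (v \* g') (v \* f')
    (etrans (esym (compA _ _ _)) (etrans (congr1 _ sq) (compA _ _ _))).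
  rewrite -(w_uniq v) // -(w_uniq (p \* k)) //.
  by rewrite -!compA kg kf.
- move=> I lt F o lt_wo o_min F_succ F_lim Y c [c_nat c_univ] u v puv.
  have vc_nat i j (ij : lt i j) : v \* c j Logic.I \* chain_map F ij = v \* c i Logic.I.
    by rewrite -compA (c_nat _ _ ij Logic.I Logic.I).
  have [h [ho ph h_nat]] := transfinite_lift lt_wo o_min F_succ F_lim vc_nat puv.
  have [k [kP _]] := c_univ X (fun i _ => h i) (fun i j ij _ _ => h_nat i j ij).
  exists k; split; first by rewrite kP.
  have [w [_ w_uniq]] := c_univ Z (fun i _ => v \* c i Logic.I)
    (fun i j ij _ _ => vc_nat i j ij).
  rewrite -(w_uniq v) => [|i []] //; rewrite -(w_uniq (p \* k)) // => i [].
  by rewrite -compA kP ph.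
- move=> A B X' Y' f g [i [r [j [s [ri sj gi fr]]]]] gp u v puv.
  have [|h [hg ph]] := gp (u \* r) (v \* s).
    by rewrite compA puv -!compA fr.
  exists (h \* j); rewrite -!compA -gi [h \* _]compA hg -compA ri compm1.
  by rewrite compA ph -compA sj compm1.
Qed.

(** * Simplicial operators and partial simplices *)

Lemma delta_mono m n (f : delta m n) (i j : 'I_m.+1) : i <= j -> f i <= f j.
Proof. exact: (monotonebP _ (dfunP f)). Qed.

Lemma dcompE m n p (g : delta n p) (f : delta m n) i : dcomp g f i = g (f i).
Proof. by rewrite ffunE. Qed.

Lemma delta_ext m n (f g : delta m n) :
  (forall i, f i = g i :> nat) -> f = g.
Proof. by move=> fg; apply: delta_eq => i; apply: val_inj; apply: fg. Qed.

(* The running maximum makes [dmk m n f] monotone for every [f]; it is the map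
   [f] itself as soon as [f] is monotone on [0, m] with values in [0, n]. *)
Lemma dmk_subproof m n (f : nat -> nat) :
  monotoneb [ffun k : 'I_m.+1 => inord (minn n (\max_(i < k.+1) f i)) : 'I_n.+1].
Proof.
apply/monotonebP => i j ij; rewrite !ffunE !inordK ?ltnS ?geq_minl //.
rewrite leq_min geq_minl /=; apply: leq_trans (geq_minr _ _) _.
apply/bigmax_leqP => k _.
have kj : k < j.+1 by apply: leq_trans (ltn_ord k) _.
exact: (leq_bigmax (Ordinal kj)).
Qed.
Definition dmk m n (f : nat -> nat) : delta m n := Delta (dmk_subproof m n f).

Lemma dmkE m n (f : nat -> nat) (k : 'I_m.+1) :
  (forall i j, i <= j <= m -> f i <= f j) -> f m <= n ->
  dmk m n f k = f k :> nat.
Proof.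
move=> f_mono fm; have km : k <= m by rewrite -ltnS.
rewrite ffunE inordK ?ltnS ?geq_minl //.
have -> : \max_(i < k.+1) f i = f k.
  apply/eqP; rewrite eqn_leq; apply/andP; split.
    by apply/bigmax_leqP => i _; apply: f_mono; rewrite -ltnS ltn_ord.
  exact: (leq_bigmax (Ordinal (ltnSn k))).
by apply/minn_idPr; apply: leq_trans (f_mono _ _ _) fm; rewrite km leqnn.
Qed.

(** Operators are written as lists of vertices, so that faces and composites of concrete operators
    are found by computation. The default 0 of [nth] is never reached when [dlist_ok] holds. *)
Definition dlist m n (s : seq nat) : delta m n := dmk m n (nth 0 s).

Definition dlist_ok m n (s : seq nat) : bool :=
  [&& size s == m.+1, sorted leq s & all (fun i => i <= n) s].

Lemma dlistE m n s (k : 'I_m.+1) :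
  dlist_ok m n s -> dlist m n s k = nth 0 s k :> nat.
Proof.
case/and3P=> /eqP sz so al; rewrite dmkE // => [i j /andP [ij jm]|].
  by apply: (sorted_leq_nth leq_trans leqnn) => //; rewrite inE sz; lia.
by apply: (allP al); rewrite mem_nth // sz.
Qed.

Definition edge n x y := dlist 1 n [:: x; y].
Definition tri n x y z := dlist 2 n [:: x; y; z].
Definition tet n x y z w := dlist 3 n [:: x; y; z; w].

Lemma dlist_comp m n p s t : dlist_ok n p s -> dlist_ok m n t ->
  dcomp (dlist n p s) (dlist m n t) = dlist m p [seq nth 0 s i | i <- t].
Proof.
move=> sok tok; have /and3P [/eqP ssz sso sal] := sok.
have /and3P [/eqP tsz tso tal] := tok.
have st_ok : dlist_ok m p [seq nth 0 s i | i <- t].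
  apply/and3P; split; first by rewrite size_map tsz.
    apply: (homo_sorted_in _ (allss t)) tso => i j it jt ij.
    apply: (sorted_leq_nth leq_trans leqnn) => //; rewrite inE ssz ltnS;
      exact: (allP tal).
  apply/allP => _ /mapP [i it ->]; apply: (allP sal); apply: mem_nth.
  by rewrite ssz ltnS; apply: (allP tal).
apply: delta_ext => k; rewrite dcompE !dlistE // (nth_map 0) ?tsz ?ltn_ord //.
Qed.

Lemma dlist_eq m n (f : delta m n) s :
  dlist_ok m n s -> (forall k : 'I_m.+1, f k = nth 0 s k :> nat) ->
  f = dlist m n s.
Proof. by move=> sok E; apply: delta_ext => k; rewrite dlistE. Qed.

Lemma dcomp_dlist m n p (f : delta n p) t : dlist_ok m n t ->
  dcomp f (dlist m n t) = dlist m p [seq val (f (inord i)) | i <- t].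
Proof.
move=> tok; have /and3P [/eqP tsz tso tal] := tok.
apply: dlist_eq => [|k].
  apply/and3P; split; first by rewrite size_map tsz.
    apply: (homo_sorted_in _ (allss t)) tso => i j it jt ij.
    by apply: delta_mono; rewrite !inordK // ltnS; exact: (allP tal).
  by apply/allP => _ /mapP [i it ->]; rewrite /= -ltnS ltn_ord.
rewrite dcompE (nth_map 0) ?tsz ?ltn_ord //=; congr (val (f _)).
apply: val_inj; rewrite [RHS]inordK; first exact: dlistE.
by rewrite ltnS; apply: (allP tal); rewrite mem_nth // tsz.
Qed.

Lemma tri_ok n x y z : dlist_ok 2 n [:: x; y; z] = (x <= y <= z) && (z <= n).
Proof. by rewrite /dlist_ok /=; lia. Qed.

Lemma edge_ok n x y : dlist_ok 1 n [:: x; y] = (x <= y <= n).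
Proof. by rewrite /dlist_ok /=; lia. Qed.

Lemma tet_ok n x y z w :
  dlist_ok 3 n [:: x; y; z; w] = (x <= y <= z) && (z <= w <= n).
Proof. by rewrite /dlist_ok /=; lia. Qed.

Lemma degenerate_tri (X : sset) n (s : X n) x y z :
  x <= y <= z -> z <= n -> (x == y) || (y == z) -> degenerate (act (tri n x y z) s).
Proof.
move=> xyz zn; have xy_ok : dlist_ok 1 n [:: x; z] by rewrite edge_ok; lia.
case/orP => /eqP e.
  exists 1, (dlist 2 1 [:: 0; 0; 1]), (act (edge n x z) s); split=> //.
  by rewrite -act_comp dlist_comp //= e.
exists 1, (dlist 2 1 [:: 0; 1; 1]), (act (edge n x z) s); split=> //.
by rewrite -act_comp dlist_comp //= e.
Qed.

Lemma deltaE m n (f : delta m n) :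
  f = dlist m n [seq val (f (inord i)) | i <- iota 0 m.+1].
Proof.
rewrite -[in LHS](dcompm1 f).
have ok : dlist_ok m m (iota 0 m.+1).
  apply/and3P; split; rewrite ?size_iota ?iota_sorted //.
  by apply/allP => i; rewrite mem_iota; lia.
rewrite -dcomp_dlist //; congr dcomp; apply: dlist_eq => // k.
by rewrite ffunE nth_iota // ltnS -ltnS.
Qed.

Lemma delta_ok m n (f : delta m n) :
  dlist_ok m n [seq val (f (inord i)) | i <- iota 0 m.+1].
Proof.
apply/and3P; split; first by rewrite size_map size_iota.
  apply: (homo_sorted_in _ (allss _)) (iota_sorted 0 m.+1) => i j.
  by rewrite !mem_iota /= => im jm ij; apply: delta_mono; rewrite !inordK.
by apply/allP => _ /mapP [i it ->]; rewrite /= -ltnS ltn_ord.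
Qed.

Lemma triE n (f : delta 2 n) :
  exists x y z, [/\ f = tri n x y z, x <= y <= z & z <= n].
Proof.
exists (f (inord 0)), (f (inord 1)), (f (inord 2)); split; first exact: deltaE.
  by have := delta_ok f; rewrite /= tri_ok => /andP [].
by rewrite -ltnS ltn_ord.
Qed.

(** A face of Delta^n is named by its set of vertices, as a predicate on [nat]: incidence conditions
    then become linear arithmetic. *)
Definition hit m n (f : delta m n) : pred nat :=
  fun k => [exists i, f i == k :> nat].

Lemma hitP m n (f : delta m n) k : reflect (exists i, f i = k :> nat) (hit f k).
Proof. by apply: (iffP existsP) => -[i fi]; exists i; apply/eqP. Qed.

Lemma hit_le m n (f : delta m n) k : hit f k -> k <= n.
Proof. by case/hitP => i <-; rewrite -ltnS. Qed.

Lemma hit_f m n (f : delta m n) i : hit f (f i).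
Proof. by apply/hitP; exists i. Qed.

Lemma hit_comp m n p (g : delta n p) (f : delta m n) k :
  hit (dcomp g f) k -> hit g k.
Proof. by case/hitP => i <-; rewrite dcompE; apply: hit_f. Qed.

Lemma hit_dlist m n s k : dlist_ok m n s -> hit (dlist m n s) k = (k \in s).
Proof.
move=> sok; have /and3P [/eqP ssz _ _] := sok; apply/hitP/idP => [[i <-]|].
  by rewrite dlistE // mem_nth // ssz.
move=> ks; have lt_k : index k s < m.+1 by rewrite -ssz index_mem.
by exists (Ordinal lt_k); rewrite dlistE //= nth_index.
Qed.

Lemma hit_tri n x y z k : x <= y <= z -> z <= n ->
  hit (tri n x y z) k = (k \in [:: x; y; z]).
Proof. by move=> xyz zn; rewrite hit_dlist // tri_ok xyz. Qed.

(** These are the subcomplexes of Delta^n, given by the vertex sets of their faces. *)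
Definition family (P : pred nat -> Prop) : Prop :=
  forall a b : pred nat, (forall k, a k -> b k) -> P b -> P a.

(* A map from the subcomplex of Delta^n with faces in [P] to [X] is encoded by
   its values on all simplices of Delta^n, those outside of the subcomplex
   being irrelevant. *)
Definition natural_on (X : sset) n (P : pred nat -> Prop)
    (g : forall m, delta m n -> X m) : Prop :=
  forall m p (f : delta m p) (a : delta p n),
    P (hit a) -> g m (dcomp a f) = act f (g p a).

Definition misses n i : pred nat -> Prop :=
  fun a => exists j, [/\ j <= n, j <> i & ~~ a j].

Lemma misses_hornP n (i : 'I_n.+1) m (x : delta m n) :
  misses n i (hit x) <-> horn i m x.
Proof.
split=> [[j [jn ji xj]]|/existsP [j /andP [ji /forallP xj]]].
  have jn' : j < n.+1 by rewrite ltnS.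
  apply/existsP; exists (Ordinal jn'); apply/andP; split.
    by apply/eqP => e; apply: ji; rewrite -e.
  apply/forallP => k; apply: contra xj => /eqP xk.
  by apply/hitP; exists k; rewrite xk.
exists j; split; first by rewrite -ltnS.
  by move/val_inj => e; rewrite e eqxx in ji.
by apply/hitP => -[k /val_inj xk]; have /eqP := xj k.
Qed.

Definition fills (X : sset) n i (h : forall m, delta m n -> X m) (k : X n) :=
  forall m (b : delta m n), misses n i (hit b) -> act b k = h m b.

Lemma family_ext P (a b : pred nat) : family P -> a =1 b -> P a -> P b.
Proof. by move=> Pf ab; apply: Pf => k; rewrite ab. Qed.

Definition dinj m n (f : delta m n) : Prop := injective f.

(** A value may have several preimages under [d]; choosing the least one makes the factor
    monotone. *)
Lemma factor_hit m p n (d : delta p n) (a : delta m n) :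
  (forall k, hit a k -> hit d k) -> exists b, a = dcomp d b.
Proof.
move=> ad; pose ex_pre k := hitP _ _ (ad _ (hit_f a k)).
pose P k i := d i == a k.
have exP k : exists i, P k i.
  by have [i di] := ex_pre k; exists i; apply/eqP/val_inj.
pose c k : 'I_p.+1 := [arg min_(i < xchoose (exP k) | P k i) i].
have cP k : d (c k) = a k.
  by rewrite /c; case: arg_minnP => [|i /eqP //]; apply: xchooseP.
have c_mono : monotoneb [ffun k : 'I_m.+1 => c k].
  apply/monotonebP => i j ij; rewrite !ffunE leqNgt; apply/negP => ji.
  have : d (c j) <= d (c i) by apply: delta_mono; apply: ltnW.
  rewrite !cP => aji; have aij : a i = a j.
    by apply: val_inj; apply/eqP; rewrite eqn_leq aji delta_mono.
  move: ji; rewrite ltnNge {1}/c; case: arg_minnP; first exact: xchooseP.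
  by move=> k _ /(_ (c j)) -> //; rewrite /P cP aij.
exists (Delta c_mono); apply: delta_ext => k; rewrite dcompE /= ffunE.
by rewrite cP.
Qed.

Lemma dcomp_inj m p n (d : delta p n) (b b' : delta m p) :
  dinj d -> dcomp d b = dcomp d b' -> b = b'.
Proof.
move=> d_inj e; apply: delta_eq => k; apply: d_inj.
by rewrite -!dcompE e.
Qed.

Lemma enum_delta n (a : pred nat) k0 : a k0 -> (forall k, a k -> k <= n) ->
  exists p (d : delta p n), dinj d /\ hit d =1 a.
Proof.
move=> ak0 an; pose l := [seq k <- iota 0 n.+1 | a k].
have lE k : (k \in l) = a k.
  rewrite mem_filter mem_iota; case ak: (a k) => //=; exact: an.
have l_sz : size l = (size l).-1.+1 by move: (lE k0); rewrite ak0; case: (l).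
have l_ok : dlist_ok (size l).-1 n l.
  apply/and3P; split; first by rewrite -l_sz.
    by apply: sorted_filter (iota_sorted _ _); apply: leq_trans.
  by apply/allP => k; rewrite lE; apply: an.
exists (size l).-1, (dlist (size l).-1 n l); split=> [i j e|k].
  apply/val_inj/eqP; rewrite -(nth_uniq 0 _ _ (s := l)) ?filter_uniq ?iota_uniq //;
    try by rewrite [X in _ < X]l_sz ltn_ord.
  by rewrite -(dlistE i l_ok) -(dlistE j l_ok) e.
by rewrite hit_dlist.
Qed.

(** * Extending a partial map by filling horns at one vertex *)

Section ConeExtension.
Variables (X : sset) (thin : X 2 -> Prop) (n v : nat) (vn : v <= n).
Variables (P Q : pred nat -> Prop) (g : forall m, delta m n -> X m).
Hypothesis familyP : family P.
Hypothesis familyQ : family Q.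
Hypothesis PQ : forall a, P a -> Q a.
Hypothesis add_v : forall a, Q a -> ~ P a -> Q (predU1 v a).
Hypothesis drop_v : forall a, Q a -> ~ P a -> ~ P (predD1 a v).
Hypothesis g_nat : natural_on P g.

(** Thinness is recorded for the new triangles through [v], because the thin triangle required by a
    later horn at [v] contains [v]. *)
Definition cone_stage (R : pred nat -> Prop) (h : forall m, delta m n -> X m) :=
  [/\ family R, (forall a, P a -> R a) & natural_on R h] /\
  [/\ forall m (t : delta m n), P (hit t) -> h m t = @g m t
    & forall t : delta 2 n, R (hit t) -> ~ P (hit t) -> hit t v ->
        dinj t -> thin (h 2 t)].

Hypothesis fill : forall R h, cone_stage R h -> (forall a, R a -> Q a) ->
  forall p (d : delta p n) (i : 'I_p.+1), dinj d -> d i = v :> nat ->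
    Q (hit d) -> ~ P (hit d) ->
    (forall m (b : delta m p), misses p i (hit b) -> R (hit (dcomp d b))) ->
    exists2 k : X p, fills i (fun m b => h m (dcomp d b)) k
      & p = 2 -> forall t : delta 2 p, dinj t -> thin (act t k).

Let face (s : {set 'I_n.+1}) : pred nat := fun k => [exists i in s, i == k :> nat].

Let face_le s k : face s k -> k <= n.
Proof. by case/existsP => i /andP [_ /eqP <-]; rewrite -ltnS. Qed.

Let face_mem s (i : 'I_n.+1) : face s i = (i \in s).
Proof.
apply/existsP/idP => [[j /andP [js /eqP /val_inj <-]] //|si].
by exists i; rewrite si /=.
Qed.

Let set_of (a : pred nat) : {set 'I_n.+1} := [set i : 'I_n.+1 | a i].

Let set_ofE (a : pred nat) : (forall k, a k -> k <= n) -> face (set_of a) =1 a.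
Proof.
move=> an k; apply/idP/idP => [ak|ak].
  have kn : k < n.+1 by rewrite ltnS (face_le ak).
  by move: ak; rewrite -[k]/(val (Ordinal kn)) face_mem inE.
have kn : k < n.+1 by rewrite ltnS an.
by rewrite -[k]/(val (Ordinal kn)) face_mem inE.
Qed.

Let missing (R : pred nat -> Prop) : {set {set 'I_n.+1}} :=
  [set s | `[< Q (face s) /\ ~ R (face s) >]].

Let stage_step R h : cone_stage R h -> (forall a, R a -> Q a) ->
  (forall a, Q a -> ~ R a -> ~ R (predD1 a v)) ->
  forall s, Q (face s) -> ~ R (face s) -> face s v ->
  (forall j, j <> v -> face s j -> R (predD1 (face s) j)) ->
  exists h', cone_stage (fun a => R a \/ forall k, a k -> face s k) h'.
Proof.
move=> st RQ drop_vR s Qs nRs sv faceR; have [[Rf PR h_nat] [hg h_thin]] := st.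
have [p [d [d_inj ds]]] := enum_delta sv (@face_le s).
have [i di] : exists i, d i = v :> nat by apply/hitP; rewrite ds.
have Qd : Q (hit d) by apply: family_ext Qs => // k; rewrite ds.
have nPd : ~ P (hit d).
  by move=> /(family_ext familyP ds) /PR.
have dR m (b : delta m p) : misses p i (hit b) -> R (hit (dcomp d b)).
  move=> [j [jp ji bj]]; have jp' : j < p.+1 by [].
  pose j' := Ordinal jp'; apply: (Rf _ _ _ (faceR (d j') _ _)).
  - move=> k kb; rewrite /= -ds (hit_comp kb) andbT.
    apply: contra bj => /eqP e; move: kb => /hitP [l]; rewrite dcompE e.
    by move=> /val_inj /d_inj lj; apply/hitP; exists l; rewrite lj.
  - by rewrite -di => /val_inj /d_inj e; apply: ji; rewrite -e.
  - by rewrite -ds hit_f.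
have [k k_fills k_thin] := fill st RQ d_inj di Qd nPd dR.
pose h' m (a : delta m n) : X m :=
  if pselect (R (hit a)) then h m a else
  if pselect (exists b, a = dcomp d b) is left H then act (sval (cid H)) k
  else h m a.
have h'R m (a : delta m n) : R (hit a) -> h' m a = h m a.
  by rewrite /h'; case: pselect.
(* The two definitions agree: a simplex of the face [s] that is in [R] lies in the horn, for
   otherwise it hits all vertices of [s] but possibly [v], and the face of [s] opposite to [v] would
   be in [R]. *)
have h'd m (b : delta m p) : h' m (dcomp d b) = act b k.
  rewrite /h'; case: pselect => [Rdb|nRdb].
    rewrite k_fills //; apply: contrapT => nmiss.
    apply: (drop_vR _ Qs nRs); apply: Rf Rdb => l /andP [lv].
    rewrite -ds => /hitP [j dj]; rewrite -dj; apply/hitP.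
    have : hit b j.
      apply: contrapT => bj; apply: nmiss; exists j; split.
      - by rewrite -ltnS.
      - by move=> /val_inj e; move: lv; rewrite -dj e di eqxx.
      - exact/negP.
    by case/hitP => j' /val_inj bj'; exists j'; rewrite dcompE bj'.
  case: pselect => [H|[]]; last by exists b.
  by case: (cid H) => b' /= /(dcomp_inj d_inj) ->.
exists h'; split; split.
- move=> a b ab [Rb|bs]; [left; apply: Rf Rb => //|right=> l /ab; exact: bs].
- by move=> a /PR; left.
- move=> m q f a [Ra|as_]; first by rewrite !h'R ?h_nat //;
    apply: Rf Ra => l; apply: hit_comp.
  have [b ->] : exists b, a = dcomp d b.
    by apply: factor_hit => l /as_; rewrite ds.
  by rewrite -dcompA !h'd act_comp.
- by move=> m t Pt; rewrite h'R ?hg //; apply: PR.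
move=> t [Rt|ts] nPt tv t_inj.
  by rewrite h'R //; apply: h_thin.
have [Rt|nRt] := pselect (R (hit t)).
  by rewrite h'R //; apply: h_thin.
have [b tE] : exists b, t = dcomp d b.
  by apply: factor_hit => l /ts; rewrite ds.
have b_inj : dinj b by move=> x y e; apply: t_inj; rewrite tE !dcompE e.
rewrite tE h'd; apply: (k_thin _ b b_inj).
(* A new triangle through [v] is all of [s]: if it missed another vertex of [s], it would be in [R].
   Hence [p = 2]. *)
have b_surj (j : 'I_p.+1) : j \in codom b.
  apply: contrapT => bj.
  have [jv|jv] := eqVneq (d j : nat) v.
    apply: bj; case/hitP: tv => l tl; rewrite -(_ : b l = j) ?codom_f //.
    by apply: d_inj; apply: val_inj; rewrite /= -dcompE -tE jv.
  apply: nRt; apply: (Rf _ _ _ (faceR (d j) _ _)).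
  - move=> l tl; rewrite /= ts // andbT; apply: contra_notN bj => /eqP le.
    case/hitP: tl => x; rewrite tE dcompE le => /val_inj /d_inj <-.
    exact: codom_f.
  - exact/eqP.
  - by rewrite -ds hit_f.
have: #|codom b| = #|'I_p.+1| by apply: eq_card => j; rewrite b_surj.
by rewrite (card_codom b_inj) !card_ord => -[].
Qed.

(** By [add_v] and [drop_v], the faces of [Q] outside of [P] come in pairs, one containing [v] and
    the same one without [v]. A pair is added by filling the horn at [v] of its larger member. A
    missing face through [v] with the least number of vertices is always ready for this. *)
Lemma cone_extension : exists h, cone_stage Q h.
Proof.
suff H : forall c R h, #|missing R| < c -> cone_stage R h ->
    (forall a, R a -> Q a) -> (forall a, Q a -> ~ R a -> ~ R (predD1 a v)) ->
    exists h, cone_stage Q h.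
  have st : cone_stage P (@g) by split; split=> // t Pt nPt.
  exact: H (leqnn _) st PQ drop_v.
elim=> // c IH R h lt_c st RQ drop_vR; have [[Rf PR h_nat] [hg h_thin]] := st.
have faceE (a : pred nat) : (forall k, a k -> k <= n) -> Q a -> ~ R a ->
    exists s, [/\ face s =1 a, Q (face s) & ~ R (face s)].
  move=> an Qa nRa; have E := set_ofE an; exists (set_of a); split=> //.
    by apply: family_ext Qa => // k; rewrite E.
  by move=> Ra; apply: nRa; apply: family_ext Ra.
have [none|/existsNP [s0 /not_implyP [Qs0 nRs0]]] :=
    pselect (forall s, Q (face s) -> R (face s)).
  have QR m (a : delta m n) : Q (hit a) -> R (hit a).
    move=> Qa; apply: contrapT => nRa.
    by have [s [_ Qs []]] := faceE _ (@hit_le m n a) Qa nRa; apply: none.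
  exists h; split; split=> //.
  - by move=> m q f a /QR; apply: h_nat.
  - by move=> t /QR; apply: h_thin.
have [|||s1 [s1v Qs1 nRs1]] := @faceE (predU1 v (face s0)).
- by move=> k /predU1P [->//|]; apply: face_le.
- by apply: add_v Qs0 _ => /PR.
- by move=> Rv; apply: nRs0; apply: Rf Rv => k /= ->; rewrite orbT.
have s1P : `[< [/\ Q (face s1), ~ R (face s1) & face s1 v] >].
  by apply/asboolP; rewrite s1v /= eqxx.
have [s /asboolP [Qs nRs sv] s_min] :=
  arg_minnP (P := fun s => `[< [/\ Q (face s), ~ R (face s) & face s v] >])
    (fun s : {set 'I_n.+1} => #|s|) s1P.
(* The face of [s] opposite to [j] still contains [v], so it is in [R] by minimality of [s]. *)
have faceR j : j <> v -> face s j -> R (predD1 (face s) j).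
  move=> jv sj; apply: contrapT => nR.
  have [||s' [s'E Qs' nRs']] := faceE (predD1 (face s) j) _ _ nR.
  - by move=> k /andP [_ /face_le].
  - by apply: familyQ Qs => k /andP [].
  have s's : s' \proper s.
    have j_lt : j < n.+1 by rewrite ltnS (face_le sj).
    apply/properP; split.
      apply/subsetP => i; rewrite -!face_mem s'E => /andP [] //.
    exists (Ordinal j_lt); first by rewrite -face_mem.
    by rewrite -face_mem s'E /= eqxx.
  have := s_min s'; rewrite leqNgt proper_card // => H; apply/notF/H/asboolP.
  by rewrite s'E /= sv andbT eq_sym; split=> //; apply/eqP.
have [h' st'] := stage_step st RQ drop_vR Qs nRs sv faceR.
apply: (IH _ h' _ st').
- rewrite -ltnS; apply: leq_trans lt_c; rewrite ltnS; apply: proper_card.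
  apply/properP; split.
    apply/subsetP => s2; rewrite !inE => /asboolP [Qs2 nR2].
    by apply/asboolP; split=> // R2; apply: nR2; left.
  exists s; rewrite inE; first exact/asboolP.
  by apply/asboolP => -[_]; apply; right.
- by move=> a [/RQ|as_] //; apply: familyQ Qs.
move=> a Qa nR [Ra|as_]; first by apply: (drop_vR a) => // Ra'; apply: nR; left.
apply: nR; right=> k ak; have [->//|kv] := eqVneq k v.
by apply: as_; rewrite /= kv.
Qed.

End ConeExtension.

(** * Thin triangles *)

Lemma natural_comp (X : sset) n q (P Q : pred nat -> Prop) (d : delta n q)
    (h : forall m, delta m q -> X m) :
  (forall m (a : delta m n), P (hit a) -> Q (hit (dcomp d a))) ->
  natural_on Q h -> natural_on P (fun m b => h m (dcomp d b)).
Proof. by move=> PQ h_nat m p f a /PQ; rewrite dcompA; apply: h_nat. Qed.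

Lemma family_and P Q : family P -> family Q -> family (fun a => P a /\ Q a).
Proof. by move=> Pf Qf a b ab [/(Pf _ _ ab) ? /(Qf _ _ ab)]. Qed.

(** The content of (A1) and (A2), with horns encoded as partial maps. For n = 2 the triangle i-1, i,
    i+1 is not in the horn: the condition on [h] is void, and the thinness of the filler is the
    information. For n > 2 the triangle is in the horn, and its thinness is the hypothesis. *)
Record weak_bicat (X : sset) (thin : X 2 -> Prop) : Prop := WeakBicat {
  thin_degenerate : forall x : X 2, degenerate x -> thin x;
  inner_fill : forall n i (h : forall m, delta m n -> X m), 0 < i < n ->
    natural_on (misses n i) h ->
    (misses n i (hit (tri n i.-1 i i.+1)) -> thin (h 2 (tri n i.-1 i i.+1))) ->
    exists2 k : X n, fills i h k & thin (act (tri n i.-1 i i.+1) k);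
  thin_saturate : forall s : X 4,
    thin (act (tri 4 0 2 4) s) -> thin (act (tri 4 1 2 3) s) ->
    thin (act (tri 4 0 1 3) s) -> thin (act (tri 4 1 3 4) s) ->
    thin (act (tri 4 0 1 2) s) ->
    thin (act (tri 4 0 3 4) s) /\ thin (act (tri 4 0 1 4) s) }.

Section WeakBicategory.
Variables (X : sset) (thin : X 2 -> Prop) (XP : weak_bicat thin).

Lemma thin_tri n (s : X n) x y z :
  x <= y <= z -> z <= n -> (x == y) || (y == z) -> thin (act (tri n x y z) s).
Proof.
by move=> xyz zn e; apply: (thin_degenerate XP); apply: degenerate_tri.
Qed.

(** (A2) at a degenerate 4-simplex: the five triangles of its hypothesis become the three given ones
    and two degenerate ones. The repeated vertex is 1 here, and 2 in [thin_d2]. *)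
Lemma thin_d1 (s : X 3) :
  thin (act (tri 3 0 1 2) s) -> thin (act (tri 3 0 1 3) s) ->
  thin (act (tri 3 1 2 3) s) -> thin (act (tri 3 0 2 3) s).
Proof.
move=> t012 t013 t123.
have := thin_saturate XP (s := act (dlist 4 3 [:: 0; 1; 1; 2; 3]) s).
rewrite -!act_comp !dlist_comp //= => H.
by case: H => //; apply: thin_tri.
Qed.

Lemma thin_d2 (s : X 3) :
  thin (act (tri 3 0 1 2) s) -> thin (act (tri 3 0 2 3) s) ->
  thin (act (tri 3 1 2 3) s) -> thin (act (tri 3 0 1 3) s).
Proof.
move=> t012 t023 t123.
have := thin_saturate XP (s := act (dlist 4 3 [:: 0; 1; 2; 2; 3]) s).
rewrite -!act_comp !dlist_comp //= => H.
by case: H => //; apply: thin_tri.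
Qed.

Section PartialMaps.
Variables (n : nat) (P : pred nat -> Prop) (g : forall m, delta m n -> X m).
Hypothesis Pf : family P.
Hypothesis g_nat : natural_on P g.

Lemma natural_dlist m p s t : dlist_ok p n s -> dlist_ok m p t ->
  P (hit (dlist p n s)) ->
  g (dlist m n [seq nth 0 s i | i <- t]) = act (dlist m p t) (g (dlist p n s)).
Proof. by move=> sok tok Ps; rewrite -(dlist_comp sok tok) g_nat. Qed.

Lemma natural_thin_degenerate x y z : x <= y <= z -> z <= n ->
  (x == y) || (y == z) -> P (hit (edge n x z)) -> thin (g (tri n x y z)).
Proof.
move=> xyz zn e Pxz; have xz_ok : dlist_ok 1 n [:: x; z] by rewrite edge_ok; lia.
apply: (thin_degenerate XP); case/orP: e => /eqP e.
  exists 1, (dlist 2 1 [:: 0; 0; 1]), (g (edge n x z)); split=> //.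
  by rewrite -natural_dlist //= e.
exists 1, (dlist 2 1 [:: 0; 1; 1]), (g (edge n x z)); split=> //.
by rewrite -natural_dlist //= e.
Qed.

Lemma natural_thin_d1 x y z w : x <= y <= z -> z <= w <= n ->
  P (hit (tet n x y z w)) -> thin (g (tri n x y z)) ->
  thin (g (tri n x y w)) -> thin (g (tri n y z w)) -> thin (g (tri n x z w)).
Proof.
move=> xyz zwn Ps; have s_ok : dlist_ok 3 n [:: x; y; z; w].
  by rewrite tet_ok xyz zwn.
have E i j k : i <= j <= k -> k <= 3 -> g (tri n (nth 0 [:: x; y; z; w] i)
    (nth 0 [:: x; y; z; w] j) (nth 0 [:: x; y; z; w] k)) =
    act (tri 3 i j k) (g (tet n x y z w)).
  by move=> ijk k3; rewrite -natural_dlist // tri_ok ijk.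
rewrite (E 0 1 2) // (E 0 1 3) // (E 1 2 3) // (E 0 2 3) //.
exact: thin_d1.
Qed.

Lemma natural_thin_d2 x y z w : x <= y <= z -> z <= w <= n ->
  P (hit (tet n x y z w)) -> thin (g (tri n x y z)) ->
  thin (g (tri n x z w)) -> thin (g (tri n y z w)) -> thin (g (tri n x y w)).
Proof.
move=> xyz zwn Ps; have s_ok : dlist_ok 3 n [:: x; y; z; w].
  by rewrite tet_ok xyz zwn.
have E i j k : i <= j <= k -> k <= 3 -> g (tri n (nth 0 [:: x; y; z; w] i)
    (nth 0 [:: x; y; z; w] j) (nth 0 [:: x; y; z; w] k)) =
    act (tri 3 i j k) (g (tet n x y z w)).
  by move=> ijk k3; rewrite -natural_dlist // tri_ok ijk.
rewrite (E 0 1 2) // (E 0 1 3) // (E 1 2 3) // (E 0 2 3) //.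
exact: thin_d2.
Qed.

Lemma dinj_tri x y z : x < y < z -> z <= n -> dinj (tri n x y z).
Proof.
move=> xyz zn i j e; have ok : dlist_ok 2 n [:: x; y; z] by rewrite tri_ok; lia.
have: nth 0 [:: x; y; z] i = nth 0 [:: x; y; z] j.
  by rewrite -(dlistE i ok) -(dlistE j ok) /= -/(tri n x y z) e.
by case: i j {e} => [[|[|[|]]] //= ilt] [[|[|[|]]] //= jlt] e;
  apply: val_inj => //=; lia.
Qed.

Lemma dinj_tri2 (t : delta 2 2) : dinj t -> t = tri 2 0 1 2.
Proof.
have [x [y [z [-> xyz z2]]]] := triE t => t_inj.
have ok : dlist_ok 2 2 [:: x; y; z] by rewrite tri_ok xyz.
have xy : x <> y.
  move=> e; have /t_inj/(congr1 val) //: tri 2 x y z (inord 0) = tri 2 x y z (inord 1).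
    by apply: val_inj; rewrite /= !dlistE // !inordK.
  by rewrite /= !inordK.
have yz : y <> z.
  move=> e; have /t_inj/(congr1 val) //: tri 2 x y z (inord 1) = tri 2 x y z (inord 2).
    by apply: val_inj; rewrite /= !dlistE // !inordK.
  by rewrite /= !inordK.
by congr (tri 2 _ _ _); lia.
Qed.

Lemma dinj_triE p (t : delta 2 p) : p = 2 -> dinj t -> t = tri p 0 1 2.
Proof. by move=> p2; move: t; rewrite p2; apply: dinj_tri2. Qed.

(* Every face [a] of [Q] outside of [P] that contains [v] is filled along its
   inner horn at [v]; the thin triangle it needs either is already in [P] or has
   been filled before. *)
Lemma inner_cone v (Q : pred nat -> Prop) : v <= n -> family Q ->
  (forall a, P a -> Q a) ->
  (forall a, Q a -> ~ P a -> Q (predU1 v a)) ->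
  (forall a, Q a -> ~ P a -> ~ P (predD1 a v)) ->
  (forall a : pred nat, (forall k, a k -> k <= n) -> Q a -> ~ P a -> a v ->
     exists x y, [/\ a x, a y, x < v, v < y
       & (forall k, a k -> x < k -> k < y -> k = v) /\
         (P (hit (tri n x v y)) -> thin (g (tri n x v y)))]) ->
  exists h : forall m, delta m n -> X m, [/\ natural_on Q h,
    forall m (t : delta m n), P (hit t) -> h m t = g t
    & forall x y z, x < y < z -> z <= n -> v \in [:: x; y; z] ->
        Q (hit (tri n x y z)) -> ~ P (hit (tri n x y z)) ->
        thin (h 2 (tri n x y z))].
Proof.
move=> vn Qf PQ add_v drop_v inner.
have [|h [[_ _ h_nat] [hg h_thin]]] :=
    @cone_extension X thin n v vn P Q (@g) Pf Qf PQ add_v drop_v g_nat.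
  move=> R h [[Rf PR h_nat] [hg h_thin]] RQ p d i d_inj di Qd nPd dR.
  have dv : hit d v by rewrite -di; apply: hit_f.
  have [x [y [/hitP [i1 i1x] /hitP [i2 i2y] xv vy [adj thinP]]]] :=
    inner _ (@hit_le p n d) Qd nPd dv.
  have lt_d (j1 j2 : 'I_p.+1) : (d j1 < d j2) = (j1 < j2).
    apply/idP/idP => [|lt].
      by rewrite ltnNge => /negP H; rewrite ltnNge; apply/negP => /(delta_mono d).
    rewrite ltn_neqAle delta_mono 1?ltnW // andbT; apply/eqP => /val_inj /d_inj e.
    by move: lt; rewrite e ltnn.
  have i1i : i1 < i by rewrite -lt_d i1x di.
  have ii2 : i < i2 by rewrite -lt_d i2y di.
  have between (k : 'I_p.+1) : i1 < k -> k < i2 -> k = i.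
    move=> ik ki; apply: d_inj; apply: val_inj; rewrite /= di; apply: adj.
    - exact: hit_f.
    - by rewrite -i1x lt_d.
    - by rewrite -i2y lt_d.
  (* [x] and [y] are the neighbours of [v] in the face, so they are its vertices number i-1 and
     i+1. *)
  have i1E : i1 = i.-1 :> nat.
    have lt : i.-1 < p.+1 by have := ltn_ord i; lia.
    have := between (Ordinal lt) => /= H.
    case: (ltngtP i1 i.-1) => //; last by lia.
    by move=> /H /(_ _)/(congr1 val) /=; lia.
  have i2E : i2 = i.+1 :> nat.
    case: (ltngtP i2 i.+1) => //; first by lia.
    move=> lt; have lt' : i.+1 < p.+1 by have := ltn_ord i2; lia.
    by have /(congr1 val) /= := between (Ordinal lt') (ltnW i1i) lt; lia.
  have i2p : i2 <= p by rewrite -ltnS.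
  have tok : dlist_ok 2 p [:: i.-1; nat_of_ord i; i.+1] by rewrite tri_ok; lia.
  have dtri : dcomp d (tri p i.-1 i i.+1) = tri n x v y.
    rewrite /tri dcomp_dlist //= -i1E -i2E !inord_val.
    by rewrite -i1x -i2y -di.
  have xyn : x < v < y /\ y <= n by rewrite xv vy -i2y -ltnS.
  have [|||k k_fills k_thin] := inner_fill XP (n := p) (i := i)
      (h := fun m b => h m (dcomp d b)).
  - by lia.
  - by move=> m q f a miss; rewrite dcompA h_nat //; apply: dR.
  - move=> miss; rewrite dtri; have [Pt|nPt] := pselect (P (hit (tri n x v y))).
      by rewrite hg //; apply: thinP.
    apply: h_thin => //; first by rewrite -dtri; apply: dR.
      by rewrite hit_tri ?inE ?eqxx ?orbT //; lia.
    by apply: dinj_tri; lia.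
  exists k => // p2 t; have iE : i = 1 :> nat by have := ltn_ord i2; lia.
  by rewrite iE in k_thin => /(dinj_triE p2) ->.
exists h; split=> // x y z xyz zn v_in Qt nPt; apply: h_thin => //.
  by rewrite hit_tri //; lia.
exact: dinj_tri.
Qed.

End PartialMaps.

End WeakBicategory.

Lemma family_lacks k : family (fun a => ~~ a k).
Proof. by move=> a b ab; apply: contra; apply: ab. Qed.

Lemma family_or P Q : family P -> family Q -> family (fun a => P a \/ Q a).
Proof. by move=> Pf Qf a b ab [/(Pf _ _ ab) ?|/(Qf _ _ ab) ?]; [left|right]. Qed.

Lemma lacks_comp m n p (a : delta p n) (f : delta m p) k :
  ~~ hit a k -> ~~ hit (dcomp a f) k.
Proof. by apply: contra; apply: hit_comp. Qed.

Lemma lacks_neq m n (a : delta m n) k i : ~~ hit a k -> a i != k :> nat.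
Proof. by apply: contra => /eqP <-; apply: hit_f. Qed.

Section WeakBicategory.
Variables (X : sset) (thin : X 2 -> Prop) (XP : weak_bicat thin).

(* Vertex 0 of the 4-simplex is a copy of vertex 2, and the face opposite to it
   is [s]: the thin triangle 123 is inverted. *)
Lemma thin_collapsed_first (s : X 3) :
  act (edge 3 0 1) s = act (edge 3 0 0) s ->
  thin (act (tri 3 0 1 2) s) -> thin (act (tri 3 0 1 3) s) ->
  thin (act (tri 3 0 2 3) s) -> thin (act (tri 3 1 2 3) s).
Proof.
move=> s01 t012 t013 t023.
have s11 : act (edge 3 1 1) s = act (edge 3 0 0) s.
  have := congr1 (act (edge 1 1 1)) s01.
  by rewrite -!act_comp !dlist_comp.
(* On 1234, [m1] gives [s]; on 0234, [m2] gives a degeneracy of the face 123 of [s]; on 012, [m3] is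
   constant. The remaining faces are filled at the vertex 2. *)
pose m1 := dlist 4 3 [:: 0; 0; 1; 2; 3]; pose m2 := dlist 4 3 [:: 1; 1; 1; 2; 3].
pose m3 := dlist 4 3 [:: 0; 0; 0; 0; 0].
pose g m (a : delta m 4) := if ~~ hit a 0 then act (dcomp m1 a) s else
  if ~~ hit a 1 then act (dcomp m2 a) s else act (dcomp m3 a) s.
have gE1 m (a : delta m 4) : ~~ hit a 0 -> g m a = act (dcomp m1 a) s.
  by rewrite /g => ->.
have gE2 m (a : delta m 4) : ~~ hit a 1 -> g m a = act (dcomp m2 a) s.
  rewrite /g => a1; rewrite a1; case: ifP => // a0; congr (act _ s).
  apply: delta_ext => i; rewrite !dcompE !dlistE //.
  by move: (lacks_neq i a0) (lacks_neq i a1); case: (nat_of_ord (a i)) => [|[|k]].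
have gE3 m (a : delta m 4) : ~~ hit a 3 -> ~~ hit a 4 -> g m a = act (dcomp m3 a) s.
  have vals i : ~~ hit a 3 -> ~~ hit a 4 -> a i <= 2.
    by move=> /(lacks_neq i) a3 /(lacks_neq i) a4; have := ltn_ord (a i); lia.
  rewrite /g => a3 a4; case: ifP => [a0|_]; last case: ifP => // a1.
    have -> : dcomp m1 a = dcomp (edge 3 0 1) (dcomp (dlist 4 1 [:: 0; 0; 1; 1; 1]) a).
      apply: delta_ext => i; rewrite !dcompE !dlistE //.
      by have := vals i a3 a4; case: (nat_of_ord (a i)) => [|[|[|k]]].
    rewrite act_comp s01 -act_comp; congr (act _ s).
    apply: delta_ext => i; rewrite !dcompE !dlistE //.
    by have := vals i a3 a4; case: (nat_of_ord (a i)) => [|[|[|k]]].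
  have -> : dcomp m2 a = dcomp (edge 3 1 1) (dcomp (dlist 4 1 [:: 0; 0; 1; 1; 1]) a).
    apply: delta_ext => i; rewrite !dcompE !dlistE //.
    by have := vals i a3 a4; case: (nat_of_ord (a i)) => [|[|[|k]]].
  rewrite act_comp s11 -act_comp; congr (act _ s).
  apply: delta_ext => i; rewrite !dcompE !dlistE //.
  by have := vals i a3 a4; case: (nat_of_ord (a i)) => [|[|[|k]]].
pose P (a : pred nat) := ~~ a 0 \/ ~~ a 1 \/ ~~ a 3 /\ ~~ a 4.
have Pf : family P.
  apply: family_or (@family_lacks 0) _; apply: family_or (@family_lacks 1) _.
  exact: family_and (@family_lacks 3) (@family_lacks 4).
have g_nat : natural_on P g.
  move=> m p f a [a0|[a1|[a3 a4]]].
  - by rewrite !gE1 ?lacks_comp // dcompA act_comp.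
  - by rewrite !gE2 ?lacks_comp // dcompA act_comp.
  - by rewrite !gE3 ?lacks_comp // dcompA act_comp.
have nP a : ~ P a -> [/\ a 0, a 1 & a 3 || a 4].
  move=> nPa; split; apply: contrapT => /negP H; apply: nPa.
  - by left.
  - by right; left.
  - by right; right; apply/norP.
have g_thin x y z : x <= y <= z -> z <= 4 ->
    0 \notin [:: x; y; z] -> thin (act (tri 3 (x.-1) (y.-1) (z.-1)) s) ->
    thin (g 2 (tri 4 x y z)).
  move=> xyz z4 n0; rewrite gE1 ?hit_tri //.
  rewrite /tri dlist_comp //= ?tri_ok ?xyz //.
  suff E k : k <= 4 -> nth 0 [:: 0; 0; 1; 2; 3] k = k.-1.
    by move: n0; rewrite !E //; lia.
  by case: k => [|[|[|[|[|k]]]]].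
have [h [h_nat hg h_thin]] : exists h : forall m, delta m 4 -> X m,
    [/\ natural_on (fun=> True) h,
    forall m (t : delta m 4), P (hit t) -> h m t = g m t
    & forall x y z, x < y < z -> z <= 4 -> 2 \in [:: x; y; z] ->
        True -> ~ P (hit (tri 4 x y z)) -> thin (h 2 (tri 4 x y z))].
  apply: (inner_cone XP Pf g_nat) => //.
  move=> a an _ /nP [a0 a1 a34] a2; exists 1.
  exists (if a 3 then 3 else 4); split=> //; first by move: a34; case: ifP.
    by case: ifP.
  split=> [k ak k1|_].
    by case: ifPn => [_|a3]; move: ak k1; case: k => [|[|[|[|k]]]] //= ak;
      rewrite ?ltnS // ak in a3.
  by case: ifP => _; apply: g_thin.
have PE x y z : x <= y <= z -> z <= 4 -> P (mem [:: x; y; z]) ->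
    P (hit (tri 4 x y z)).
  move=> xyz z4; apply: family_ext => // k.
  by rewrite hit_tri.
have deg_thin x y z : x <= y <= z -> z <= 4 -> (x == y) || (y == z) ->
    thin (h 2 (tri 4 x y z)).
  by move=> xyz z4 e; apply: (natural_thin_degenerate XP h_nat).
have t012' : thin (h 2 (tri 4 0 1 2)).
  rewrite hg; last by apply: PE => //; right; right.
  by rewrite gE3 ?hit_tri // /tri dlist_comp //; apply: (thin_tri XP).
have t02 z : 3 <= z <= 4 -> thin (h 2 (tri 4 0 2 z)).
  move=> z34; rewrite hg; last by apply: PE; [lia|lia|right; left; rewrite !inE; lia].
  rewrite gE2 ?hit_tri //; [|rewrite !inE; lia|lia|lia].
  rewrite /tri dlist_comp ?tri_ok //; last lia.
  by apply: (thin_tri XP) => //=; move: z34; case: z => [|[|[|[|[|z]]]]].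
have t12 z : 3 <= z <= 4 -> thin (h 2 (tri 4 1 2 z)).
  move=> z34; rewrite hg; last by apply: PE; [lia|lia|left; rewrite !inE; lia].
  apply: g_thin; [lia|lia|rewrite !inE; lia|].
  by move: z34; case: z => [|[|[|[|[|z]]]]].
(* The triangles 012, 02z and 12z give 01z; then 013, 014 and 134 give 034, which is the face 123 of
   [s]. *)
have t01 z : 3 <= z <= 4 -> thin (h 2 (tri 4 0 1 z)).
  move=> z34; apply: (natural_thin_d2 XP h_nat (z := 2)) => //; try lia.
  - exact: t02.
  - exact: t12.
have t034 : thin (h 2 (tri 4 0 3 4)).
  apply: (natural_thin_d1 XP h_nat (y := 1)) => //; [exact: t01|exact: t01|].
  rewrite hg; last by apply: PE => //; left.
  by apply: g_thin.
move: t034; rewrite hg; last by apply: PE => //; right; left.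
by rewrite gE2 ?hit_tri // /tri dlist_comp.
Qed.

(* As above, with the order of the vertices reversed. *)
Lemma thin_collapsed_last (s : X 3) :
  act (edge 3 2 3) s = act (edge 3 3 3) s ->
  thin (act (tri 3 0 1 3) s) -> thin (act (tri 3 0 2 3) s) ->
  thin (act (tri 3 1 2 3) s) -> thin (act (tri 3 0 1 2) s).
Proof.
move=> s23 t013 t023 t123.
have s22 : act (edge 3 2 2) s = act (edge 3 3 3) s.
  have := congr1 (act (edge 1 0 0)) s23.
  by rewrite -!act_comp !dlist_comp.
pose m1 := dlist 4 3 [:: 0; 1; 2; 3; 3]; pose m2 := dlist 4 3 [:: 0; 1; 2; 2; 2].
pose m3 := dlist 4 3 [:: 3; 3; 3; 3; 3].
pose g m (a : delta m 4) := if ~~ hit a 4 then act (dcomp m1 a) s else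
  if ~~ hit a 3 then act (dcomp m2 a) s else act (dcomp m3 a) s.
have gE1 m (a : delta m 4) : ~~ hit a 4 -> g m a = act (dcomp m1 a) s.
  by rewrite /g => ->.
have gE2 m (a : delta m 4) : ~~ hit a 3 -> g m a = act (dcomp m2 a) s.
  rewrite /g => a3; rewrite a3; case: ifP => // a4; congr (act _ s).
  apply: delta_ext => i; rewrite !dcompE !dlistE //.
  move: (lacks_neq i a3) (lacks_neq i a4) (ltn_ord (a i)).
  by case: (nat_of_ord (a i)) => [|[|[|[|[|k]]]]].
have gE3 m (a : delta m 4) : ~~ hit a 0 -> ~~ hit a 1 -> g m a = act (dcomp m3 a) s.
  have vals i : ~~ hit a 0 -> ~~ hit a 1 -> 2 <= a i <= 4.
    by move=> /(lacks_neq i) a0 /(lacks_neq i) a1; have := ltn_ord (a i); lia.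
  rewrite /g => a0 a1; case: ifP => [a4|_]; last case: ifP => // a3.
    have -> : dcomp m1 a = dcomp (edge 3 2 3) (dcomp (dlist 4 1 [:: 0; 0; 0; 1; 1]) a).
      apply: delta_ext => i; rewrite !dcompE !dlistE //.
      by have := vals i a0 a1; case: (nat_of_ord (a i)) => [|[|[|[|[|k]]]]].
    rewrite act_comp s23 -act_comp; congr (act _ s).
    apply: delta_ext => i; rewrite !dcompE !dlistE //.
    by have := vals i a0 a1; case: (nat_of_ord (a i)) => [|[|[|[|[|k]]]]].
  have -> : dcomp m2 a = dcomp (edge 3 2 2) (dcomp (dlist 4 1 [:: 0; 0; 0; 1; 1]) a).
    apply: delta_ext => i; rewrite !dcompE !dlistE //.
    by have := vals i a0 a1; case: (nat_of_ord (a i)) => [|[|[|[|[|k]]]]].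
  rewrite act_comp s22 -act_comp; congr (act _ s).
  apply: delta_ext => i; rewrite !dcompE !dlistE //.
  by have := vals i a0 a1; case: (nat_of_ord (a i)) => [|[|[|[|[|k]]]]].
pose P (a : pred nat) := ~~ a 4 \/ ~~ a 3 \/ ~~ a 0 /\ ~~ a 1.
have Pf : family P.
  apply: family_or (@family_lacks 4) _; apply: family_or (@family_lacks 3) _.
  exact: family_and (@family_lacks 0) (@family_lacks 1).
have g_nat : natural_on P g.
  move=> m p f a [a4|[a3|[a0 a1]]].
  - by rewrite !gE1 ?lacks_comp // dcompA act_comp.
  - by rewrite !gE2 ?lacks_comp // dcompA act_comp.
  - by rewrite !gE3 ?lacks_comp // dcompA act_comp.
have nP a : ~ P a -> [/\ a 4, a 3 & a 0 || a 1].
  move=> nPa; split; apply: contrapT => /negP H; apply: nPa.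
  - by left.
  - by right; left.
  - by right; right; apply/norP.
have g_thin x y z : x <= y <= z -> z <= 3 -> thin (act (tri 3 x y z) s) ->
    thin (g 2 (tri 4 x y z)).
  move=> xyz z3; rewrite gE1 ?hit_tri ?inE //; try lia.
  rewrite /tri dlist_comp //= ?tri_ok ?xyz //; last lia.
  suff E k : k <= 3 -> nth 0 [:: 0; 1; 2; 3; 3] k = k by rewrite !E //; lia.
  by case: k => [|[|[|[|k]]]].
have [h [h_nat hg h_thin]] : exists h : forall m, delta m 4 -> X m,
    [/\ natural_on (fun=> True) h,
    forall m (t : delta m 4), P (hit t) -> h m t = g m t
    & forall x y z, x < y < z -> z <= 4 -> 2 \in [:: x; y; z] ->
        True -> ~ P (hit (tri 4 x y z)) -> thin (h 2 (tri 4 x y z))].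
  apply: (inner_cone XP Pf g_nat) => //.
  move=> a an _ /nP [a4 a3 a01] a2; exists (if a 1 then 1 else 0), 3.
  split=> //; [by move: a01; rewrite orbC; case: ifP|by case: ifP|].
  split=> [k ak|_]; last by case: ifP => _; apply: g_thin.
  by case: ifPn => [_|a1] k1 k3; move: ak k1 k3; case: k => [|[|[|k]]] //= ak;
    rewrite ak in a1.
have PE x y z : x <= y <= z -> z <= 4 -> P (mem [:: x; y; z]) ->
    P (hit (tri 4 x y z)).
  move=> xyz z4; apply: family_ext => // k.
  by rewrite hit_tri.
have t234 : thin (h 2 (tri 4 2 3 4)).
  rewrite hg; last by apply: PE => //; right; right.
  by rewrite gE3 ?hit_tri // /tri dlist_comp //; apply: (thin_tri XP).
have tx34 x : x <= 1 -> thin (h 2 (tri 4 x 3 4)).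
  move=> x1; apply: (natural_thin_d1 XP h_nat (y := 2)) => //; [lia| |].
    rewrite hg; last by apply: PE; [lia|lia|left; rewrite !inE; lia].
    by apply: g_thin; [lia|lia|]; move: x1; case: x => [|[|x]].
  rewrite hg; last by apply: PE; [lia|lia|right; left; rewrite !inE; lia].
  rewrite gE2 ?hit_tri //; [|rewrite !inE; lia|lia].
  rewrite /tri dlist_comp ?tri_ok //; last lia.
  by apply: (thin_tri XP) => //=; move: x1; case: x => [|[|x]].
have t014 : thin (h 2 (tri 4 0 1 4)).
  apply: (natural_thin_d2 XP h_nat (z := 3)) => //; [|exact: tx34|exact: tx34].
  rewrite hg; last by apply: PE => //; left.
  by apply: g_thin.
move: t014; rewrite hg; last by apply: PE => //; right; left.
by rewrite gE2 ?hit_tri // /tri dlist_comp.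
Qed.

End WeakBicategory.

(** * Edges extending to the walking isomorphism *)

(* The nerve of the groupoid with two uniquely isomorphic objects. *)
Definition iso_nerve : sset :=
  @SSet (fun n => 'I_n.+1 -> bool) (fun m n f w => w \o f)
    (fun n w => funext (fun i => congr1 w (ffunE _ i)))
    (fun m n p g f w => funext (fun i => congr1 w (dcompE g f i))).

Definition iso01 : iso_nerve 1 := fun i => val i == 1.

(* The lifting properties of the generators (A4) and (S5) at the edge [e].  In
   an oo-bicategory they are taken as the definition of the marking. *)
Definition special (X : sset) (thin : X 2 -> Prop) (e : X 1) : Prop :=
  (forall n (h : forall m, delta m n -> X m), 2 <= n ->
     natural_on (misses n n) h -> h 1 (edge n n.-1 n) = e ->
     (2 < n -> thin (h 2 (tri n 0 n.-1 n))) ->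
     exists2 k : X n, fills n h k & thin (act (tri n 0 n.-1 n) k)) /\
  (forall s : X 3, act (edge 3 2 3) s = e ->
     thin (act (tri 3 0 1 3) s) -> thin (act (tri 3 0 2 3) s) ->
     thin (act (tri 3 1 2 3) s) -> thin (act (tri 3 0 1 2) s)).

Lemma last_below (a : pred nat) k0 v : a k0 -> k0 < v ->
  exists x, [/\ a x, x < v & forall k, a k -> x < k -> v <= k].
Proof.
move=> a0 v0; have ex : exists i, a i && (i < v) by exists k0; rewrite a0.
have bd i : a i && (i < v) -> i <= v by case/andP => _ /ltnW.
exists (ex_maxn ex bd); case: ex_maxnP => i /andP [ai iv] imax; split=> // k ak ik.
by rewrite leqNgt; apply/negP => kv; have := imax k; rewrite ak kv /=; lia.
Qed.

(** The operator 0...01: pulled back along it, an edge becomes an n-simplex whose vertices but the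
    last coincide. *)
Definition last_letter n : delta n 1 := dmk n 1 (fun k => k == n).

Lemma last_letterE n (k : 'I_n.+1) : 0 < n -> last_letter n k = (k == n :> nat) :> nat.
Proof. by move=> n0; rewrite dmkE => // [i j /andP [ij jn]|]; case: eqP => //=; lia. Qed.

Section WeakBicategory.
Variables (X : sset) (thin : X 2 -> Prop) (XP : weak_bicat thin).
Variables (iso : smap iso_nerve X) (iso_thin : forall w, thin (iso 2 w)).
Let e := iso 1 iso01.

(** The vertex k of Delta^n carries the letter [l k], and simplices are read in J through these
    letters. *)
Let word n (l : pred nat) m (a : delta m n) : X m := iso m (fun i => l (a i)).

Let word_comp n l m p (f : delta m p) (a : delta p n) :
  word l (dcomp a f) = act f (word l a).
Proof.
rewrite -smap_act; congr (iso m _); apply: funext => i.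
by rewrite /= dcompE.
Qed.

Let act_e m (b : delta m 1) : act b e = iso m (fun i => b i == 1 :> nat).
Proof. by rewrite -smap_act. Qed.

(** A vertex 4 is attached to 3 along the inverse of [e], so that the edge 24 is degenerate.
    Thinness moves from the triangles ending in 3 to those ending in 4, and [thin_collapsed_last]
    applies to 0124. *)
Lemma special_iso_thin (s : X 3) : act (edge 3 2 3) s = e ->
  thin (act (tri 3 0 1 3) s) -> thin (act (tri 3 0 2 3) s) ->
  thin (act (tri 3 1 2 3) s) -> thin (act (tri 3 0 1 2) s).
Proof.
move=> s23 t013 t023 t123; pose m1 := dlist 4 3 [:: 0; 1; 2; 3; 3].
pose l := pred1 3.
pose g m (a : delta m 4) := if ~~ hit a 4 then act (dcomp m1 a) s else word l a.
have gE1 m (a : delta m 4) : ~~ hit a 4 -> g m a = act (dcomp m1 a) s.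
  by rewrite /g => ->.
have gE2 m (a : delta m 4) : ~~ hit a 0 -> ~~ hit a 1 -> g m a = word l a.
  move=> a0 a1; rewrite /g; case: ifP => // a4.
  have vals i : 2 <= a i <= 3.
    move: (lacks_neq i a0) (lacks_neq i a1) (lacks_neq i a4) (ltn_ord (a i)); lia.
  have -> : dcomp m1 a = dcomp (edge 3 2 3) (dcomp (dlist 4 1 [:: 0; 0; 0; 1; 1]) a).
    apply: delta_ext => i; rewrite !dcompE !dlistE //.
    by have := vals i; case: (nat_of_ord (a i)) => [|[|[|[|k]]]].
  rewrite act_comp s23 act_e; congr (iso m _); apply: funext => i.
  rewrite dcompE dlistE //.
  by have := vals i; case: (nat_of_ord (a i)) => [|[|[|[|k]]]].
pose P (a : pred nat) := ~~ a 4 \/ ~~ a 0 /\ ~~ a 1.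
have Pf : family P.
  apply: family_or (@family_lacks 4) _.
  exact: family_and (@family_lacks 0) (@family_lacks 1).
have g_nat : natural_on P g.
  move=> m p f a [a4|[a0 a1]].
    by rewrite !gE1 ?lacks_comp // dcompA act_comp.
  by rewrite !gE2 ?lacks_comp // word_comp.
have nP a : ~ P a -> a 4 /\ (a 0 || a 1).
  move=> nPa; split; apply: contrapT => /negP H; apply: nPa; [by left|right].
  exact/norP.
have [h [h_nat hg h_thin]] : exists h : forall m, delta m 4 -> X m,
    [/\ natural_on (fun=> True) h,
    forall m (t : delta m 4), P (hit t) -> h m t = g m t
    & forall x y z, x < y < z -> z <= 4 -> 3 \in [:: x; y; z] ->
        True -> ~ P (hit (tri 4 x y z)) -> thin (h 2 (tri 4 x y z))].
  apply: (inner_cone XP Pf g_nat) => //.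
  move=> a an _ /nP [a4 a01] a3.
  exists (if a 2 then 2 else if a 1 then 1 else 0), 4; split=> //.
  - by case: ifP => // a2; move: a01; rewrite orbC; case: ifP.
  - by case: ifP => // _; case: ifP.
  split=> [k ak xk k4|Pt].
    move: ak xk; case: k k4 => [|[|[|[|k]]]] //= _ ak; case: ifP => a2 //;
      by [rewrite ak in a2|case: ifP => // a1; rewrite ak in a1].
  move: Pt; case: ifP => [_ _|_]; last first.
    by case: ifP => _ [|[]]; rewrite !hit_tri.
  by rewrite gE2 ?hit_tri //; apply: iso_thin.
have PE x y z : x <= y <= z -> z <= 4 -> P (mem [:: x; y; z]) ->
    P (hit (tri 4 x y z)).
  by move=> xyz z4; apply: family_ext => // k; rewrite hit_tri.
have tg x y z : x <= y <= z -> z <= 3 -> thin (act (tri 3 x y z) s) ->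
    thin (h 2 (tri 4 x y z)).
  move=> xyz z3; rewrite hg; last by apply: PE; [lia|lia|left; rewrite !inE; lia].
  rewrite gE1 ?hit_tri ?inE //; try lia.
  rewrite /tri dlist_comp //= ?tri_ok ?xyz //; last lia.
  suff E k : k <= 3 -> nth 0 [:: 0; 1; 2; 3; 3] k = k by rewrite !E //; lia.
  by case: k => [|[|[|[|k]]]].
have t034 : thin (h 2 (tri 4 0 3 4)) by apply: h_thin => //; case=> [|[]]; rewrite hit_tri.
have t134 : thin (h 2 (tri 4 1 3 4)) by apply: h_thin => //; case=> [|[]]; rewrite !hit_tri.
have t234 : thin (h 2 (tri 4 2 3 4)).
  rewrite hg; last by apply: PE => //; right.
  by rewrite gE2 ?hit_tri //; apply: iso_thin.
have t014 : thin (h 2 (tri 4 0 1 4)).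
  by apply: (natural_thin_d2 XP h_nat (z := 3)) => //; apply: tg.
have t024 : thin (h 2 (tri 4 0 2 4)).
  by apply: (natural_thin_d2 XP h_nat (z := 3)) => //; apply: tg.
have t124 : thin (h 2 (tri 4 1 2 4)).
  by apply: (natural_thin_d2 XP h_nat (z := 3)) => //; apply: tg.
have hE m t : dlist_ok m 3 t -> act (dlist m 3 t) (h 3 (tet 4 0 1 2 4)) =
    h m (dlist m 4 [seq nth 0 [:: 0; 1; 2; 4] i | i <- t]).
  by move=> tok; rewrite -(natural_dlist h_nat (s := [:: 0; 1; 2; 4])).
have := @thin_collapsed_last X thin XP (h 3 (tet 4 0 1 2 4)).
rewrite !hE //= => H; have {H} : thin (h 2 (tri 4 0 1 2)).
  apply: H => //; rewrite !hg; try by right; rewrite !hit_dlist.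
  rewrite !gE2 ?hit_dlist //; congr (iso 1 _); apply: funext => i.
  by rewrite !dlistE //; case: i => -[|[]].
rewrite hg; last by apply: PE => //; left.
by rewrite gE1 ?hit_tri // /tri dlist_comp.
Qed.

(** The induction measures how far the degenerate part reaches: for [a = n.-2] the condition
    concerns only the last edge, so any horn on [e] qualifies; for [a = 0] it covers the whole face
    opposite to 0. *)
Definition block a n (h : forall m, delta m n -> X m) : Prop :=
  forall m (b : delta m n), (forall i, a < b i) ->
    h m b = act (dcomp (last_letter n) b) e.

(* Vertices: the front 0, ..., n-2, then q' = n-1, r' = n, q = n+1, r = n+2,
   where q' and r' are copies of q and r. *)
Lemma base_fill n (h : forall m, delta m n -> X m) : 2 <= n ->
  natural_on (misses n n) h -> block 0 h ->
  (2 < n -> thin (h 2 (tri n 0 n.-1 n))) ->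
  exists2 k : X n, fills n h k & thin (act (tri n 0 n.-1 n) k).
Proof.
move=> n2 h_nat h_block h_thin; pose N := n.+2.
(* The letters on q', r', q, r are 0101, and 0 on the front. Without q, both r' and r stand for the
   vertex n of the horn ([s1]); without r', both q' and q stand for n-1 ([s2]). *)
pose l : pred nat := fun k => (k == n) || (k == n.+2).
pose f1 k := minn k n; pose f2 k := if k == n.+2 then n else minn k n.-1.
pose s1 := dmk N n f1; pose s2 := dmk N n f2.
have s1E k : s1 k = f1 k :> nat.
  by rewrite dmkE /f1 => [//|i j /andP [ij jN]|]; lia.
have s2E k : s2 k = f2 k :> nat.
  by rewrite dmkE /f2 => [//|i j /andP [ij]|]; rewrite /N ?eqxx //;
    do 2?case: eqP; lia.
pose g m (a : delta m N) := if ~~ hit a 0 then word l a else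
  if ~~ hit a n.+1 then h m (dcomp s1 a) else h m (dcomp s2 a).
have gE0 m (a : delta m N) : ~~ hit a 0 -> g m a = word l a by rewrite /g => ->.
have pos m (a : delta m N) i : ~~ hit a 0 -> 0 < a i.
  by move/(lacks_neq i); lia.
have gE1 m (a : delta m N) : ~~ hit a n.+1 -> g m a = h m (dcomp s1 a).
  move=> a1; rewrite /g a1; case: ifP => // a0.
  rewrite h_block ?act_e => [|i]; last first.
    by rewrite dcompE s1E /f1; have := pos _ _ i a0; lia.
  congr (iso m _); apply: funext => i.
  rewrite !dcompE last_letterE ?s1E ?/f1 /l; last lia.
  by move: (lacks_neq i a1) (ltn_ord (a i)); rewrite /N; lia.
have gE2 m (a : delta m N) : ~~ hit a n -> g m a = h m (dcomp s2 a).
  move=> an; rewrite /g; case: ifP => [a0|_].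
    rewrite h_block ?act_e => [|i]; last first.
      by rewrite dcompE s2E /f2; have := pos _ _ i a0; case: ifP; lia.
    congr (iso m _); apply: funext => i.
    rewrite !dcompE last_letterE ?s2E ?/f2 /l; last lia.
    by move: (lacks_neq i an) (ltn_ord (a i)); rewrite /N; case: ifP; lia.
  case: ifP => // a1; congr (h m _); apply: delta_ext => i.
  rewrite !dcompE s1E s2E /f1 /f2.
  by move: (lacks_neq i an) (lacks_neq i a1) (ltn_ord (a i)); rewrite /N; case: ifP; lia.
pose LF (a : pred nat) := exists k, k <= n.-2 /\ ~~ a k.
have LFf : family LF.
  by move=> a b ab [k [kn bk]]; exists k; split=> //; apply: contra bk; apply: ab.
(* On [F0] the values come from the horn or from J. The faces lacking a front vertex are filled at
   q' ([F1]), then those lacking q' are filled at r' ([F2]). The face on the front, q and r, which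
   is the filler, arises in the latter step. *)
pose F0 (a : pred nat) := ~~ a 0 \/
  (~~ a n \/ ~~ a n.+1) /\ (LF a \/ ~~ a n.-1 /\ ~~ a n.+1).
have F0f : family F0.
  apply: family_or; first exact: family_lacks.
  apply: family_and; first by apply: family_or; apply: family_lacks.
  by apply: family_or => //; apply: family_and; apply: family_lacks.
have g_nat : natural_on F0 g.
  move=> m p f a [a0|[]].
    by rewrite !gE0 ?lacks_comp // word_comp.
  case=> [an|an1] a_miss.
    rewrite !gE2 ?lacks_comp // dcompA h_nat //.
    case: a_miss => [[k [kn ak]]|[an' an1]].
      exists k; split; [lia|lia|]; apply: contra ak => /hitP [i].
      by rewrite dcompE s2E => si; apply/hitP; exists i; move: si;
        rewrite /f2; case: ifP; lia.
    exists n.-1; split; [lia|lia|]; apply/hitP => -[i].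
    rewrite dcompE s2E /f2.
    move: (lacks_neq i an) (lacks_neq i an') (lacks_neq i an1) (ltn_ord (a i)).
    by rewrite /N; case: ifP; lia.
  rewrite !gE1 ?lacks_comp // dcompA h_nat //.
  case: a_miss => [[k [kn ak]]|[an' _]].
    exists k; split; [lia|lia|]; apply: contra ak => /hitP [i].
    by rewrite dcompE s1E => si; apply/hitP; exists i; move: si; rewrite /f1; lia.
  exists n.-1; split; [lia|lia|]; apply/hitP => -[i].
  by rewrite dcompE s1E /f1; move: (lacks_neq i an'); lia.
pose F1 (a : pred nat) := F0 a \/ LF a.
have F1f : family F1 by apply: family_or.
have [h1 [h1_nat h1g _]] : exists h1 : forall m, delta m N -> X m,
    [/\ natural_on F1 h1,
    forall m (t : delta m N), F0 (hit t) -> h1 m t = g m t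
    & forall x y z, x < y < z -> z <= N -> n.-1 \in [:: x; y; z] ->
        F1 (hit (tri N x y z)) -> ~ F0 (hit (tri N x y z)) ->
        thin (h1 2 (tri N x y z))].
  apply: (inner_cone XP F0f g_nat) => //.
  - by rewrite /N; lia.
  - by move=> a ?; left.
  - move=> a [//|[k [kn ak]]] _; right; exists k; split=> //=.
    by rewrite negb_or ak andbT; apply/eqP; lia.
  - move=> a Q nF0 [|[]] /=.
      rewrite negb_and negbK => /orP [/eqP|a0]; first lia.
      by apply: nF0; left.
    have -> : (n != n.-1) = true by apply/eqP; lia.
    have -> : (n.+1 != n.-1) = true by apply/eqP; lia.
    by case: Q => //= LFa an _; apply: nF0; right; split=> //; left.
  move=> a aN Q nF0 an'; have LFa : LF a by case: Q.
  have a0 : a 0 by apply: contrapT => /negP a0; apply: nF0; left.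
  have [an an1] : a n /\ a n.+1.
    split; apply: contrapT => /negP H; apply: nF0; right; split; by [left|right|left|left].
  have n1 : 0 < n.-1 by lia.
  have [x [ax xn' x_last]] := last_below a0 n1.
  exists x, n; split=> //; first lia.
  split=> [k ak xk kn|Ft]; first by have := x_last k ak xk; lia.
  (* If x > 0 the triangle x, q', r' comes from J. If x = 0 it is thin by hypothesis: [a] contains 0
     but lacks a front vertex, so n > 2. *)
  have [x0|x0] := posnP x; last first.
    by rewrite gE0 ?hit_tri ?inE; [apply: iso_thin|lia|rewrite /N; lia|lia].
  rewrite x0 gE1 ?hit_tri ?inE; [|lia|rewrite /N; lia|lia].
  have [k [kn ak]] := LFa.
  have k0 : k != 0 by apply: contraNneq ak => ->.
  rewrite (_ : dcomp s1 _ = tri n 0 n.-1 n); first by apply: h_thin; lia.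
  apply: dlist_eq => [|i]; first by rewrite tri_ok; lia.
  rewrite dcompE s1E dlistE ?tri_ok; last by rewrite /N; lia.
  by case: i => -[|[|[|i]]] //= _; rewrite /f1; lia.
pose F2 (a : pred nat) := F1 a \/ ~~ a n.-1.
have F2f : family F2 by apply: family_or => //; apply: family_lacks.
have F1n a : F2 a -> ~ F1 a -> [/\ a 0, ~ LF a, ~~ a n.-1 & a n.+1].
  case=> // an' nF1; split=> //.
  - by apply: contrapT => /negP a0; apply: nF1; left; left.
  - by move=> H; apply: nF1; right.
  - apply: contrapT => /negP an1; apply: nF1; left; right; split; right=> //.
have [h2 [h2_nat h2h h2_thin]] : exists h2 : forall m, delta m N -> X m,
    [/\ natural_on F2 h2,
    forall m (t : delta m N), F1 (hit t) -> h2 m t = h1 m t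
    & forall x y z, x < y < z -> z <= N -> n \in [:: x; y; z] ->
        F2 (hit (tri N x y z)) -> ~ F1 (hit (tri N x y z)) ->
        thin (h2 2 (tri N x y z))].
  apply: (inner_cone XP F1f h1_nat) => //.
  - by rewrite /N; lia.
  - by move=> a ?; left.
  - move=> a Q /(F1n _ Q) [a0 _ an' an1]; right => /=.
    by rewrite negb_or an' andbT; apply/eqP; lia.
  - have LFd a : LF (predD1 a n) -> LF a.
      move=> [k [kn ak]]; exists k; split=> //; apply: contra ak => ak.
      by rewrite /= ak andbT; apply/eqP; lia.
    move=> a Q /(F1n _ Q) [a0 nLF an' an1] [[|[_ [/LFd //|[_]]]]|/LFd //].
      by rewrite /= a0 andbT negbK => /eqP; lia.
    by rewrite /= an1 andbT negbK => /eqP; lia.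
  move=> a aN Q /(F1n _ Q) [a0 nLF an' an1] an; exists n.-2, n.+1.
  split=> //; [|lia|].
    by apply: contrapT => /negP H; apply: nLF; exists n.-2.
  split=> [k ak nk kn|].
    have kn' : k != n.-1 by apply: contraNneq an' => <-.
    by lia.
  have tN : n.-2 <= n <= n.+1 by lia.
  (* For n > 2 the triangle n-2, r', q avoids 0 and comes from J. For n = 2 it is itself a new face,
     and nothing is asked of it. *)
  have [n3|n3] := ltnP 2 n.
    move=> _; have lk : ~~ hit (tri N n.-2 n n.+1) 0.
      by rewrite hit_tri ?inE; [lia|lia|rewrite /N; lia].
    by rewrite h1g ?gE0 //; [apply: iso_thin|left].
  have n2E : n = 2 by lia.
  have hitE k : hit (tri N n.-2 n n.+1) k = (k \in [:: n.-2; n; n.+1]).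
    by rewrite hit_tri //; rewrite /N; lia.
  case=> [[|[[|]]]|[k []]]; rewrite !hitE !inE n2E //.
  by rewrite leqn0 => /eqP ->.
pose f3 k := if k < n.-1 then k else k.+2.
pose d := dmk n N f3.
have dE k : d k = f3 k :> nat.
  by rewrite dmkE /f3 /N => [//|i j /andP [ij jn]|]; do ?case: ifP; lia.
have d_lacks k m (b : delta m n) : n.-1 <= k <= n -> ~~ hit (dcomp d b) k.
  move=> kn; apply/hitP => -[i]; rewrite dcompE dE /f3; case: ifP; lia.
have dn' m (b : delta m n) : ~~ hit (dcomp d b) n.-1 by apply: d_lacks; lia.
have dn m (b : delta m n) : ~~ hit (dcomp d b) n by apply: d_lacks; lia.
have d_fills : fills n h (h2 n d).
  move=> m b [j [jn jn' bj]].
  have F0b : F0 (hit (dcomp d b)).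
    right; split; first by left.
    have [jn2|jn2] := leqP j n.-2.
      left; exists j; split=> //; apply: contra bj => /hitP [i].
      rewrite dcompE dE => di; apply/hitP; exists i; move: di.
      by rewrite /f3; case: ifP; lia.
    right; split=> //; apply/hitP => -[i]; rewrite dcompE dE.
    by move: (lacks_neq i bj) (ltn_ord (b i)); rewrite /f3; case: ifP; lia.
  rewrite -h2_nat; last by right; rewrite -(dcompm1 d) dn'.
  rewrite h2h; last by left.
  rewrite h1g // gE2 //; congr (h m _); apply: delta_ext => i.
  rewrite !dcompE s2E dE /f2 /f3; have := ltn_ord (b i).
  by do ?case: ifP; lia.
exists (h2 n d) => //.
(* For n > 2 the triangle is in the horn. For n = 2 it is the filler, and the tetrahedron 0, r', q,
   r shows that it is thin. *)
have [n3|n3] := ltnP 2 n.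
  rewrite d_fills; first exact: h_thin.
  by exists 1; split; rewrite ?hit_tri ?inE; lia.
have n2E : n = 2 by lia.
have d_tri : dcomp d (tri n 0 n.-1 n) = tri N 0 n.+1 n.+2.
  apply: dlist_eq => [|i]; first by rewrite tri_ok /N; lia.
  rewrite dcompE dE dlistE ?tri_ok; last lia.
  by case: i => -[|[|[|i]]] //= _; rewrite /f3; case: ifP; lia.
rewrite -h2_nat ?d_tri; last by right; rewrite -(dcompm1 d) dn'.
have ok : dlist_ok 3 N [:: 0; n; n.+1; n.+2] by rewrite tet_ok /N; lia.
have hitE x y z k : x <= y <= z -> z <= N -> hit (tri N x y z) k = (k \in [:: x; y; z]).
  exact: hit_tri.
apply: (natural_thin_d1 XP h2_nat (y := n)).
- by lia.
- by rewrite /N; lia.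
- by right; rewrite hit_dlist // !inE; lia.
- have tok : 0 <= n <= n.+1 /\ n.+1 <= N by rewrite /N; lia.
  apply: h2_thin; [lia|rewrite /N; lia|by rewrite !inE; lia| |].
    by right; rewrite hitE ?inE; [lia|lia|rewrite /N; lia].
  case=> [[|[[|]]]|[k []]]; rewrite ?hitE ?inE /N; try lia.
- have F0t : F0 (hit (tri N 0 n n.+2)).
    by right; split; [right|right; split]; rewrite hitE ?inE /N; lia.
  rewrite (_ : h2 2 _ = g 2 (tri N 0 n n.+2)); last by rewrite h2h ?h1g //; left.
  rewrite gE1 ?hitE ?inE; [|lia|lia|rewrite /N; lia].
  rewrite (_ : dcomp s1 _ = tri n 0 n n).
    apply: (natural_thin_degenerate XP h_nat); [lia|lia|by rewrite eqxx orbT|].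
    by exists 1; split; rewrite ?hit_dlist ?inE ?edge_ok; lia.
  apply: dlist_eq => [|i]; first by rewrite tri_ok; lia.
  rewrite dcompE s1E dlistE ?tri_ok; last by rewrite /N; lia.
  by case: i => -[|[|[|i]]] //= _; rewrite /f1; lia.
- have lk : ~~ hit (tri N n n.+1 n.+2) 0 by rewrite hitE ?inE /N; lia.
  have Ft : F0 (hit (tri N n n.+1 n.+2)) by left.
  rewrite (_ : h2 2 _ = g 2 (tri N n n.+1 n.+2)); last by rewrite h2h ?h1g //; left.
  by rewrite gE0 //; apply: iso_thin.
Qed.

(* A copy p = a+1 of the next vertex is inserted after a, joined to every
   vertex k < a by a thin triangle k, a, p.  The face opposite to a is then a
   horn of the same kind with a smaller [a]. *)
Lemma iso_fill a n (h : forall m, delta m n -> X m) : 2 <= n -> a <= n.-2 ->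
  natural_on (misses n n) h -> block a h ->
  (2 < n -> thin (h 2 (tri n 0 n.-1 n))) ->
  exists2 k : X n, fills n h k & thin (act (tri n 0 n.-1 n) k).
Proof.
elim: a n h => [|a0 IH] n h n2; first by move=> _; apply: base_fill.
set a := a0.+1 => an h_nat h_block h_thin; pose N := n.+1.
have n3 : 2 < n by lia.
(* [s] identifies p with the vertex it copies; [dp] and [da] are the faces opposite to p and to a,
   and [r] is a left inverse of [da]. *)
pose fs k := if k <= a.+1 then k else k.-1.
pose s := dmk N n fs.
have sE k : s k = fs k :> nat.
  by rewrite dmkE /fs /N => [//|i j /andP [ij jN]|]; do ?case: ifP; lia.
pose fp k := if k <= a then k else k.+1.
pose dp := dmk n N fp.
have dpE k : dp k = fp k :> nat.
  by rewrite dmkE /fp /N => [//|i j /andP [ij jN]|]; do ?case: ifP; lia.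
pose fa k := if k < a then k else k.+1.
pose da := dmk n N fa.
have daE k : da k = fa k :> nat.
  by rewrite dmkE /fa /N => [//|i j /andP [ij jN]|]; do ?case: ifP; lia.
pose fr k := if k <= a then k else k.-1.
pose r := dmk N n fr.
have rE k : r k = fr k :> nat.
  by rewrite dmkE /fr /N => [//|i j /andP [ij jN]|]; do ?case: ifP; lia.
pose LB (t : pred nat) := exists k, [/\ k <= n, k != a, k != a.+1 & ~~ t k].
have LBf : family LB.
  move=> t u tu [k [kn ka ka1 uk]]; exists k; split=> //.
  by apply: contra uk; apply: tu.
have LBd k t : k = a \/ k = a.+1 -> LB (predD1 t k) -> LB t.
  move=> kE [i [i_n ia ia1 ti]]; exists i; split=> //.
  by apply: contra ti => /= ->; rewrite andbT; case: kE => ->.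
pose F1 (t : pred nat) := LB t \/ ~~ t a.+1 /\ ~~ t a.
have F1f : family F1.
  by apply: family_or => //; apply: family_and; apply: family_lacks.
pose low (t : pred nat) := forall k, k < a -> ~~ t k.
have lowf : family low by move=> t u tu ut k /ut; apply: contra; apply: tu.
(* On [F0] the values come from [h]. Filling at a reaches [F1], which contains the horn of the face
   opposite to a; that face is filled by induction, and then the whole simplex is filled at p. *)
pose F0 (t : pred nat) := F1 t /\ (~~ t a.+1 \/ low t).
have F0f : family F0.
  by apply: family_and => //; apply: family_or => //; apply: family_lacks.
pose g0 m (b : delta m N) := h m (dcomp s b).
have g0_nat : natural_on F0 g0.
  apply: natural_comp h_nat => m b [Fb [bp|blow]].
    case: Fb => [[k [kn ka ka1 bk]]|[_ ba]].
      exists (if k < a then k else k.-1); split; [case: ifP; lia|case: ifP; lia|].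
      apply/hitP => -[i]; rewrite dcompE sE /fs.
      move: (lacks_neq i bk) (lacks_neq i bp).
      by do 2?case: ifP; lia.
    exists a; split; [lia|lia|]; apply/hitP => -[i]; rewrite dcompE sE /fs.
    by move: (lacks_neq i ba); case: ifP; lia.
  exists 0; split; [lia|lia|]; apply/hitP => -[i]; rewrite dcompE sE /fs.
  by move: (lacks_neq i (blow 0 (ltn0Sn _))); case: ifP; lia.
have F1n t : F1 t -> ~ F0 t -> [/\ LB t, t a.+1 & exists2 k, k < a & t k].
  move=> F1t nF0; have tp : t a.+1.
    by apply: contrapT => /negP tp; apply: nF0; split=> //; left.
  split=> //; first by case: F1t => [//|[]]; rewrite tp.
  apply: contrapT => nex; apply: nF0; split=> //; right=> k ka.
  by apply/negP => tk; apply: nex; exists k.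
have hitN x y z k : x <= y <= z -> z <= N -> hit (tri N x y z) k = (k \in [:: x; y; z]).
  exact: hit_tri.
have aN : a <= N by rewrite /N; lia.
have [g1 [g1_nat g1g _]] : exists g1 : forall m, delta m N -> X m,
    [/\ natural_on F1 g1,
    forall m (t : delta m N), F0 (hit t) -> g1 m t = g0 m t
    & forall x y z, x < y < z -> z <= N -> a \in [:: x; y; z] ->
        F1 (hit (tri N x y z)) -> ~ F0 (hit (tri N x y z)) ->
        thin (g1 2 (tri N x y z))].
  apply: (inner_cone XP F0f g0_nat) => //.
  - by move=> t [].
  - move=> t Q /(F1n _ Q) [[k [kn ka ka1 tk]] _ _]; left; exists k; split=> //=.
    by rewrite negb_or ka.
  - move=> t Q /(F1n _ Q) [_ tp [k ka tk]] [_ [|/(_ k ka)]] /=.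
      by rewrite tp andbT negbK => /eqP; lia.
    by rewrite tk andbT negbK => /eqP; lia.
  move=> t tN Q /(F1n _ Q) [_ tp [k ka tk]] ta.
  have [x [tx xa x_last]] := last_below tk ka.
  exists x, a.+1; split=> //; split=> [i ti xi ia|]; first by have := x_last i ti xi; lia.
  have H : x <= a <= a.+1 /\ a.+1 <= N by rewrite /N; lia.
  case=> _ [|/(_ x xa)]; case: H => H1 H2; rewrite hitN ?inE //; last by rewrite eqxx.
  by rewrite eqxx !orbT.
have da_lacks m (b : delta m n) : ~~ hit (dcomp da b) a.
  by apply/hitP => -[i]; rewrite dcompE daE /fa; case: ifP; lia.
have da_F1 m (b : delta m n) : misses n n (hit b) -> F1 (hit (dcomp da b)).
  case=> j [jn jn' bj].
  have H k : ~~ hit b k -> ~~ hit (dcomp da b) (fa k).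
    move=> bk; apply/hitP => -[i]; rewrite dcompE daE /fa.
    by move: (lacks_neq i bk); do 2?case: ifP; lia.
  have [ja|ja|ja] := ltngtP j a.
  - left; exists j; split; [lia|lia|lia|].
    by move: (H j bj); rewrite /fa ja.
  - left; exists j.+1; split; [lia|lia|lia|].
    by move: (H j bj); rewrite /fa ltnNge (ltnW ja).
  - right; split=> //; move: (H j bj).
    by rewrite /fa ja ltnn.
have [k' k'_fills _] : exists2 k : X n, fills n (fun m b => g1 m (dcomp da b)) k
    & thin (act (tri n 0 n.-1 n) k).
  apply: IH => //; first lia.
  - exact: natural_comp g1_nat.
  - move=> m b b_block.
    have lowb : low (hit (dcomp da b)).
      move=> k ka; apply/hitP => -[i]; rewrite dcompE daE /fa.
      by have := b_block i; case: ifP; lia.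
    rewrite g1g; last first.
      split; last by right.
      by left; exists 0; split; [lia|lia|lia|apply: lowb].
    rewrite /g0 h_block => [|i]; last first.
      by rewrite !dcompE sE daE /fs /fa; have := b_block i; do 2?case: ifP; lia.
    congr (act _ _); apply: delta_ext => i; rewrite !dcompE !last_letterE; [|lia|lia].
    by rewrite sE daE /fs /fa; have := b_block i; do 2?case: ifP; lia.
  - move=> _; have -> : dcomp da (tri n 0 n.-1 n) = tri N 0 n n.+1.
      apply: dlist_eq => [|i]; first by rewrite tri_ok /N; lia.
      rewrite dcompE daE dlistE ?tri_ok; last lia.
      by case: i => -[|[|[|i]]] //= _; rewrite /fa; case: ifP; lia.
    have lk k : 0 < k < n -> ~~ hit (tri N 0 n n.+1) k.
      by move=> kn; rewrite hitN ?inE /N; lia.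
    rewrite g1g; last first.
      by split; [right; split; apply: lk; lia|left; apply: lk; lia].
    rewrite /g0 (_ : dcomp s _ = tri n 0 n.-1 n); first exact: h_thin.
    apply: dlist_eq => [|i]; first by rewrite tri_ok; lia.
    rewrite dcompE sE dlistE ?tri_ok; last by rewrite /N; lia.
    by case: i => -[|[|[|i]]] //= _; rewrite /fs; case: ifP; lia.
pose g2 m (b : delta m N) := if ~~ hit b a then act (dcomp r b) k' else g1 m b.
have g2E m (b : delta m N) : F1 (hit b) -> g2 m b = g1 m b.
  rewrite /g2; case: ifP => // ba F1b.
  have bE : dcomp da (dcomp r b) = b.
    apply: delta_ext => i; rewrite !dcompE daE rE /fa /fr.
    by move: (lacks_neq i ba); do 2?case: ifP; lia.
  rewrite k'_fills ?bE //.
  case: F1b => [[k [kn ka ka1 bk]]|[bp _]].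
    exists (if k < a then k else k.-1); split; [case: ifP; lia|case: ifP; lia|].
    apply/hitP => -[i]; rewrite dcompE rE /fr.
    by move: (lacks_neq i bk) (lacks_neq i ba); do 2?case: ifP; lia.
  exists a; split; [lia|lia|]; apply/hitP => -[i]; rewrite dcompE rE /fr.
  by move: (lacks_neq i bp) (lacks_neq i ba); case: ifP; lia.
pose F2 (t : pred nat) := F1 t \/ ~~ t a.
have F2f : family F2 by apply: family_or => //; apply: family_lacks.
have g2_nat : natural_on F2 g2.
  move=> m p f b [Fb|ba]; first by rewrite !g2E ?g1_nat //;
    apply: F1f Fb => k; apply: hit_comp.
  by rewrite /g2 ba lacks_comp // dcompA act_comp.
have F2n t : ~ F2 t -> t a /\ forall k, k <= n -> k != a -> k != a.+1 -> t k.
  move=> nF2; split; first by apply: contrapT => /negP ta; apply: nF2; right.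
  move=> k kn ka ka1; apply: contrapT => /negP tk; apply: nF2; left; left.
  by exists k.
have g1_h t : F0 (hit t) -> forall u, dcomp s t = u -> g2 2 t = h 2 u.
  by move=> Ft u <-; rewrite g2E ?g1g //; case: Ft.
have [g3 [g3_nat g3g _]] : exists g3 : forall m, delta m N -> X m,
    [/\ natural_on (fun=> True) g3,
    forall m (t : delta m N), F2 (hit t) -> g3 m t = g2 m t
    & forall x y z, x < y < z -> z <= N -> a.+1 \in [:: x; y; z] ->
        True -> ~ F2 (hit (tri N x y z)) -> thin (g3 2 (tri N x y z))].
  apply: (inner_cone XP F2f g2_nat) => //.
  - by rewrite /N; lia.
  - move=> t _ /F2n [ta tB] [[[k [kn ka ka1]]|[_]]|] /=.
    + by rewrite ka1 (tB k).
    + by rewrite ta andbT negbK => /eqP; lia.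
    + by rewrite ta andbT negbK => /eqP; lia.
  move=> t tN _ /F2n [ta tB] tp; exists a, a.+2; split=> //.
    by apply: tB; lia.
  split=> [k tk|_]; first lia.
  (* The thin triangle a, p, a+2 of the last horn is degenerate, as p is a copy of a+2. *)
  have lowt : low (hit (tri N a a.+1 a.+2)).
    by move=> k ka; rewrite hitN ?inE /N; lia.
  rewrite (g1_h _ _ (tri n a a.+1 a.+1)).
  - apply: (natural_thin_degenerate XP h_nat); [lia|lia|by rewrite eqxx orbT|].
    by exists 0; split; rewrite ?hit_dlist ?inE ?edge_ok; lia.
  - split; last by right.
    by left; exists 0; split; [lia|lia|lia|apply: lowt].
  apply: dlist_eq => [|i]; first by rewrite tri_ok; lia.
  rewrite dcompE sE dlistE ?tri_ok; last by rewrite /N; lia.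
  by case: i => -[|[|[|i]]] //= _; rewrite /fs; case: ifP; lia.
have k_fills : fills n h (g3 n dp).
  move=> m b [j [jn jn' bj]].
  have H k : ~~ hit b k -> ~~ hit (dcomp dp b) (fp k).
    move=> bk; apply/hitP => -[i]; rewrite dcompE dpE /fp.
    by move: (lacks_neq i bk); do 2?case: ifP; lia.
  have Hp : ~~ hit (dcomp dp b) a.+1.
    by apply/hitP => -[i]; rewrite dcompE dpE /fp; case: ifP; lia.
  have Fb : F0 (hit (dcomp dp b)).
    split; last by left.
    have [ja|ja|ja] := ltngtP j a.
    - left; exists j; split; [lia|lia|lia|].
      by move: (H j bj); rewrite /fp (ltnW ja).
    - left; exists j.+1; split; [lia|lia|lia|].
      by move: (H j bj); rewrite /fp leqNgt ja.
    - right; split=> //; move: (H j bj).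
      by rewrite /fp ja leqnn.
  have F1b : F1 (hit (dcomp dp b)) by case: Fb.
  rewrite -g3_nat // g3g ?g2E ?g1g //; last by left.
  congr (h m _); apply: delta_ext => i; rewrite !dcompE sE dpE /fs /fp.
  by do 2?case: ifP; lia.
exists (g3 n dp) => //; rewrite k_fills; first exact: h_thin.
by exists 1; split; rewrite ?hit_tri ?inE; lia.
Qed.

Lemma special_iso : special thin e.
Proof.
split=> [n h n2 h_nat h_edge h_thin|s]; last exact: special_iso_thin.
apply: (iso_fill n2 (leqnn _) h_nat _ h_thin) => m b b_block.
rewrite -h_edge -h_nat.
  congr (h m _); apply: delta_ext => i; rewrite !dcompE dlistE; last by rewrite edge_ok; lia.
  rewrite last_letterE; last lia.
  by have := b_block i; have := ltn_ord (b i); case: eqP => /=; lia.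
by exists 0; split; rewrite ?hit_dlist ?inE ?edge_ok; lia.
Qed.

End WeakBicategory.

(** * Special edges extend to the walking isomorphism *)

(* The letter of the vertex [k] of Delta^n in the alternating word ...0101. *)
Definition letter n k : bool := ~~ odd (n - k).

(* A map hitting all vertices but possibly the last one is determined by the
   alternating word that it reads. *)
Lemma letter_inj m n (a b : delta m n) : 0 < n -> ~ misses n n (hit a) ->
  (forall i, letter n (a i) = letter n (b i)) -> a = b.
Proof.
move=> n0 a_full ab; have a_hit k : k < n -> hit a k.
  move=> kn; apply: contrapT => /negP ak; apply: a_full; exists k; split=> //; lia.
pose A i := nat_of_ord (a (inord i)); pose B i := nat_of_ord (b (inord i)).
have An i : A i <= n by rewrite -ltnS ltn_ord.
have Bn i : B i <= n by rewrite -ltnS ltn_ord.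
have A_mono i j : i <= j <= m -> A i <= A j.
  by move=> ij; apply: delta_mono; rewrite !inordK; lia.
have B_mono i j : i <= j <= m -> B i <= B j.
  by move=> ij; apply: delta_mono; rewrite !inordK; lia.
have parity i : odd (A i) = odd (B i).
  have := ab (inord i); rewrite /letter !oddB //; last by rewrite -ltnS.
    by rewrite /A /B; do 3?case: odd.
  by rewrite -ltnS.
have A_hit k : k < n -> exists2 i, i <= m & A i = k.
  by move=> /a_hit /hitP [i ai]; exists i; [rewrite -ltnS|rewrite /A inord_val].
have A0 : A 0 = 0.
  by have [i im A0] := A_hit 0 n0; have := A_mono 0 i; lia.
have Am : n.-1 <= A m.
  by have [|i im Ai] := A_hit n.-1; [lia|have := A_mono i m; lia].
have A_step i : i < m -> A i.+1 <= (A i).+1.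
  move=> im; rewrite leqNgt; apply/negP => gap.
  have [|j jm Aj] := A_hit (A i).+1; first by have := An i.+1; lia.
  have [ji|ij] := leqP j i; first by have := A_mono j i; lia.
  by have := A_mono i.+1 j; lia.
(* Upwards: when [A] grows the parity changes, so [B] grows as well if it was equal. The reverse
   inequality descends from m, where [A] is at least n-1 and has the parity of [B]; [A] drops by at
   most one at each step. *)
have AB i : i <= m -> A i <= B i.
  elim: i => [|i IH] im; first by rewrite A0.
  have := IH (ltnW im); have := A_step i im; have := B_mono i i.+1.
  have := parity i; have := parity i.+1.
  have [->|ne] := eqVneq (A i.+1) (A i); first by lia.
  have := A_mono i i.+1; move=> *; lia.
have BA i : i <= m -> B (m - i) <= A (m - i).
  elim: i => [|i IH] im; first by rewrite subn0; have := parity m; have := Bn m; lia.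
  have E : m - i = (m - i.+1).+1 by lia.
  have := IH (ltnW im); rewrite E; have := A_step (m - i.+1); have := parity (m - i.+1).
  by have := B_mono (m - i.+1) (m - i.+1).+1; lia.
apply: delta_ext => i; have im : i <= m by rewrite -ltnS.
have := AB i im; have := BA (m - i); rewrite subKn // /A /B inord_val; lia.
Qed.

Section SpecialExtend.
Variables (X : sset) (thin : X 2 -> Prop).
Hypothesis thin_degenerate : forall x : X 2, degenerate x -> thin x.
Variables (e : X 1) (e_special : special thin e).

(* [alternating z] says that [z] factors through the alternating simplex
   ...0101 of [iso_nerve]. *)
Definition alternating n (z : X n) : Prop :=
  [/\ forall m (a b : delta m n),
        (forall i, letter n (a i) = letter n (b i)) -> act a z = act b z,
      forall t : delta 2 n,
        (forall i, letter n (t i) = (i != 1 :> nat)) -> thin (act t z)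
    & act (edge n n.-1 n) z = e].

Lemma alternating_edge : alternating e.
Proof.
split=> [m a b ab|t tE|].
- congr (act _ e); apply: delta_ext => i; have := ab i; rewrite /letter.
  by have := ltn_ord (a i); have := ltn_ord (b i); lia.
- have := tE (inord 0); have := tE (inord 1); rewrite /letter !inordK //.
  have: t (inord 0) <= t (inord 1) by apply: delta_mono; rewrite !inordK.
  by have := ltn_ord (t (inord 1)); lia.
rewrite (_ : edge 1 0 1 = did 1) ?act_id //; symmetry.
by apply: dlist_eq => // -[[|[|i]]] //= ilt; rewrite ffunE.
Qed.

(** The words read in the horn of Delta^(n+1) at its last vertex already occur in [z], so [z]
    determines a map on this horn. Its last edge is [e], and the horn is filled because [e] is
    special. *)
Lemma alternating_step n (z : X n) : 0 < n -> alternating z ->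
  exists2 z' : X n.+1, alternating z' & act (dmk n n.+1 S) z' = z.
Proof.
move=> n0 [z_eq z_thin z_edge].
pose reads m (a : delta m n.+1) (b : delta m n) :=
  forall i, letter n (b i) = letter n.+1 (a i).
pose h m (a : delta m n.+1) : X m :=
  if pselect (exists b, reads m a b) is left H then act (sval (cid H)) z
  else act (dconst m ord0) z.
have hE m a b : reads m a b -> h m a = act b z.
  rewrite /h => ab; case: pselect => [H|[]]; last by exists b.
  by case: (cid H) => b' ab' /=; apply: z_eq => i; rewrite ab ab'.
have ex_reads m (a : delta m n.+1) : misses n.+1 n.+1 (hit a) -> exists b, reads m a b.
  case=> j [jn jn' aj].
  (* A letter depends on the parity of the distance to the last vertex. Passing from n+1 to n, the
     vertices before j move up by one and those after j move down by one; the value at j is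
     irrelevant. *)
  pose f k := if k < j then k.+1 else if k == j then j else k.-1.
  have fE (k : 'I_n.+2) : dmk n.+1 n f k = f k :> nat.
    rewrite dmkE // => [i i' /andP [ii' i'n]|]; rewrite /f.
      by case: (ltngtP i j); case: (ltngtP i' j); lia.
    by case: (ltngtP n.+1 j); lia.
  exists (dcomp (dmk n.+1 n f) a) => i; rewrite dcompE fE /letter /f.
  move: (lacks_neq i aj) (ltn_ord (a i)).
  by case: (ltngtP (a i) j) => //= ia _ an; lia.
have h_nat : natural_on (misses n.+1 n.+1) h.
  move=> m p f a /ex_reads [b ab]; rewrite (hE _ _ _ ab) -act_comp.
  by apply: hE => i; rewrite !dcompE ab.
have ok_edge : dlist_ok 1 n [:: n.-1; n] by rewrite edge_ok; lia.
have h_edge : h 1 (edge n.+1 n n.+1) = e.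
  have ok : dlist_ok 1 n.+1 [:: n; n.+1] by rewrite edge_ok; lia.
  rewrite -z_edge; apply: (hE) => i; rewrite (dlistE i ok_edge) (dlistE i ok).
  by case: i => -[|[|i]] //= _; rewrite /letter; lia.
have h_thin : 2 < n.+1 -> thin (h 2 (tri n.+1 0 n n.+1)).
  move=> n2; have ok : dlist_ok 2 n.+1 [:: 0; n; n.+1] by rewrite tri_ok; lia.
  have [|b rb] := ex_reads 2 (tri n.+1 0 n n.+1).
    by exists 1; split; rewrite ?hit_dlist ?inE; lia.
  rewrite (hE _ _ _ rb).
  have tE i : letter n (b i) = letter n.+1 (nth 0 [:: 0; n; n.+1] i).
    by rewrite rb dlistE.
  (* The triangle reads 101 if n is odd, and 001 if n is even. *)
  have [n_odd|n_even] := boolP (odd n).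
    apply: z_thin => i; rewrite tE; case: i => -[|[|[|i]]] //= _; rewrite /letter; lia.
  rewrite (z_eq _ b (tri n n.-1 n.-1 n)).
    by apply: thin_degenerate; apply: degenerate_tri; lia.
  move=> i; rewrite tE dlistE ?tri_ok; last lia.
  by case: i => -[|[|[|i]]] //= _; rewrite /letter; lia.
have [k k_fills k_thin] := e_special.1 n.+1 h n0 h_nat h_edge h_thin.
have k_eq m (a b : delta m n.+1) :
    (forall i, letter n.+1 (a i) = letter n.+1 (b i)) -> act a k = act b k.
  move=> ab; have [ma|fa] := pselect (misses n.+1 n.+1 (hit a)); last first.
    by rewrite (letter_inj _ fa ab).
  have [mb|fb] := pselect (misses n.+1 n.+1 (hit b)); last first.
    by rewrite (letter_inj _ fb (fun i => esym (ab i))).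
  rewrite !k_fills //; have [c rc] := ex_reads _ _ ma.
  by rewrite (hE _ _ _ rc); symmetry; apply: hE => i; rewrite rc ab.
exists k; last first.
  have S_E i : dmk n n.+1 S i = i.+1 :> nat by rewrite dmkE // => i' j /andP [].
  rewrite k_fills ?(hE _ _ (did n)) ?act_id // => [i|].
    by rewrite S_E ffunE.
  by exists 0; split=> //; apply/hitP => -[i]; rewrite S_E.
split=> // [t tE|]; last first.
  rewrite k_fills //; exists 0; split; rewrite ?hit_dlist ?inE ?edge_ok; lia.
have [mt|ft] := pselect (misses n.+1 n.+1 (hit t)).
  rewrite k_fills //; have [b rb] := ex_reads _ _ mt.
  by rewrite (hE _ _ _ rb); apply: z_thin => i; rewrite rb tE.
(* A triangle reading 101 that hits all of 0, ..., n exists only for n = 1, and is then the triangle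
   012 made thin by the filling. *)
have t_hit j : j < n.+1 -> hit t j.
  by move=> jn; apply: contrapT => /negP tj; apply: ft; exists j; split=> //; lia.
have [x [y [w [tw xyw wn]]]] := triE t.
have ok : dlist_ok 2 n.+1 [:: x; y; w] by rewrite tri_ok xyw.
have hitE j : hit t j = (j \in [:: x; y; w]) by rewrite tw hit_dlist.
have := tE (inord 0); have := tE (inord 1); have := tE (inord 2).
rewrite tw !dlistE // !inordK //= /letter => L2 L1 L0.
have x0 : x = 0 by have := t_hit 0 isT; rewrite hitE !inE; lia.
have y1 : y = 1 by have := t_hit 1; rewrite hitE !inE; lia.
have [n1|n1] := leqP n 1.
  have nE : n = 1 by lia.
  by rewrite (_ : tri _ x y w = tri n.+1 0 n n.+1) //; congr tri; lia.
by have := t_hit 2 n1; have := t_hit 3; rewrite !hitE !inE; lia.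
Qed.

Let alt n := {z : X n.+1 | alternating z}.

Lemma alternating_sequence : exists z : forall n, X n.+1,
  [/\ z 0 = e, forall n, alternating (z n)
    & forall n, act (dmk n.+1 n.+2 S) (z n.+1) = z n].
Proof.
pose next n (z : alt n) : alt n.+1 :=
  let: exist2 z' z'P _ := cid2 (alternating_step (ltn0Sn n) (svalP z)) in
  exist _ z' z'P.
pose fix z n : alt n :=
  if n is n'.+1 then next n' (z n') else exist _ e alternating_edge.
exists (fun n => sval (z n)); split=> // n; first exact: svalP.
by rewrite /= /next; case: cid2.
Qed.

Lemma special_extend : exists2 iso : smap iso_nerve X,
  iso 1 iso01 = e & forall w, thin (iso 2 w).
Proof.
have [z [z0 z_alt z_next]] := alternating_sequence.
have z_shift n d : act (dmk n.+1 (d + n).+1 (addn d)) (z (d + n)) = z n.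
  elim: d => [|d IH].
    rewrite (_ : dmk _ _ _ = did n.+1) ?act_id //; apply: delta_ext => i.
    by rewrite dmkE ?ffunE // => j k /andP [].
  rewrite -[RHS]IH -(z_next (d + n)) -act_comp; congr (act _ _).
  apply: delta_ext => i; rewrite dcompE !dmkE; try (by move=> j k /andP []; lia); lia.
(* In the alternating simplex of dimension 2m+2 the vertices 2i and 2i+1 carry the letters 1 and 0,
   so one of them can serve as the i-th letter of [w]. *)
pose b m (w : 'I_m.+1 -> bool) : delta m m.*2.+2 :=
  dmk m m.*2.+2 (fun k => k.*2 + ~~ w (inord k)).
have bE m w (i : 'I_m.+1) : b m w i = i.*2 + ~~ w i :> nat.
  rewrite dmkE ?inord_val // => [j k /andP [jk km]|]; last first.
    by case: (w _); lia.
  have [->//|jk'] := eqVneq j k.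
  by case: (w _) (w _) => [] []; lia.
pose F m (w : iso_nerve m) : X m := act (b m w) (z m.*2.+1).
have FE m (w : iso_nerve m) n (c : delta m n.+1) :
    (forall i, letter n.+1 (c i) = w i) -> F m w = act c (z n).
  move=> cw; pose N := maxn m.*2.+1 n.
  have E k q (a : delta m k.+1) : q + k = N -> act a (z k) =
      act (dcomp (dmk k.+1 N.+1 (addn q)) a) (z N).
    by move=> qk; rewrite act_comp; congr (act a _); rewrite -qk z_shift.
  rewrite /F (E _ (N - m.*2.+1)) ?(E n (N - n)); [|lia|lia].
  have [z_eq _ _] := z_alt N; apply: z_eq => i; rewrite !dcompE.
  have shE k q (x : 'I_k.+2) : q + k = N -> dmk k.+1 N.+1 (addn q) x = q + x :> nat.
    by move=> qk; rewrite dmkE // => [j j'|]; lia.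
  rewrite !shE; [|lia|lia]; rewrite bE; have := cw i; rewrite /letter; have := ltn_ord (c i).
  by have := ltn_ord i; case: (w i) => /=; lia.
have F_act m p (f : delta m p) (w : iso_nerve p) : F m (act f w) = act f (F p w).
  rewrite {2}/F -act_comp; apply: FE => i; rewrite dcompE bE /letter /=.
  by have := ltn_ord (f i); case: (w _) => /=; lia.
exists (SMap F_act) => /= [|w].
  rewrite -z0 -[RHS]act_id; apply: FE => i; rewrite ffunE /letter /iso01 /=.
  by have := ltn_ord i; case: eqP => /=; lia.
(* A triangle repeating a letter is degenerate, 101 is thin by construction of the sequence, and 010
   is thin by (S5) in the 3-simplex 0101. *)
have F_deg (u : iso_nerve 2) (s : delta 2 1) (v : iso_nerve 1) :
    u = act s v -> thin (F 2 u).
  by move=> ->; rewrite F_act; apply: thin_degenerate; exists 1, s, (F 1 v).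
have wE i : w i = nth false [:: w ord0; w (inord 1); w (inord 2)] i.
  case: i => -[|[|[|i]]] //= ilt; congr w; apply: val_inj; rewrite /= ?inordK //.
have [w01|w01] := eqVneq (w ord0) (w (inord 1)).
  apply: (F_deg w (dlist 2 1 [:: 0; 0; 1])
    (fun i => if val i == 0 then w ord0 else w (inord 2))).
  apply: funext => i; rewrite wE /= dlistE //.
  by case: i => -[|[|[|i]]].
have [w12|w12] := eqVneq (w (inord 1)) (w (inord 2)).
  apply: (F_deg w (dlist 2 1 [:: 0; 1; 1])
    (fun i => if val i == 0 then w ord0 else w (inord 2))).
  apply: funext => i; rewrite wE /= dlistE //.
  by case: i => -[|[|[|i]]].
have thin101 (w' : iso_nerve 2) : (forall i, w' i = (i != 1 :> nat)) -> thin (F 2 w').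
  move=> w'E; have [_ z_thin _] := z_alt 5; apply: (z_thin (b 2 w')) => i.
  by rewrite (bE 2 w' i) w'E /letter; case: i => -[|[|[|i]]].
have [w0|w0] := boolP (w ord0).
  apply: thin101 => i; rewrite wE; move: w01 w12; rewrite w0.
  by case: (w (inord 1)); case: (w (inord 2)) => //; case: i => -[|[|[|i]]].
pose w4 : iso_nerve 3 := fun i => odd i.
have -> : w = act (tri 3 0 1 2) w4.
  apply: funext => i; rewrite wE /= /w4 dlistE //; move: w01 w12 w0.
  case: (w ord0) => //.
  by case: (w (inord 1)); case: (w (inord 2)) => //; case: i => -[|[|[|i]]].
rewrite F_act; apply: e_special.2.
- rewrite -F_act -z0 -[RHS]act_id; apply: FE => i; rewrite ffunE /= /w4 dlistE //.
  by case: i => -[|[|i]].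
- rewrite -F_act; apply: (F_deg _ (dlist 2 1 [:: 0; 1; 1]) (fun i => odd i)).
  by apply: funext => i; rewrite /= /w4 !dlistE //; case: i => -[|[|[|i]]].
- rewrite -F_act; apply: (F_deg _ (dlist 2 1 [:: 0; 0; 1]) (fun i => odd i)).
  by apply: funext => i; rewrite /= /w4 !dlistE //; case: i => -[|[|[|i]]].
rewrite -F_act; apply: thin101 => i; rewrite /= /w4 dlistE //.
by case: i => -[|[|[|i]]].
Qed.

End SpecialExtend.

(** * Composition of special edges *)

Section WeakBicategory.
Variables (X : sset) (thin : X 2 -> Prop) (XP : weak_bicat thin).

(* As [inner_cone], but the faces containing [v] have [v] as last vertex and
   are filled along their last horn. *)
Lemma outer_cone e n (P : pred nat -> Prop) (g : forall m, delta m n -> X m) v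
    (Q : pred nat -> Prop) : special thin e ->
  family P -> natural_on P g -> v <= n -> family Q ->
  (forall a, P a -> Q a) ->
  (forall a, Q a -> ~ P a -> Q (predU1 v a)) ->
  (forall a, Q a -> ~ P a -> ~ P (predD1 a v)) ->
  (forall a : pred nat, (forall k, a k -> k <= n) -> Q a -> ~ P a -> a v ->
     exists x y, [/\ a x, a y, x < y < v,
       (forall k, a k -> x <= k <= v /\ (k < v -> k <= y))
       & [/\ P (hit (edge n y v)), g 1 (edge n y v) = e
         & P (hit (tri n x y v)) -> thin (g 2 (tri n x y v))]]) ->
  exists h : forall m, delta m n -> X m, [/\ natural_on Q h,
    forall m (t : delta m n), P (hit t) -> h m t = g m t
    & forall x y z, x < y < z -> z <= n -> v \in [:: x; y; z] ->
        Q (hit (tri n x y z)) -> ~ P (hit (tri n x y z)) ->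
        thin (h 2 (tri n x y z))].
Proof.
move=> [e_fill _] Pf g_nat vn Qf PQ add_v drop_v outer.
have [|h [[_ _ h_nat] [hg h_thin]]] :=
    @cone_extension X thin n v vn P Q g Pf Qf PQ add_v drop_v g_nat.
  move=> R h [[Rf PR h_nat] [hg h_thin]] RQ p d i d_inj di Qd nPd dR.
  have dv : hit d v by rewrite -di; apply: hit_f.
  have [x [y [/hitP [i1 i1x] /hitP [i2 i2y] xyv adj [Pyv gyv thinP]]]] :=
    outer _ (@hit_le p n d) Qd nPd dv.
  have lt_d (j1 j2 : 'I_p.+1) : (d j1 < d j2) = (j1 < j2).
    apply/idP/idP => [|lt].
      by rewrite ltnNge => /negP H; rewrite ltnNge; apply/negP => /(delta_mono d).
    rewrite ltn_neqAle delta_mono 1?ltnW // andbT; apply/eqP => /val_inj /d_inj e'.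
    by move: lt; rewrite e' ltnn.
  have i1i2 : i1 < i2 by rewrite -lt_d i1x i2y; lia.
  have i2i : i2 < i by rewrite -lt_d i2y di; lia.
  have iE : i = p :> nat.
    apply/eqP; rewrite eqn_leq -ltnS ltn_ord /= leqNgt -[X in _ < X]/(val (@ord_max p)).
    by rewrite -lt_d di -leqNgt; have [] := adj _ (hit_f d ord_max); lia.
  have i1E : i1 = 0 :> nat.
    apply/eqP; rewrite -leqn0 leqNgt -[X in X < _]/(val (@ord0 p)) -lt_d i1x.
    by rewrite -leqNgt; have [] := adj _ (hit_f d ord0); lia.
  have i2E : i2 = p.-1 :> nat.
    have lt : p.-1 < p.+1 by lia.
    apply/eqP; rewrite eqn_leq; apply/andP; split; first by lia.
    rewrite leqNgt -[X in _ < X]/(val (Ordinal lt)) -lt_d i2y -leqNgt.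
    have [_ H] := adj _ (hit_f d (Ordinal lt)); apply: H.
    by rewrite -di lt_d /=; lia.
  have p2 : 2 <= p by lia.
  have i_v : inord p = i by apply: val_inj; rewrite /= inordK // iE.
  have i_y : inord p.-1 = i2 by apply: val_inj; rewrite /= inordK ?i2E //; lia.
  have i_x : inord 0 = i1 by apply: val_inj; rewrite /= inordK ?i1E.
  have dedge : dcomp d (edge p p.-1 p) = edge n y v.
    rewrite /edge dcomp_dlist ?edge_ok /= ?i_v ?i_y ?i2y ?di //; lia.
  have dtri : dcomp d (tri p 0 p.-1 p) = tri n x y v.
    by rewrite /tri dcomp_dlist ?tri_ok /= ?i_v ?i_y ?i_x ?i1x ?i2y ?di //; lia.
  have [||||k k_fills k_thin] := e_fill p (fun m b => h m (dcomp d b)).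
  - by [].
  - by move=> m q f a; rewrite iE in dR => /dR; rewrite dcompA; apply: h_nat.
  - by rewrite dedge hg.
  - move=> p3; rewrite dtri; have [Pt|nPt] := pselect (P (hit (tri n x y v))).
      by rewrite hg //; apply: thinP.
    apply: h_thin => //.
    + rewrite -dtri; apply: dR; exists 1; rewrite iE hit_tri ?inE; [|lia|lia].
      by split; lia.
    + by rewrite hit_tri ?inE ?eqxx ?orbT //; lia.
    + by apply: dinj_tri; lia.
  exists k; first by rewrite iE.
  by move=> p2' t /(dinj_triE p2') ->; move: k_thin; rewrite [X in tri _ _ X.-1 X]p2'.
exists h; split=> // x y z xyz zn v_in Qt nPt; apply: h_thin => //.
  by rewrite hit_tri //; lia.
exact: dinj_tri.
Qed.

Variables (t : X 2) (t_thin : thin t).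
Hypothesis s01 : special thin (act (edge 2 0 1) t).
Hypothesis s12 : special thin (act (edge 2 1 2) t).

(* Vertices: 0, 1, then t on a = 2, b = 3, c = 4. *)
Lemma special_comp_thin (s : X 3) : act (edge 3 2 3) s = act (edge 2 0 2) t ->
  thin (act (tri 3 0 1 3) s) -> thin (act (tri 3 0 2 3) s) ->
  thin (act (tri 3 1 2 3) s) -> thin (act (tri 3 0 1 2) s).
Proof.
move=> s23 t013 t023 t123; pose r := dlist 4 3 [:: 0; 1; 2; 3; 3].
pose q := dlist 4 2 [:: 0; 0; 0; 1; 2].
pose g m (a : delta m 4) := if ~~ hit a 3 then act (dcomp r a) s else act (dcomp q a) t.
have gE1 m (a : delta m 4) : ~~ hit a 3 -> g m a = act (dcomp r a) s.
  by rewrite /g => ->.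
have gE2 m (a : delta m 4) : ~~ hit a 0 -> ~~ hit a 1 -> g m a = act (dcomp q a) t.
  move=> a0 a1; rewrite /g; case: ifP => // a3.
  have vals i : a i = 2 :> nat \/ a i = 4 :> nat.
    move: (lacks_neq i a0) (lacks_neq i a1) (lacks_neq i a3) (ltn_ord (a i)); lia.
  pose u := dlist 4 1 [:: 0; 0; 0; 0; 1].
  have -> : dcomp r a = dcomp (edge 3 2 3) (dcomp u a).
    by apply: delta_ext => i; rewrite !dcompE !dlistE //; case: (vals i) => ->.
  rewrite act_comp s23 -act_comp; congr (act _ t).
  by apply: delta_ext => i; rewrite !dcompE !dlistE //; case: (vals i) => ->.
pose P (a : pred nat) := ~~ a 3 \/ ~~ a 0 /\ ~~ a 1.
have Pf : family P.
  apply: family_or (@family_lacks 3) _.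
  exact: family_and (@family_lacks 0) (@family_lacks 1).
have g_nat : natural_on P g.
  move=> m p f a [a3|[a0 a1]].
    by rewrite !gE1 ?lacks_comp // dcompA act_comp.
  by rewrite !gE2 ?lacks_comp // dcompA act_comp.
have nP a : ~ P a -> a 3 /\ (a 0 || a 1).
  move=> nPa; split; apply: contrapT => /negP H; apply: nPa; [by left|right].
  exact/norP.
have [h [h_nat hg h_thin]] : exists h : forall m, delta m 4 -> X m,
    [/\ natural_on (fun=> True) h,
    forall m (u : delta m 4), P (hit u) -> h m u = g m u
    & forall x y z, x < y < z -> z <= 4 -> 4 \in [:: x; y; z] ->
        True -> ~ P (hit (tri 4 x y z)) -> thin (h 2 (tri 4 x y z))].
  apply: (outer_cone s12 Pf g_nat) => //.
  move=> a an _ /nP [a3 a01] a4; exists (if a 0 then 0 else 1), 3; split=> //.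
  - by move: a01; case: ifP.
  - by case: ifP.
  - move=> k ak; have k4 := an k ak; split; last by move=> k4'; lia.
    case: ifPn => a0; first by lia.
    by have : k != 0 by [apply: contraNneq a0 => <-]; lia.
  split; first by right; rewrite !hit_dlist.
    by rewrite gE2 ?hit_dlist // dlist_comp.
  by case: ifP => _ [|[]]; rewrite !hit_tri.
have new k : k <= 1 -> thin (h 2 (tri 4 k 3 4)).
  move=> k1; apply: h_thin; [lia|by []|by rewrite !inE orbT|by []|].
  by case=> [|[]]; rewrite !hit_tri ?inE; lia.
have old x y z : x <= y <= z -> z <= 4 -> 3 \notin [:: x; y; z] ->
    thin (act (tri 3 (minn x 3) (minn y 3) (minn z 3)) s) -> thin (h 2 (tri 4 x y z)).
  move=> xyz z4 n3 ts; have l3 : ~~ hit (tri 4 x y z) 3 by rewrite hit_tri.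
  rewrite hg ?gE1 //; last by left.
  rewrite /tri dlist_comp ?tri_ok ?xyz //=.
  suff E k : k <= 4 -> nth 0 [:: 0; 1; 2; 3; 3] k = minn k 3 by rewrite !E //; lia.
  by case: k => [|[|[|[|[|k]]]]].
have t234 : thin (h 2 (tri 4 2 3 4)).
  rewrite hg; last by right; rewrite !hit_tri.
  rewrite gE2 ?hit_tri // dlist_comp //= -/(tri 2 0 1 2).
  rewrite (_ : tri 2 0 1 2 = did 2) ?act_id //; symmetry.
  by apply: dlist_eq => // -[[|[|[|i]]]] //= ilt; rewrite ffunE.
have hE m u x y z w : dlist_ok 3 4 [:: x; y; z; w] -> dlist_ok m 3 u ->
    act (dlist m 3 u) (h 3 (tet 4 x y z w)) =
    h m (dlist m 4 [seq nth 0 [:: x; y; z; w] i | i <- u]).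
  by move=> ok uok; rewrite -(natural_dlist h_nat (s := [:: x; y; z; w])).
have h34 : h 1 (edge 4 3 4) = act (edge 2 1 2) t.
  rewrite hg; last by right; rewrite !hit_dlist.
  by rewrite gE2 ?hit_dlist // dlist_comp.
have h23 : h 1 (edge 4 2 3) = act (edge 2 0 1) t.
  rewrite hg; last by right; rewrite !hit_dlist.
  by rewrite gE2 ?hit_dlist // dlist_comp.
(* (S5) at bc moves thinness from c to b; then (S5) at ab moves it from b to a. *)
have t013' : thin (h 2 (tri 4 0 1 3)).
  have := s12.2 (h 3 (tet 4 0 1 3 4)); rewrite !hE //; apply=> //; [|exact: new|exact: new].
  exact: old.
have t023' : thin (h 2 (tri 4 0 2 3)).
  have := s12.2 (h 3 (tet 4 0 2 3 4)); rewrite !hE //; apply=> //; [|exact: new].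
  exact: old.
have t123' : thin (h 2 (tri 4 1 2 3)).
  have := s12.2 (h 3 (tet 4 1 2 3 4)); rewrite !hE //; apply=> //; [|exact: new].
  exact: old.
have : thin (h 2 (tri 4 0 1 2)).
  by have := s01.2 (h 3 (tet 4 0 1 2 3)); rewrite !hE //; apply.
rewrite hg; last by left; rewrite hit_tri.
by rewrite gE1 ?hit_tri // dlist_comp.
Qed.

(* Vertices: the front 0, ..., n-2, then t on a = n-1, b = n, c = n+1. *)
Lemma special_comp_fill n (h : forall m, delta m n -> X m) : 2 <= n ->
  natural_on (misses n n) h -> h 1 (edge n n.-1 n) = act (edge 2 0 2) t ->
  (2 < n -> thin (h 2 (tri n 0 n.-1 n))) ->
  exists2 k : X n, fills n h k & thin (act (tri n 0 n.-1 n) k).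
Proof.
move=> n2 h_nat h_edge h_thin; pose N := n.+1.
pose fr k := minn k n; pose r := dmk N n fr.
have rE k : r k = fr k :> nat.
  by rewrite dmkE /fr /N => [//|i j /andP [ij jN]|]; lia.
pose fq k := k - n.-1; pose q := dmk N 2 fq.
have qE k : q k = fq k :> nat.
  by rewrite dmkE /fq /N => [//|i j /andP [ij jN]|]; lia.
pose fd k := if k < n then k else k.+1; pose d := dmk n N fd.
have dE k : d k = fd k :> nat.
  by rewrite dmkE /fd /N => [//|i j /andP [ij jN]|]; do ?case: ifP; lia.
pose g m (a : delta m N) := if ~~ hit a n then h m (dcomp r a) else act (dcomp q a) t.
pose low (u : pred nat) := forall k, k < n.-1 -> ~~ u k.
pose LF (u : pred nat) := exists2 k, k < n.-1 & ~~ u k.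
have lowf : family low by move=> u w uw wl k /wl; apply: contra; apply: uw.
have LFf : family LF by move=> u w uw [k kn wk]; exists k => //; apply: contra wk; apply: uw.
have LFd k u : n.-1 <= k -> LF (predD1 u k) -> LF u.
  move=> nk [i i_n ui]; exists i => //; apply: contra ui => /= ->.
  by rewrite andbT; lia.
have gE1 m (a : delta m N) : ~~ hit a n -> g m a = h m (dcomp r a).
  by rewrite /g => ->.
have gE2 m (a : delta m N) : low (hit a) -> g m a = act (dcomp q a) t.
  move=> al; rewrite /g; case: ifP => // an.
  have vals i : a i = n.-1 :> nat \/ a i = n.+1 :> nat.
    have [lt|] := ltnP (a i) n.-1; first by have := al _ lt; rewrite hit_f.
    by move: (lacks_neq i an) (ltn_ord (a i)); rewrite /N; lia.
  pose u := dmk N 1 (fun k => k == n.+1).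
  have uE k : u k = (k == n.+1 :> nat) :> nat.
    by rewrite dmkE // => [i j /andP [ij]|]; rewrite /N; do ?case: eqP => /=; lia.
  have ok : dlist_ok 1 n [:: n.-1; n] by rewrite edge_ok; lia.
  have -> : dcomp r a = dcomp (edge n n.-1 n) (dcomp u a).
    apply: delta_ext => i; rewrite !dcompE rE dlistE // uE /fr.
    by case: (vals i) => ->; case: eqP => /=; lia.
  rewrite h_nat.
    rewrite h_edge -act_comp; congr (act _ t).
    apply: delta_ext => i; rewrite !dcompE qE dlistE // uE /fq.
    by case: (vals i) => ->; case: eqP => /=; lia.
  by exists 0; split; rewrite ?hit_dlist ?inE; lia.
(* On [P0] the values come from [h] or from [t]. The faces lacking a front vertex or a are filled at
   c along bc, the one lacking c is filled at b along ab, and the whole simplex along its inner horn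
   at b with thin triangle [t]. The filler is the face opposite to b. *)
pose P0 (u : pred nat) := ~~ u n /\ (LF u \/ ~~ u n.-1) \/ low u.
have P0f : family P0.
  apply: family_or => //; apply: family_and; first exact: family_lacks.
  by apply: family_or => //; apply: family_lacks.
have g_nat : natural_on P0 g.
  move=> m p f a [[an a_miss]|al]; last first.
    rewrite !gE2 // ?dcompA ?act_comp //; apply: lowf al => k; exact: hit_comp.
  rewrite !gE1 ?lacks_comp // dcompA h_nat //.
  have H k : k < n -> ~~ hit a k -> misses n n (hit (dcomp r a)).
    move=> kn ak; exists k; split; [lia|lia|]; apply/hitP => -[i].
    by rewrite dcompE rE /fr; move: (lacks_neq i ak); lia.
  by case: a_miss => [[k kn ak]|an']; [apply: (H k) => //; lia|apply: (H n.-1) => //; lia].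
pose Q1 (u : pred nat) := LF u \/ ~~ u n.-1.
have Q1f : family Q1 by apply: family_or => //; apply: family_lacks.
have low_LF u : low u -> LF u by move=> ul; exists 0; [lia|apply: ul; lia].
have P0Q1 u : P0 u -> Q1 u by case=> [[]//|/low_LF]; left.
have P0n u : Q1 u -> ~ P0 u -> u n /\ exists2 k, k < n.-1 & u k.
  move=> Qu nPu; split; first by apply: contrapT => /negP un; apply: nPu; left.
  apply: contrapT => H; apply: nPu; right=> k kn; apply/negP => uk.
  by apply: H; exists k.
have hitN x y z k : x <= y <= z -> z <= N -> hit (tri N x y z) k = (k \in [:: x; y; z]).
  exact: hit_tri.
have edge_low k : n.-1 <= k <= n -> low (hit (edge N k k.+1)).
  by move=> kn i i_n; rewrite hit_dlist ?edge_ok ?inE /N; lia.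
have g_edge k : n.-1 <= k <= n -> g 1 (edge N k k.+1) = act (edge 2 (k - n.-1) (k - n.-1).+1) t.
  move=> kn; rewrite gE2; last exact: edge_low.
  congr (act _ t); apply: dlist_eq => [|i]; first by rewrite edge_ok; lia.
  rewrite dcompE qE dlistE ?edge_ok; last by rewrite /N; lia.
  by case: i => -[|[|i]] //= _; rewrite /fq; lia.
have [g1 [g1_nat g1g g1_thin]] : exists g1 : forall m, delta m N -> X m,
    [/\ natural_on Q1 g1,
    forall m (u : delta m N), P0 (hit u) -> g1 m u = g m u
    & forall x y z, x < y < z -> z <= N -> N \in [:: x; y; z] ->
        Q1 (hit (tri N x y z)) -> ~ P0 (hit (tri N x y z)) ->
        thin (g1 2 (tri N x y z))].
  apply: (outer_cone s12 P0f g_nat) => //.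
  - move=> u [[k kn uk]|ua] _; [left; exists k => //|right]; rewrite /= negb_or.
      by rewrite uk andbT /N; lia.
    by rewrite ua andbT /N; lia.
  - move=> u Qu /(P0n _ Qu) [un [k kn uk]] [[]|/(_ k kn)] /=.
      by rewrite un andbT /N; lia.
    by rewrite uk andbT /N; lia.
  move=> u uN Qu /(P0n _ Qu) [un [k0 k0n uk0]] uN'.
  have ex : exists k, u k by exists k0.
  exists (ex_minn ex), n; case: ex_minnP => x ux x_min; have := x_min _ uk0 => xk0.
  split=> //; first by rewrite /N; lia.
    by move=> k uk; split; [rewrite x_min ?uN|rewrite /N; lia].
  split; first by right; apply: edge_low; lia.
    rewrite /N g_edge; last lia.
    by congr (act (edge 2 _ _) t); lia.
  by case=> [[]|/(_ x)]; rewrite hitN ?inE /N; lia.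
pose Q2 (u : pred nat) := Q1 u \/ ~~ u N.
have Q2f : family Q2 by apply: family_or => //; apply: family_lacks.
have Q1n u : ~ Q1 u -> u n.-1 /\ forall k, k < n.-1 -> u k.
  move=> nQu; split; first by apply: contrapT => /negP un; apply: nQu; right.
  by move=> k kn; apply: contrapT => /negP uk; apply: nQu; left; exists k.
have low_P0 u : low u -> P0 u by right.
have low_g1 m (u : delta m N) : low (hit u) -> g1 m u = g m u by move/low_P0/g1g.
have abc_low : low (hit (tri N n.-1 n N)).
  by move=> k kn; rewrite hitN ?inE /N; lia.
have abc_thin : thin (g 2 (tri N n.-1 n N)).
  rewrite gE2 // (_ : dcomp q _ = did 2) ?act_id //; apply: delta_ext => i.
  rewrite dcompE qE dlistE ?tri_ok; last by rewrite /N; lia.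
  by rewrite ffunE; case: i => -[|[|[|i]]] //= _; rewrite /fq /N; lia.
have tet_Q1 : 2 < n -> Q1 (hit (tet N 0 n.-1 n N)).
  by move=> n3; left; exists 1; rewrite ?hit_dlist ?tet_ok ?inE /N; lia.
have hE m u : 2 < n -> dlist_ok m 3 u -> act (dlist m 3 u) (g1 3 (tet N 0 n.-1 n N)) =
    g1 m (dlist m N [seq nth 0 [:: 0; n.-1; n; N] i | i <- u]).
  move=> n3 uok; rewrite -(natural_dlist g1_nat (s := [:: 0; n.-1; n; N])) //.
    by rewrite tet_ok /N; lia.
  exact: tet_Q1.
have bc_new : thin (g1 2 (tri N 0 n N)).
  apply: g1_thin; [rewrite /N; lia|by []|by rewrite !inE eqxx !orbT| |].
    by right; rewrite hitN ?inE /N; lia.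
  by case=> [[]|/(_ 0)]; rewrite hitN ?inE /N; lia.
(* The outer horn at b requires 0ab to be thin: (S5) at bc moves thinness from 0ac to it. *)
have ab_thin : 2 < n -> thin (g1 2 (tri N 0 n.-1 n)).
  move=> n3; have := s12.2 (g1 3 (tet N 0 n.-1 n N)).
  rewrite !hE //=; apply=> //.
  - have nE : n.-1 <= n <= n by lia.
    rewrite -/(edge N n N) low_g1; last exact: edge_low.
    by rewrite g_edge // (_ : n - n.-1 = 1); last lia.
  - have F : P0 (hit (tri N 0 n.-1 N)).
      left; split; first by rewrite hitN ?inE /N; lia.
      by left; exists 1; rewrite ?hitN ?inE /N; lia.
    rewrite g1g // gE1; last by rewrite hitN ?inE /N; lia.
    rewrite (_ : dcomp r _ = tri n 0 n.-1 n); first exact: h_thin.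
    apply: dlist_eq => [|i]; first by rewrite tri_ok; lia.
    rewrite dcompE rE dlistE ?tri_ok; last by rewrite /N; lia.
    by case: i => -[|[|[|i]]] //= _; rewrite /fr /N; lia.
  - by rewrite -/(tri N n.-1 n N) low_g1.
have [g2 [g2_nat g2g g2_thin]] : exists g2 : forall m, delta m N -> X m,
    [/\ natural_on Q2 g2,
    forall m (u : delta m N), Q1 (hit u) -> g2 m u = g1 m u
    & forall x y z, x < y < z -> z <= N -> n \in [:: x; y; z] ->
        Q2 (hit (tri N x y z)) -> ~ Q1 (hit (tri N x y z)) ->
        thin (g2 2 (tri N x y z))].
  apply: (outer_cone s01 Q1f g1_nat) => //.
  - by move=> u; left.
  - move=> u [//|uN] _; right; rewrite /= negb_or uN andbT /N; lia.
  - move=> u _ /Q1n [ua uf] [/LFd [|k kn]|] /=; first by lia.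
      by rewrite uf.
    by rewrite ua andbT; lia.
  move=> u uN [//|uN'] /Q1n [ua uf] un; exists 0, n.-1; split=> //.
  - by apply: uf; lia.
  - by lia.
  - move=> k uk; have kN : k != N by apply: contraNneq uN' => <-.
    by have := uN k uk; rewrite /N in kN *; lia.
  have nE : n.-1.+1 = n by lia.
  have ab_low : low (hit (edge N n.-1 n)) by rewrite -[X in edge N _ X]nE; apply: edge_low; lia.
  split; first by left; apply: low_LF.
    rewrite low_g1 // -[X in edge N _ X]nE g_edge; last lia.
    by rewrite (_ : n.-1 - n.-1 = 0) //; lia.
  case=> [[k kn]|]; rewrite hitN ?inE /N; try lia.
  by move=> k0; apply: ab_thin; lia.
have [g3 [g3_nat g3g _]] : exists g3 : forall m, delta m N -> X m,
    [/\ natural_on (fun=> True) g3,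
    forall m (u : delta m N), Q2 (hit u) -> g3 m u = g2 m u
    & forall x y z, x < y < z -> z <= N -> n \in [:: x; y; z] ->
        True -> ~ Q2 (hit (tri N x y z)) -> thin (g3 2 (tri N x y z))].
  apply: (inner_cone XP Q2f g2_nat) => //.
  - move=> u _ nQ2 [[/LFd [|k kn uk]|]|] /=; first by lia.
    + by apply: nQ2; left; left; exists k.
    + rewrite negb_and negbK => /orP [|ua]; first by lia.
      by apply: nQ2; left; right.
    + rewrite negb_and negbK => /orP [|uN]; first by rewrite /N; lia.
      by apply: nQ2; right.
  move=> u uN _ nQ2 un; have nQ1 : ~ Q1 u by move=> Qu; apply: nQ2; left.
  have [ua uf] := Q1n _ nQ1; exists n.-1, N; split=> //; [|lia|].
    by apply: contrapT => /negP uN'; apply: nQ2; right.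
  split=> [k uk|_]; first by rewrite /N; lia.
  by rewrite g2g ?low_g1 //; left; apply: low_LF.
have k_fills : fills n h (g3 n d).
  move=> m b [j [jn jn' bj]].
  have H k : k < n -> ~~ hit b k -> ~~ hit (dcomp d b) k.
    move=> kn bk; apply/hitP => -[i]; rewrite dcompE dE /fd.
    by move: (lacks_neq i bk); case: ifP; lia.
  have Fb : P0 (hit (dcomp d b)).
    left; split.
      by apply/hitP => -[i]; rewrite dcompE dE /fd; case: ifP; lia.
    have [jn1|jn1] := ltnP j n.-1; first by left; exists j => //; apply: H => //; lia.
    by right; have <- : j = n.-1 by [lia]; apply: H => //; lia.
  have Q1b := P0Q1 _ Fb.
  rewrite -g3_nat // g3g ?g2g ?g1g //; last by left.
  rewrite gE1.
    congr (h m _); apply: delta_ext => i; rewrite !dcompE rE dE /fr /fd.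
    by have := ltn_ord (b i); case: ifP; lia.
  by apply/hitP => -[i]; rewrite dcompE dE /fd; case: ifP; lia.
(* For n = 2 the filler is the triangle 0ac, which is thin by the tetrahedron 0abc. *)
exists (g3 n d) => //; have [n3|n3] := ltnP 2 n.
  rewrite k_fills; first exact: h_thin.
  by exists 1; split; rewrite ?hit_tri ?inE; lia.
have nE : n = 2 by lia.
have d_tri : dcomp d (tri n 0 n.-1 n) = tri N 0 n.-1 N.
  apply: dlist_eq => [|i]; first by rewrite tri_ok /N; lia.
  rewrite dcompE dE dlistE ?tri_ok; last lia.
  by case: i => -[|[|[|i]]] //= _; rewrite /fd /N; case: ifP; lia.
rewrite -g3_nat // d_tri; apply: (natural_thin_d2 XP g3_nat (z := n)) => //.
- by lia.
- by rewrite /N; lia.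
- rewrite g3g; last by right; rewrite hitN ?inE /N; lia.
  apply: g2_thin; [lia|rewrite /N; lia|by rewrite !inE eqxx !orbT| |].
    by right; rewrite hitN ?inE /N; lia.
  by case=> [[k kn]|]; rewrite hitN ?inE /N; lia.
- have F : Q1 (hit (tri N 0 n N)) by right; rewrite hitN ?inE /N; lia.
  by rewrite g3g ?g2g //; left.
- have F : Q1 (hit (tri N n.-1 n N)) by left; apply: low_LF.
  by rewrite g3g ?g2g ?low_g1 //; left.
Qed.

Lemma special_comp : special thin (act (edge 2 0 2) t).
Proof.
split=> [n h n2 h_nat h_edge h_thin|s]; last exact: special_comp_thin.
exact: special_comp_fill.
Qed.

End WeakBicategory.

(** * Cylinders *)

Definition yoneda (X : sset) n (x : X n) : smap (simplex n) X :=
  @SMap (simplex n) X (fun m a => act a x) (fun m p f a => act_comp a f x).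

Lemma sset_mono_inj (X Y : sset) (f : smap X Y) :
  monomorphism (C := sset_cat) f -> forall n, injective (f n).
Proof.
move=> f_mono n x y xy.
have /f_mono/(congr1 (fun g : smap (simplex n) X => g n (did n))) :
    smap_comp f (yoneda x) = smap_comp f (yoneda y).
  by apply: smap_eq => m a /=; rewrite !smap_act xy.
by rewrite /= !act_id.
Qed.

Lemma inj_sset_mono (X Y : sset) (f : smap X Y) :
  (forall n, injective (f n)) -> monomorphism (C := sset_cat) f.
Proof.
move=> f_inj W g h fgh; apply: smap_eq => n x; apply: f_inj.
exact: (congr1 (fun k : smap W Y => k n x) fgh).
Qed.

(** When only degenerate triangles of [W] are thin, every simplicial map from [W] is scaled, so such
    [W] test monomorphisms as in simplicial sets. *)
Lemma sc_mono_inj (X Y : scsset) (f : scmap X Y) :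
  monomorphism (C := sc_cat) f <-> forall n, injective (f n).
Proof.
split=> [f_mono|f_inj].
  apply: sset_mono_inj => W g h fgh.
  have deg (k : smap W X) : exists k' : scmap (sc_of (X := W) none) X, sc_smap k' = k.
    unshelve eexists (@ScMap (sc_of none) X k _) => //.
    by move=> x [dx|//]; exact: sc_thin_deg (degenerate_map k dx).
  have [[g' gE] [h' hE]] := (deg g, deg h).
  have /f_mono e : @comp sc_cat _ _ _ f g' = @comp sc_cat _ _ _ f h'.
    apply: scmap_eq => n x; rewrite /= gE hE.
    exact: (congr1 (fun k : smap W Y => k n x) fgh).
  by rewrite -gE -hE e.
move=> W g h fgh; apply: scmap_eq => n x; apply: f_inj.
exact: (congr1 (fun k : scmap W Y => k n x) fgh).
Qed.

(** A map to [iso_nerve] is an arbitrary function on vertices; the vertices outside of the image of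
    [i] are sent to [false]. *)
Lemma iso_nerve_lift (A B : sset) (i : smap A B) (u : smap A iso_nerve) :
  injective (i 0) -> exists h : smap B iso_nerve, smap_comp h i = u.
Proof.
move=> i_inj.
pose h n (b : B n) : iso_nerve n := fun k =>
  `[< exists a : A 0, i 0 a = act (dconst 0 k) b /\ u 0 a ord0 >].
have h_act m n (f : delta m n) (b : B n) : h m (act f b) = act f (h n b).
  apply: funext => k; rewrite /h /=; congr asbool; apply: eq_exists => a.
  rewrite -act_comp (_ : dcomp f (dconst 0 k) = dconst 0 (f k)) //.
  by apply: delta_eq => j; rewrite !ffunE.
exists (SMap h_act); apply: smap_eq => n a; apply: funext => k /=.
have uk : u 0 (act (dconst 0 k) a) ord0 = u n a k.
  by rewrite smap_act /= ffunE.
apply/asboolP/idP => [[a']|ua].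
  by rewrite -smap_act => -[/i_inj ->]; rewrite uk.
by exists (act (dconst 0 k) a); rewrite smap_act uk.
Qed.

Lemma iso_nerve_kan : kan_complex iso_nerve.
Proof.
move=> A B i [n k n0] u v _.
have [|h hu] := iso_nerve_lift (i := sub_incl (horn k)) u; first exact: val_inj.
exists h; split=> //; apply: smap_eq => m x; exact: simplex0_uniq.
Qed.

Section ProductSSet.
Variables X Y : sset.
Definition prod_sset : sset :=
  @SSet (fun n => (X n * Y n)%type) (fun m n f x => (act f x.1, act f x.2))
    (fun n x => etrans (congr2 pair (act_id x.1) (act_id x.2)) (esym (surjective_pairing x)))
    (fun m n p g f x => congr2 pair (act_comp g f x.1) (act_comp g f x.2)).

Definition prod_fst : smap prod_sset X :=
  @SMap prod_sset X (fun n x => x.1) (fun _ _ _ _ => erefl).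
Definition prod_snd : smap prod_sset Y :=
  @SMap prod_sset Y (fun n x => x.2) (fun _ _ _ _ => erefl).
Definition prod_pair (W : sset) (f : smap W X) (g : smap W Y) : smap W prod_sset :=
  @SMap W prod_sset (fun n x => (f n x, g n x))
    (fun m n a x => congr2 pair (smap_act f a x) (smap_act g a x)).

Lemma degenerate_prod n (x : prod_sset n) :
  degenerate x -> degenerate x.1 /\ degenerate x.2.
Proof. by split; [apply: (degenerate_map prod_fst)|apply: (degenerate_map prod_snd)]. Qed.
End ProductSSet.

(** The coproduct of [X] with itself, on which the two ends of the cylinder form one map. *)
Definition double_sset (X : sset) : sset :=
  @SSet (fun n => (bool * X n)%type) (fun m n f x => (x.1, act f x.2))
    (fun n x => etrans (congr1 (pair x.1) (act_id x.2)) (esym (surjective_pairing x)))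
    (fun m n p g f x => congr1 (pair x.1) (act_comp g f x.2)).

Definition double_in (X : sset) (b : bool) : smap X (double_sset X) :=
  @SMap X (double_sset X) (fun n x => (b, x)) (fun _ _ _ _ => erefl).

Definition double_copair_act (X Y : sset) (f g : smap X Y) m n (a : delta m n)
    (x : double_sset X n) :
  (if (act a x).1 then g m (act a x).2 else f m (act a x).2) =
  act a (if x.1 then g n x.2 else f n x.2).
Proof. by case: x => -[] x /=; rewrite smap_act. Qed.
Definition double_copair (X Y : sset) (f g : smap X Y) : smap (double_sset X) Y :=
  @SMap (double_sset X) Y (fun n x => if x.1 then g n x.2 else f n x.2)
    (double_copair_act f g).

Definition double_fold (X : sset) : smap (double_sset X) X :=
  @SMap (double_sset X) X (fun n x => x.2) (fun _ _ _ _ => erefl).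

Definition iso_const (X : sset) (b : bool) : smap X iso_nerve :=
  @SMap X iso_nerve (fun _ _ _ => b) (fun _ _ _ _ => erefl).

Definition sc_prod (X Y : scsset) : scsset :=
  @ScSSet (prod_sset X Y) (fun x => sc_thin x.1 /\ sc_thin x.2)
    (fun x dx => conj (sc_thin_deg (degenerate_prod dx).1)
                      (sc_thin_deg (degenerate_prod dx).2)).

Definition sc_pair (W X Y : scsset) (f : scmap W X) (g : scmap W Y) :
    scmap W (sc_prod X Y) :=
  @ScMap W (sc_prod X Y) (prod_pair f g) (fun x tx => conj (sc_mapP f tx) (sc_mapP g tx)).
Definition sc_fst (X Y : scsset) : scmap (sc_prod X Y) X :=
  @ScMap (sc_prod X Y) X (prod_fst X Y) (fun x tx => tx.1).
Definition sc_snd (X Y : scsset) : scmap (sc_prod X Y) Y :=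
  @ScMap (sc_prod X Y) Y (prod_snd X Y) (fun x tx => tx.2).

Definition sc_iso : scsset :=
  @ScSSet iso_nerve (fun _ => True) (fun _ _ => Logic.I).
Definition sc_iso_map (X : scsset) (f : smap X iso_nerve) : scmap X sc_iso :=
  @ScMap X sc_iso f (fun _ _ => Logic.I).

Definition sc_cyl (X : scsset) : scsset := sc_prod X sc_iso.
Definition sc_end (b : bool) (X : scsset) : scmap X (sc_cyl X) :=
  sc_pair (scmap_id X) (sc_iso_map (iso_const X b)).
Definition sc_cyl_map (X Y : scsset) (f : scmap X Y) : scmap (sc_cyl X) (sc_cyl Y) :=
  sc_pair (scmap_comp f (sc_fst X sc_iso)) (sc_snd X sc_iso).

Definition sc_double (X : scsset) : scsset :=
  @ScSSet (double_sset X) (fun x => sc_thin x.2)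
    (fun x dx => sc_thin_deg (degenerate_map (double_fold X) dx)).
Definition sc_in (X : scsset) (b : bool) : scmap X (sc_double X) :=
  @ScMap X (sc_double X) (double_in X b) (fun x tx => tx).
Lemma sc_copair_thin (X Y : scsset) (f g : scmap X Y) (x : sc_double X 2) :
  sc_thin x -> sc_thin (double_copair f g 2 x).
Proof. by case: x => -[] x tx; [apply: (sc_mapP g)|apply: (sc_mapP f)]. Qed.
Definition sc_copair (X Y : scsset) (f g : scmap X Y) : scmap (sc_double X) Y :=
  ScMap (sc_copair_thin f g).

Lemma sc_products (Z : sc_cat) : exists (P : sc_cat) (p0 p1 : hom P Z),
  (forall W (u v : hom W Z), exists w, p0 \* w = u /\ p1 \* w = v) /\
  (forall W (w w' : hom W P), p0 \* w = p0 \* w' -> p1 \* w = p1 \* w' -> w = w').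
Proof.
exists (sc_prod Z Z), (sc_fst Z Z), (sc_snd Z Z); split=> [W u v|W w w' e0 e1].
  by exists (sc_pair u v); split; apply: scmap_eq.
apply: scmap_eq => n x.
have := congr1 (fun k : scmap W Z => k n x) e0.
have := congr1 (fun k : scmap W Z => k n x) e1 => /=.
by case: (_ n x) (_ n x) => a b [a' b'] /= -> ->.
Qed.

Definition mb_prod (X Y : mbsset) : mbsset :=
  @MbSSet (prod_sset X Y) (fun x => mb_marked x.1 /\ mb_marked x.2)
    (fun x => mb_thin x.1 /\ mb_thin x.2) (fun x => mb_lean x.1 /\ mb_lean x.2)
    (fun x dx => conj (mb_marked_deg (degenerate_prod dx).1)
                      (mb_marked_deg (degenerate_prod dx).2))
    (fun x dx => conj (mb_thin_deg (degenerate_prod dx).1)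
                      (mb_thin_deg (degenerate_prod dx).2))
    (fun x tx => conj (mb_thin_lean tx.1) (mb_thin_lean tx.2)).

Definition mb_pair (W X Y : mbsset) (f : mbmap W X) (g : mbmap W Y) :
    mbmap W (mb_prod X Y) :=
  @MbMap W (mb_prod X Y) (prod_pair f g)
    (fun x h => conj (mb_map_marked f h) (mb_map_marked g h))
    (fun x h => conj (mb_map_thin f h) (mb_map_thin g h))
    (fun x h => conj (mb_map_lean f h) (mb_map_lean g h)).
Definition mb_fst (X Y : mbsset) : mbmap (mb_prod X Y) X :=
  @MbMap (mb_prod X Y) X (prod_fst X Y)
    (fun _ h => h.1) (fun _ h => h.1) (fun _ h => h.1).
Definition mb_snd (X Y : mbsset) : mbmap (mb_prod X Y) Y :=
  @MbMap (mb_prod X Y) Y (prod_snd X Y)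
    (fun _ h => h.2) (fun _ h => h.2) (fun _ h => h.2).

Definition mb_iso : mbsset :=
  @MbSSet iso_nerve (fun _ => True) (fun _ => True) (fun _ => True)
    (fun _ _ => Logic.I) (fun _ _ => Logic.I) (fun _ _ => Logic.I).
Definition mb_iso_map (X : mbsset) (f : smap X iso_nerve) : mbmap X mb_iso :=
  @MbMap X mb_iso f (fun _ _ => Logic.I) (fun _ _ => Logic.I) (fun _ _ => Logic.I).

Definition mb_cyl (X : mbsset) : mbsset := mb_prod X mb_iso.
Definition mb_end (b : bool) (X : mbsset) : mbmap X (mb_cyl X) :=
  mb_pair (mbmap_id X) (mb_iso_map (iso_const X b)).
Definition mb_cyl_map (X Y : mbsset) (f : mbmap X Y) : mbmap (mb_cyl X) (mb_cyl Y) :=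
  mb_pair (mbmap_comp f (mb_fst X mb_iso)) (mb_snd X mb_iso).

Definition mb_double (X : mbsset) : mbsset :=
  @MbSSet (double_sset X) (fun x => mb_marked x.2) (fun x => mb_thin x.2)
    (fun x => mb_lean x.2)
    (fun x dx => mb_marked_deg (degenerate_map (double_fold X) dx))
    (fun x dx => mb_thin_deg (degenerate_map (double_fold X) dx))
    (fun x tx => mb_thin_lean tx).
Definition mb_in (X : mbsset) (b : bool) : mbmap X (mb_double X) :=
  @MbMap X (mb_double X) (double_in X b) (fun _ h => h) (fun _ h => h) (fun _ h => h).

Lemma mb_copair_exists (X Y : mbsset) (f g : mbmap X Y) :
  exists w : mbmap (mb_double X) Y, mb_smap w = double_copair f g.
Proof.
unshelve eexists (@MbMap (mb_double X) Y (double_copair f g) _ _ _) => //.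
- by case=> -[] x h; [apply: (mb_map_marked g)|apply: (mb_map_marked f)].
- by case=> -[] x h; [apply: (mb_map_thin g)|apply: (mb_map_thin f)].
- by case=> -[] x h; [apply: (mb_map_lean g)|apply: (mb_map_lean f)].
Qed.

Lemma mb_products (Z : mb_cat) : exists (P : mb_cat) (p0 p1 : hom P Z),
  (forall W (u v : hom W Z), exists w, p0 \* w = u /\ p1 \* w = v) /\
  (forall W (w w' : hom W P), p0 \* w = p0 \* w' -> p1 \* w = p1 \* w' -> w = w').
Proof.
exists (mb_prod Z Z), (mb_fst Z Z), (mb_snd Z Z); split=> [W u v|W w w' e0 e1].
  by exists (mb_pair u v); split; apply: mbmap_eq.
apply: mbmap_eq => n x.
have := congr1 (fun k : mbmap W Z => k n x) e0.
have := congr1 (fun k : mbmap W Z => k n x) e1 => /=.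
by case: (_ n x) (_ n x) => a b [a' b'] /= -> ->.
Qed.

Section ScaledModel.
Variable M : model_structure sc_cat.
Hypothesis cofM : forall (X Y : scsset) (f : scmap X Y),
  cof M (f : @hom sc_cat X Y) <-> forall n, injective (f n).

(** The projection lifts against all monomorphisms, by [iso_nerve_lift]. *)
Lemma sc_weq_fst X : weq M (sc_fst X sc_iso : @hom sc_cat (sc_cyl X) X).
Proof.
apply: weq_of_lift => A B i /cofM i_inj u v sq.
have [h hu] := iso_nerve_lift (smap_comp (prod_snd X iso_nerve) u) (i_inj 0).
exists (sc_pair v (sc_iso_map h)); split; last exact: scmap_eq.
apply: scmap_eq => n x /=; rewrite [RHS]surjective_pairing; congr pair.
  by rewrite -[LHS](congr1 (fun k : scmap A X => k n x) sq).
exact: (congr1 (fun k : smap A iso_nerve => k n x) hu).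
Qed.

Lemma sc_cof_end b X : cof M (sc_end b X : @hom sc_cat X (sc_cyl X)).
Proof. by apply/cofM => n x y []. Qed.

Lemma sc_codiagonal (B : sc_cat) :
  exists (S : sc_cat) (j0 j1 : hom B S) (c : @hom sc_cat S (sc_cyl B)),
  [/\ forall W (u v : hom B W), exists w, w \* j0 = u /\ w \* j1 = v,
      forall W (w w' : hom S W), w \* j0 = w' \* j0 -> w \* j1 = w' \* j1 -> w = w',
      cof M c & c \* j0 = sc_end false B /\ c \* j1 = sc_end true B].
Proof.
exists (sc_double B), (sc_in B false), (sc_in B true).
exists (sc_copair (sc_end false B) (sc_end true B)); split.
- by move=> W u v; exists (sc_copair u v); split; apply: scmap_eq.
- move=> W w w' e0 e1; apply: scmap_eq => n [[] x].
    exact: (congr1 (fun k : scmap B W => k n x) e1).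
  exact: (congr1 (fun k : scmap B W => k n x) e0).
- apply/cofM => n [b x] [b' x'] /= e.
  have /(congr1 (fun w => w ord0)) /= : (fun=> b) = (fun=> b') :> ('I_n.+1 -> bool).
    by case: b b' e => -[] [].
  by move=> ->; congr pair; case: b b' e => -[] [].
by split; apply: scmap_eq.
Qed.

Definition sc_homotopic (A Z : sc_cat) (u v : hom A Z) : Prop :=
  homotopic (C := sc_cat) (Cyl := sc_cyl) (sc_end false) (sc_end true) u v.

Lemma sc_weq_of_extension (A B : sc_cat) (i : hom A B) :
  (forall (Z : sc_cat) (u : hom A Z), fibrant M Z -> exists h, h \* i = u) ->
  (forall (Z : sc_cat) (u v : hom B Z), fibrant M Z -> u \* i = v \* i ->
     sc_homotopic u v) ->
  weq M i.
Proof.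
apply: (weq_of_extension sc_point_terminal (cmap := sc_cyl_map)
  (pr := fun X => sc_fst X sc_iso)) => //.
- by move=> X Y f; apply: scmap_eq.
- by move=> X Y f; apply: scmap_eq.
- by move=> X; apply: scmap_eq.
- by move=> X; apply: scmap_eq.
- exact: sc_weq_fst.
- exact: sc_cof_end.
Qed.

Lemma sc_homotopic_of_tcof (A B Z : sc_cat) (i : hom A B) (u v : hom B Z) :
  cof M i -> weq M i -> fibrant M Z -> u \* i = v \* i -> sc_homotopic u v.
Proof.
apply: (homotopic_of_tcof sc_point_terminal
  (pr := fun X => sc_fst X sc_iso)).
- by move=> X; apply: scmap_eq.
- by move=> X; apply: scmap_eq.
- exact: sc_products.
- exact: sc_codiagonal.
Qed.

End ScaledModel.

Section MbModel.
Variable N : model_structure mb_cat.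
Hypothesis cofN : forall (X Y : mbsset) (f : mbmap X Y),
  cof N (f : @hom mb_cat X Y) <-> forall n, injective (f n).

Lemma mb_weq_fst X : weq N (mb_fst X mb_iso : @hom mb_cat (mb_cyl X) X).
Proof.
apply: weq_of_lift => A B i /cofN i_inj u v sq.
have [h hu] := iso_nerve_lift (smap_comp (prod_snd X iso_nerve) u) (i_inj 0).
exists (mb_pair v (mb_iso_map h)); split; last exact: mbmap_eq.
apply: mbmap_eq => n x /=; rewrite [RHS]surjective_pairing; congr pair.
  by rewrite -[LHS](congr1 (fun k : mbmap A X => k n x) sq).
exact: (congr1 (fun k : smap A iso_nerve => k n x) hu).
Qed.

Lemma mb_cof_end b X : cof N (mb_end b X : @hom mb_cat X (mb_cyl X)).
Proof. by apply/cofN => n x y []. Qed.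

Lemma mb_codiagonal (B : mb_cat) :
  exists (S : mb_cat) (j0 j1 : hom B S) (c : @hom mb_cat S (mb_cyl B)),
  [/\ forall W (u v : hom B W), exists w, w \* j0 = u /\ w \* j1 = v,
      forall W (w w' : hom S W), w \* j0 = w' \* j0 -> w \* j1 = w' \* j1 -> w = w',
      cof N c & c \* j0 = mb_end false B /\ c \* j1 = mb_end true B].
Proof.
have [c cE] := mb_copair_exists (mb_end false B) (mb_end true B).
exists (mb_double B), (mb_in B false), (mb_in B true), c; split.
- move=> W u v; have [w wE] := mb_copair_exists u v.
  by exists w; split; apply: mbmap_eq => n x; rewrite /= wE.
- move=> W w w' e0 e1; apply: mbmap_eq => n [[] x].
    exact: (congr1 (fun k : mbmap B W => k n x) e1).
  exact: (congr1 (fun k : mbmap B W => k n x) e0).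
- apply/cofN => n [b x] [b' x']; rewrite cE /= => e.
  have /(congr1 (fun w => w ord0)) /= : (fun=> b) = (fun=> b') :> ('I_n.+1 -> bool).
    by case: b b' e => -[] [].
  by move=> ->; congr pair; case: b b' e => -[] [].
by split; apply: mbmap_eq => n x; rewrite /= cE.
Qed.

Definition mb_homotopic (A Z : mb_cat) (u v : hom A Z) : Prop :=
  homotopic (C := mb_cat) (Cyl := mb_cyl) (mb_end false) (mb_end true) u v.

Lemma mb_weq_of_extension (A B : mb_cat) (i : hom A B) :
  (forall (Z : mb_cat) (u : hom A Z), fibrant N Z -> exists h, h \* i = u) ->
  (forall (Z : mb_cat) (u v : hom B Z), fibrant N Z -> u \* i = v \* i ->
     mb_homotopic u v) ->
  weq N i.
Proof.
apply: (weq_of_extension mb_point_terminal (cmap := mb_cyl_map)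
  (pr := fun X => mb_fst X mb_iso)) => //.
- by move=> X Y f; apply: mbmap_eq.
- by move=> X Y f; apply: mbmap_eq.
- by move=> X; apply: mbmap_eq.
- by move=> X; apply: mbmap_eq.
- exact: mb_weq_fst.
- exact: mb_cof_end.
Qed.

Lemma mb_homotopic_of_tcof (A B Z : mb_cat) (i : hom A B) (u v : hom B Z) :
  cof N i -> weq N i -> fibrant N Z -> u \* i = v \* i -> mb_homotopic u v.
Proof.
apply: (homotopic_of_tcof mb_point_terminal
  (pr := fun X => mb_fst X mb_iso)).
- by move=> X; apply: mbmap_eq.
- by move=> X; apply: mbmap_eq.
- exact: mb_products.
- exact: mb_codiagonal.
Qed.

End MbModel.

(** * Fibrant objects *)

Lemma facesP m n (s : seq (seq nat)) (t : simplex n m) :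
  faces s t -> exists2 l, l \in s & t = dlist m n l.
Proof.
rewrite /faces (_ : [seq _ | _ <- _] = [seq val (t (inord i)) | i <- iota 0 m.+1]).
  by move=> ts; exists [seq val (t (inord i)) | i <- iota 0 m.+1] => //; apply: deltaE.
rewrite -val_enum_ord -map_comp; apply: eq_map => i /=.
by rewrite inord_val.
Qed.

Lemma faces_dlistE m n (s : seq (seq nat)) l :
  dlist_ok m n l -> faces s (dlist m n l : simplex n m) = (l \in s).
Proof.
move=> l_ok; rewrite /faces (_ : [seq _ | _ <- _] = l) //.
have /and3P [/eqP sz _ _] := l_ok.
apply: (@eq_from_nth _ 0) => [|i]; rewrite size_map size_enum_ord ?sz // => im.
by rewrite (nth_map ord0) ?size_enum_ord //= dlistE // nth_enum_ord.
Qed.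

Lemma faces_dlist m n (s : seq (seq nat)) l :
  dlist_ok m n l -> l \in s -> faces s (dlist m n l : simplex n m).
Proof. by move/faces_dlistE ->. Qed.

Lemma faces1P m n l (t : simplex n m) : faces [:: l] t -> t = dlist m n l.
Proof. by case/facesP => _ /[1!inE] /eqP ->. Qed.

Definition smap_of_horn (X : sset) n (i : 'I_n.+1) (h : forall m, delta m n -> X m)
    (h_nat : natural_on (misses n i) h) : smap (sub_sset (horn i)) X :=
  @SMap (sub_sset (horn i)) X (fun m x => h m (val x))
    (fun m p f x => h_nat m p f (val x) (proj2 (misses_hornP i (val x)) (valP x))).

Definition horn_simplex n (i : 'I_n.+1) m (b : delta m n)
    (mb : misses n i (hit b)) : sub_sset (horn i) m :=
  exist (fun x : simplex n m => horn i m x) b (proj1 (misses_hornP i b) mb).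

Lemma sc_lift_terminal (X A B : scsset) (i : scmap A B) (u : scmap A X) :
  has_lift (i : @hom sc_cat A B) (sc_to_point X : @hom sc_cat X sc_point) ->
  exists h : scmap B X, forall n (x : A n), h n (i n x) = u n x.
Proof.
move=> li; have [|h [hi _]] := li u (sc_to_point B); first exact: scmap_eq.
exists h => n x; exact: (congr1 (fun k : scmap A X => k n x) hi).
Qed.

Lemma mb_lift_terminal (X A B : mbsset) (i : mbmap A B) (u : mbmap A X) :
  has_lift (i : @hom mb_cat A B) (mb_to_point X : @hom mb_cat X (mb_base sc_point)) ->
  exists h : mbmap B X, forall n (x : A n), h n (i n x) = u n x.
Proof.
move=> li; have [|h [hi _]] := li u (mb_to_point B); first exact: mbmap_eq.
exists h => n x; exact: (congr1 (fun k : mbmap A X => k n x) hi).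
Qed.

Lemma saturation_generator (C : category) (G : mor_class C) (X Y : C) (f : hom X Y) :
  G X Y f -> saturation G f.
Proof. by move=> Gf S _; apply. Qed.

Section InftyBicategory.
Variables (X : scsset) (X_bicat : infty_bicategory X).

Lemma sc_lift (A B : scsset) (i : scmap A B) (u : scmap A X) :
  @scaled_generator A B i -> exists h : scmap B X, forall n (x : A n), h n (i n x) = u n x.
Proof. by move=> Gi; exact: sc_lift_terminal (X_bicat (saturation_generator Gi)). Qed.

Lemma infty_bicategory_weak : weak_bicat (@sc_thin X).
Proof.
split; first exact: sc_thin_deg.
  move=> n i h i_n h_nat h_thin; have i_lt : i < n.+1 by lia.
  have n2 : 2 <= n by lia.
  have ok : dlist_ok 2 n [:: i.-1; i; i.+1] by rewrite tri_ok; lia.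
  pose u := smap_of_horn (i := Ordinal i_lt) h_nat.
  pose T := @faces n 2 [:: [:: i.-1; i; i.+1]].
  have u_thin (x : sc_of (preim_coll (sub_incl (horn (Ordinal i_lt))) T) 2) :
      sc_thin x -> sc_thin (u 2 x).
    case=> [dx|/faces1P Tx]; first exact: sc_thin_deg (degenerate_map u dx).
    case: x Tx => x /= hx xE; rewrite /= xE; apply: h_thin.
    rewrite -[tri _ _ _ _]xE; exact: (proj2 (misses_hornP (Ordinal i_lt) x) hx).
  have [k ku] := sc_lift (ScMap u_thin) (@ScInner n (Ordinal i_lt) n2 i_n).
  have kE m (b : delta m n) : act b (k n (did n)) = k m b.
    by rewrite -smap_act /= dcomp1m.
  exists (k n (did n)).
    by move=> m b mb; rewrite kE; exact: (ku m (horn_simplex (i := Ordinal i_lt) mb)).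
  by rewrite kE; apply: sc_mapP; right; apply: faces_dlist; rewrite ?inE.
move=> s t024 t123 t013 t134 t012.
have u_thin (x : sc_of (@faces 4 2 T4) 2) : sc_thin x -> sc_thin (yoneda s 2 x).
  case=> [dx|/facesP [l lT ->]]; first exact: sc_thin_deg (degenerate_map (yoneda s) dx).
  by move: lT; rewrite !inE => /or4P [| | |/orP []] /eqP ->.
have [k ku] := sc_lift (ScMap u_thin) ScSaturate.
have kE (t : delta 2 4) : act t s = k 2 t by have := ku 2 t.
by split; rewrite kE; apply: sc_mapP; right; apply: faces_dlist.
Qed.

End InftyBicategory.

(** * Fibrant marked biscaled simplicial sets *)

Section MbFibrant.
Variables (Y : mbsset) (Y_fib : two_cartesian_fibration (mb_to_point Y)).

Lemma mb_lift (A B : mbsset) (i : mbmap A B) (u : mbmap A Y) :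
  @MB_generator A B i -> exists h : mbmap B Y, forall n (x : A n), h n (i n x) = u n x.
Proof. by move=> Gi; exact: mb_lift_terminal (Y_fib (saturation_generator Gi)). Qed.

Lemma mb_fibrant_lean (x : Y 2) : mb_lean x -> mb_thin x.
Proof.
move=> lx; pose f := yoneda x.
unshelve epose (u := @MbMap (mb_of (X := simplex 2) none none all_simp) Y f _ _ _).
- by move=> y [dy|//]; exact: mb_marked_deg (degenerate_map f dy).
- by move=> y [dy|//]; exact: mb_thin_deg (degenerate_map f dy).
- move=> y _; have [a [b [c [yE abc c2]]]] := triE (y : delta 2 2).
  have [lt|ge] := boolP (a < b < c); last first.
    apply/mb_thin_lean/mb_thin_deg; rewrite yE; apply: degenerate_tri => //; lia.
  have -> : y = did 2.
    rewrite yE; apply: delta_ext => i; rewrite dlistE ?tri_ok ?abc // ffunE.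
    by case: i => -[|[|[|i]]] //= _; lia.
  by rewrite /f /= act_id.
have [k ku] := mb_lift u S2.
have <- : k 2 (did 2) = x by rewrite [LHS](ku 2 (did 2)) /= act_id.
by apply: mb_map_thin; right.
Qed.

(** The outer scaled generator has a thin triangle where (A3) has a lean one; in [Y] the two notions
    agree. *)
Lemma mb_fibrant_underlying : infty_bicategory (U_ob Y).
Proof.
apply: saturation_lift => A B i Gi u v _.
suff [h hi] : exists h : scmap B (U_ob Y), forall n (x : A n), h n (i n x) = u n x.
  by exists h; split; apply: scmap_eq => n x;
    [apply: hi|apply: simplex0_uniq].
have marked_deg (Z : sset) (f : smap Z Y) (x : Z 1) :
    with_degenerate none x -> mb_marked (f 1 x).
  by case=> // dx; exact: mb_marked_deg (degenerate_map f dx).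
have thin_deg (Z : sset) (f : smap Z Y) (x : Z 2) :
    with_degenerate none x -> mb_thin (f 2 x).
  by case=> // dx; exact: mb_thin_deg (degenerate_map f dx).
case: i / Gi u v.
- move=> n i n2 i_n u _; set T := faces _ in u *.
  pose Th := preim_coll (sub_incl (horn i)) T.
  have u_lean x : with_degenerate Th x \/ Th x -> mb_lean (u 2 x).
    by move=> Tx; apply/mb_thin_lean/(sc_mapP u); case: Tx => // Tx; right.
  have u_marked x : with_degenerate (preim_coll (sub_incl (horn i)) none) x ->
      mb_marked (u 1 x) by exact: marked_deg.
  have [k ku] := mb_lift (@MbMap (mb_of (preim_coll _ none) Th Th) Y u
    u_marked (sc_mapP u) u_lean) (A1 n2 i_n).
  by exists (@ScMap (sc_of T) (U_ob Y) k (mb_map_thin k)).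
- move=> u _; have u_lean x : with_degenerate (@faces 4 2 T4) x \/ faces T4 x ->
      mb_lean (u 2 x).
    by move=> Tx; apply/mb_thin_lean/(sc_mapP u); case: Tx => // Tx; right.
  have [k ku] := mb_lift (@MbMap (mb_of none _ _) Y u
    (@marked_deg _ u) (sc_mapP u) u_lean) A2.
  by exists (@ScMap (sc_of _) (U_ob Y) k (mb_map_thin k)).
move=> n n2 u _; set T := image_coll _ _ in u *.
pose Th := preim_coll (chorn0_incl n) T.
have u_lean x : with_degenerate (preim_coll (chorn0_incl n) none) x \/ Th x ->
    mb_lean (u 2 x).
  case=> [dx|Tx]; first exact/mb_thin_lean/(@thin_deg _ u).
  by apply/mb_thin_lean/(sc_mapP u); right.
have [k ku] := mb_lift (@MbMap (mb_of (preim_coll _ none) (preim_coll _ none) Th) Y u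
  (@marked_deg _ u) (@thin_deg _ u) u_lean) (A3 (ltnW n2)).
have k_thin (x : sc_of T 2) : sc_thin x -> mb_thin (k 2 x).
  case=> [dx|Tx]; first exact: mb_thin_deg (degenerate_map k dx).
  by apply/mb_fibrant_lean/(mb_map_lean k); right.
by exists (@ScMap (sc_of T) (U_ob Y) k k_thin).
Qed.

Lemma mb_fibrant_special (e : Y 1) : mb_marked e -> special (@mb_thin Y) e.
Proof.
move=> e_marked; split=> [n h n2 h_nat h_edge h_thin|s s23 t013 t023 t123].
  have edge_ok' : dlist_ok 1 n [:: n.-1; n] by rewrite edge_ok; lia.
  have tri_ok' : dlist_ok 2 n [:: 0; n.-1; n] by rewrite tri_ok; lia.
  pose u := smap_of_horn (i := ord_max) h_nat.
  pose E := @faces n 1 [:: [:: n.-1; n]].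
  pose C := @faces n 2 [:: [:: 0; n.-1; n]].
  pose inc := sub_incl (horn (@ord_max n)).
  unshelve epose (v := @MbMap (mb_of (preim_coll inc E) (preim_coll inc none)
    (preim_coll inc C)) Y u _ _ _).
  - move=> x [dx|/faces1P Ex]; first exact: mb_marked_deg (degenerate_map u dx).
    by case: x Ex => x /= hx xE; rewrite /= xE -/(edge n n.-1 n) h_edge.
  - by move=> x [dx|//]; exact: mb_thin_deg (degenerate_map u dx).
  - move=> x [[dx|//]|/faces1P Cx].
      exact/mb_thin_lean/mb_thin_deg/(degenerate_map u dx).
    case: x Cx => x /= hx xE; rewrite /= xE; apply/mb_thin_lean/h_thin.
    have [j [jn jm]] := proj2 (misses_hornP ord_max x) hx.
    by rewrite [x]xE hit_dlist // !inE => jx; move: jm => /=; lia.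
  have [k ku] := mb_lift v (A4 n2).
  have kE m (b : delta m n) : act b (k n (did n)) = k m b.
    by rewrite -smap_act /= dcomp1m.
  exists (k n (did n)).
    by move=> m b mb; rewrite kE; exact: (ku m (horn_simplex (i := ord_max) mb)).
  by rewrite kE; apply/mb_fibrant_lean/(mb_map_lean k); right; apply: faces_dlist; rewrite ?inE.
pose f := yoneda s.
pose E := @faces 3 1 [:: [:: 2; 3]].
unshelve epose (u := @MbMap (mb_of E none U3) Y f _ _ _).
- move=> x [dx|/faces1P ->]; first exact: mb_marked_deg (degenerate_map f dx).
  by rewrite /f /= -/(edge 3 2 3) s23.
- by move=> x [dx|//]; exact: mb_thin_deg (degenerate_map f dx).
- move=> x [[dx|//]|Ux]; first exact/mb_thin_lean/mb_thin_deg/(degenerate_map f dx).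
  have [a [b [c [xE abc c3]]]] := triE (x : delta 2 3).
  have ok : dlist_ok 2 3 [:: a; b; c] by rewrite tri_ok abc.
  apply: mb_thin_lean; rewrite /f /= xE.
  have [lt|ge] := boolP (a < b < c); last first.
    by apply: mb_thin_deg; apply: degenerate_tri => //; lia.
  have : [:: a; b; c] <> [:: 0; 1; 2].
    by move=> abcE; apply: Ux; rewrite xE /tri abcE; apply: faces_dlist.
  case: a b c abc c3 lt {xE ok} => [|[|a]] [|[|[|b]]] [|[|[|[|c]]]] //=; lia.
have [k ku] := mb_lift u S5.
have <- : k 2 (tri 3 0 1 2) = act (tri 3 0 1 2) s by rewrite [LHS](ku 2 (tri 3 0 1 2)).
by apply/mb_fibrant_lean/(mb_map_lean k); right.
Qed.

Lemma mb_fibrant_kan (K : sset) (f : smap K Y) : kan_complex K ->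
  (forall x, mb_thin (f 2 x)) -> forall x, mb_marked (f 1 x).
Proof.
move=> K_kan f_thin.
unshelve epose (u := @MbMap (mb_of (X := K) none all_simp all_simp) Y f _ _ _).
- by move=> y [dy|//]; exact: mb_marked_deg (degenerate_map f dy).
- by move=> y _.
- by move=> y _; apply: mb_thin_lean.
have [k ku] := mb_lift u (SE K_kan) => x.
by rewrite -[f 1 x](ku 1 x); apply: mb_map_marked; right.
Qed.

End MbFibrant.

(** Partial maps are encoded as total functions: outside of the horn the value is the constant
    simplex at [x0]. *)
Definition map_of_horn (X : sset) n (i : 'I_n.+1) (u : smap (sub_sset (horn i)) X)
    (x0 : X 0) m (b : delta m n) : X m :=
  if insub (b : simplex n m) is Some x then u m x else act (dconst m ord0) x0.

Section MapOfHorn.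
Variables (X : sset) (n : nat) (i : 'I_n.+1) (u : smap (sub_sset (horn i)) X).
Variable x0 : X 0.

Lemma map_of_hornE m (x : sub_sset (horn i) m) : map_of_horn u x0 (val x) = u m x.
Proof. by rewrite /map_of_horn valK. Qed.

Lemma map_of_horn_natural : natural_on (misses n i) (map_of_horn u x0).
Proof.
move=> m p f a /(misses_hornP i a) ha.
rewrite -[a]/(val (exist (fun x : simplex n p => horn i p x) a ha)).
rewrite -[dcomp _ f]/(val (sub_act f (exist (fun x : simplex n p => horn i p x) a ha))).
by rewrite !map_of_hornE (smap_act u).
Qed.

Lemma horn_vertex : 1 < n -> exists x : sub_sset (horn i) 0, True.
Proof.
move=> n1; have mi : misses n i (hit (dlist 0 n [:: (i == 0 :> nat) : nat])).
  exists (if i <= 1 then 2 else 1); split; try by case: ifP => //; lia.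
  rewrite hit_dlist; first by rewrite inE; case: (nat_of_ord i) => [|[|j]].
  by rewrite /dlist_ok /= andbT; case: eqP => /=; lia.
by exists (horn_simplex mi).
Qed.

End MapOfHorn.

(** For (E): this lets [special_extend] extend any edge of a Kan complex to a map from J. *)
Lemma kan_special (K : sset) (e : K 1) : kan_complex K -> special (@all_simp K 2) e.
Proof.
move=> K_kan; split=> // n h n2 h_nat _ _.
have n0 : 0 < n by lia.
have [|k [ku _]] := K_kan _ _ _ (HornInclusion (@ord_max n) n0)
    (smap_of_horn (i := ord_max) h_nat) (to_simplex0 _).
  by apply: smap_eq => m x; apply: simplex0_uniq.
exists (k n (did n)) => // m b mb; rewrite -smap_act /= dcomp1m.
exact: (congr1 (fun f : smap _ K => f m (horn_simplex (i := ord_max) mb)) ku).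
Qed.

(** * The natural marking of an oo-bicategory *)

Section NaturalMarking.
Variables (X : scsset) (X_bicat : infty_bicategory X).
Let XP := infty_bicategory_weak X_bicat.

(** A degenerate edge extends to a constant map on J. *)
Lemma special_degenerate (e : X 1) : degenerate e -> special (@sc_thin X) e.
Proof.
case=> [[|m]] [f [y [// _ ->]]].
pose c n (w : iso_nerve n) : X n := act (dconst n ord0) y.
have c_act m n (a : delta m n) (w : iso_nerve n) : c m (act a w) = act a (c n w).
  by rewrite /c -act_comp; congr (act _ y); apply: simplex0_uniq.
have -> : act f y = SMap c_act 1 iso01.
  by congr (act _ y); apply: (@simplex0_uniq 1).
apply: special_iso => // w; apply: sc_thin_deg.
by exists 0, (dconst 2 ord0), y.
Qed.

Definition natural_mb : mbsset :=
  @MbSSet X (special (@sc_thin X)) (@sc_thin X) (@sc_thin X)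
    special_degenerate (@sc_thin_deg X) (fun _ => id).

Lemma thin_faces (s : X 3) :
  sc_thin (act (tri 3 0 1 2) s) -> sc_thin (act (tri 3 0 1 3) s) ->
  sc_thin (act (tri 3 0 2 3) s) -> sc_thin (act (tri 3 1 2 3) s) ->
  forall a : delta 2 3, sc_thin (act a s).
Proof.
move=> t012 t013 t023 t123 a; have [x [y [z [-> xyz z3]]]] := triE a.
have [lt|ge] := boolP (x < y < z); last by apply: (thin_tri XP) => //; lia.
by case: x y z xyz z3 lt => [|[|x]] [|[|[|y]]] [|[|[|[|z]]]] //=; lia.
Qed.

Lemma natural_mb_lift (A B : mbsset) (i : mbmap A B) (u : mbmap A natural_mb) :
  (exists h : mbmap B natural_mb, forall n (x : A n), h n (i n x) = u n x) ->
  forall v, @comp mb_cat _ _ _ (mb_to_point natural_mb) u = @comp mb_cat _ _ _ v i ->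
  exists h : @hom mb_cat B natural_mb, @comp mb_cat _ _ _ h i = u /\
    @comp mb_cat _ _ _ (mb_to_point natural_mb) h = v.
Proof.
move=> [h hi] v _; exists h; split; apply: mbmap_eq => n x; first exact: hi.
exact: simplex0_uniq.
Qed.

Lemma simplex_act n (u : smap (simplex n) X) m (a : delta m n) :
  u m a = act a (u n (did n)).
Proof. by rewrite -smap_act /= dcomp1m. Qed.

Lemma natural_mb_of (B : sset) (E : B 1 -> Prop) (T C : B 2 -> Prop) (f : smap B X) :
  (forall x, E x -> special (@sc_thin X) (f 1 x)) ->
  (forall x, T x -> sc_thin (f 2 x)) -> (forall x, C x -> sc_thin (f 2 x)) ->
  exists h : mbmap (mb_of E T C) natural_mb, mb_smap h = f.
Proof.
move=> uE uT uC; unshelve eexists (@MbMap (mb_of E T C) natural_mb f _ _ _) => //.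
- by move=> x [dx|/uE //]; exact: special_degenerate (degenerate_map f dx).
- by move=> x [dx|/uT //]; exact: sc_thin_deg (degenerate_map f dx).
- by move=> x [[dx|/uT //]|/uC //]; exact: sc_thin_deg (degenerate_map f dx).
Qed.

Lemma natural_mb_extend (A : sset) (E E' : A 1 -> Prop) (T T' C C' : A 2 -> Prop)
    (u : mbmap (mb_of E T C) natural_mb) :
  (forall x, E' x -> special (@sc_thin X) (u 1 x)) ->
  (forall x, T' x -> sc_thin (u 2 x)) -> (forall x, C' x -> sc_thin (u 2 x)) ->
  exists h : mbmap (mb_of E' T' C') natural_mb, forall n (x : A n), h n x = u n x.
Proof.
move=> uE uT uC; have [h hE] := natural_mb_of uE uT uC.
by exists h => n x; rewrite hE.
Qed.

(* For n = 2 the horn of (A3) is filled by a degenerate triangle. *)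
Lemma chorn2_retract : exists2 r : smap (csimplex 2)
    (collapse (preim_sub (sub_incl (@horn 2 ord0)) (edge01 2))),
  forall m x, r m (chorn0_incl 2 m x) = x
  & degenerate (r 2 (csimplex_proj 2 2 (tri 2 0 1 2))).
Proof.
(* [rho] moves the vertex 1 to 0 and so lands in the horn. On the collapsed triangle it induces a
   retraction, since the edge 01 is a point there. *)
set A := preim_sub _ _; pose rho := dlist 2 2 [:: 0; 0; 2].
have rho1 m (a : delta m 2) : misses 2 (ord0 : 'I_3) (hit (dcomp rho a)).
  exists 1; split=> //; apply/hitP => -[i]; rewrite dcompE dlistE //.
  by case: (nat_of_ord (a i)) (ltn_ord (a i)) => [|[|[|k]]].
have w_act m n (f : delta m n) (a : simplex 2 n) :
    horn_simplex (rho1 m (act f a)) = act f (horn_simplex (rho1 n a)).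
  by apply: val_inj; rewrite /= dcompA.
pose w := @SMap (simplex 2) (sub_sset (@horn 2 ord0))
  (fun m a => horn_simplex (rho1 m a)) w_act.
have [|r [[r_point r_proj] _]] := (collapse_pushout (edge01 2)).2 _ (collapse_point A)
    (smap_comp (collapse_proj A) w).
  apply: smap_eq => n [a a01] /=; rewrite insubN // negbK /=.
  apply/forallP => k; rewrite ffunE dlistE //.
  by have := forallP a01 k; case: (nat_of_ord _) => [|[|[|j]]].
have rE m (a : delta m 2) : r m (csimplex_proj 2 m a) = collapse_proj A m (w m a).
  exact: (congr1 (fun f : smap (simplex 2) _ => f m a) r_proj).
have rhoE m (a : delta m 2) : horn (ord0 : 'I_3) m a -> ~~ edge01 2 m a -> dcomp rho a = a.
  move=> ha na; apply: delta_ext => k; rewrite dcompE dlistE //.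
  have [j [j2 j0 aj]] := proj2 (misses_hornP ord0 a) ha.
  have [i ai] : exists i, ~~ (a i <= 1) by apply/existsP; rewrite -negb_forall.
  have := ltn_ord (a i); have := lacks_neq i aj; have := lacks_neq k aj.
  move: (nat_of_ord (a k)) (ltn_ord (a k)) => [|[|[|k']]] //= _.
  by move: j0 => /=; lia.
exists r => [m [x|]|].
- rewrite [LHS](rE m (val (val x))) /= -[RHS]/(Some x) -[RHS](valK x).
  congr insub; apply: val_inj; apply: rhoE; first exact: (valP (val x)).
  exact: (valP x).
- exact: (congr1 (fun f : smap (simplex 0) _ => f m (dconst m ord0)) r_point).
rewrite rE; apply: (degenerate_map (collapse_proj A)).
exists 1, (dlist 2 1 [:: 0; 0; 1]), (w 1 (edge 2 0 2)); split=> //.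
by apply: val_inj; rewrite /= !dlist_comp.
Qed.

Lemma csimplex_projP n m (y : csimplex n m) : exists a, y = csimplex_proj n m a.
Proof.
case: y => [y|]; first by exists (val y); rewrite /= valK.
exists (dconst m ord0); rewrite /= insubN // negbK /=.
by apply/forallP => k; rewrite ffunE.
Qed.

(** (A1), (A2), and (A3) for n > 2 are the scaled generators, lean being thin here; for the same
    reason (S2) is immediate. (A4) and (S5) define the marking, (S1) is [special_comp], (S3) is
    [thin_d1] and [thin_d2], and (S4) is [thin_collapsed_first]. *)
Theorem natural_mb_fibrant : two_cartesian_fibration (mb_to_point natural_mb).
Proof.
apply: saturation_lift => A B i; case=> {A B i}.
- move=> n i n2 i_n T u; apply: natural_mb_lift.
  have [k ku] := sc_lift X_bicat (@ScMap (sc_of (preim_coll _ T)) X u (mb_map_thin u))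
    (ScInner n2 i_n).
  have [h hE] := @natural_mb_of _ none T T k (fun _ => False_ind _)
    (fun x Tx => sc_mapP k (or_intror Tx)) (fun x Tx => sc_mapP k (or_intror Tx)).
  by exists h => m x; rewrite hE; apply: ku.
- move=> hT u; apply: natural_mb_lift.
  have [k ku] := sc_lift X_bicat (@ScMap (sc_of _) X u (mb_map_thin u)) ScSaturate.
  have [h hE] := @natural_mb_of _ none (faces T4') (faces T4') k (fun _ => False_ind _)
    (fun x Tx => sc_mapP k (or_intror Tx)) (fun x Tx => sc_mapP k (or_intror Tx)).
  by exists h => m x; rewrite hE; apply: ku.
- move=> n n2 u; apply: natural_mb_lift; set C := image_coll _ _ in u *.
  suff [k ku k_thin] : exists2 k : smap (csimplex n) X,
      forall m x, k m (chorn0_incl n m x) = u m x & forall x, C x -> sc_thin (k 2 x).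
    have [h hE] := @natural_mb_of _ none none C k (fun _ => False_ind _)
      (fun _ => False_ind _) k_thin.
    by exists h => m x; rewrite hE; apply: ku.
  have [n3|n3] := ltnP 2 n.
    have u_thin x : with_degenerate (preim_coll (chorn0_incl n) C) x -> sc_thin (u 2 x).
      case=> [dx|Cx]; first exact: sc_thin_deg (degenerate_map u dx).
      by apply: (mb_map_lean u); right.
    have [k ku] := sc_lift X_bicat (@ScMap (sc_of _) X u u_thin) (ScOuter n3).
    by exists k => // x Cx; apply: (sc_mapP k); right.
  have nE : n = 2 by lia.
  move: @C u {n2 n3}; rewrite nE => C u; have [r ru r_deg] := chorn2_retract.
  exists (smap_comp u r) => [m x|x [a Ca <-]]; first by rewrite /= ru.
  apply: sc_thin_deg; apply: (degenerate_map u).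
  by rewrite (faces1P Ca).
- move=> n n2 u; apply: natural_mb_lift.
  set E := faces _ in u *; set C := faces _ in u *.
  have [y0 _] := horn_vertex (@ord_max n) n2; pose x0 : X 0 := u 0 y0.
  have ok1 : dlist_ok 1 n [:: n.-1; n] by rewrite edge_ok; lia.
  have ok2 : dlist_ok 2 n [:: 0; n.-1; n] by rewrite tri_ok; lia.
  have m1 : misses n (@ord_max n) (hit (edge n n.-1 n)).
    by exists 0; split; rewrite ?hit_dlist ?inE /=; lia.
  pose y1 := horn_simplex m1.
  have y1_marked : special (@sc_thin X) (u 1 y1).
    by apply: (mb_map_marked u); right; apply: faces_dlist; rewrite ?inE.
  have hE m (b : delta m n) (mb : misses n (@ord_max n) (hit b)) :
      map_of_horn u x0 b = u m (horn_simplex mb).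
    exact: (map_of_hornE u x0 (horn_simplex mb)).
  have h_thin : 2 < n -> sc_thin (map_of_horn u x0 (tri n 0 n.-1 n)).
    move=> n3; have m2 : misses n (@ord_max n) (hit (tri n 0 n.-1 n)).
      by exists 1; split; rewrite ?hit_dlist ?inE /=; lia.
    by rewrite (hE _ _ m2); apply: (mb_map_lean u); right; apply: faces_dlist; rewrite ?inE.
  have [k k_fills k_thin] := y1_marked.1 n _ n2 (map_of_horn_natural u x0) (hE _ _ m1) h_thin.
  have [|||h hE'] := @natural_mb_of _ E none C (yoneda k).
  - move=> x /faces1P -> /=; rewrite -/(edge n n.-1 n) (k_fills _ _ m1) (hE _ _ m1).
    exact: y1_marked.
  - by [].
  - by move=> x /faces1P -> /=.
  exists h => m x; rewrite hE' /= -(map_of_hornE u x0); apply: k_fills.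
  exact: (proj2 (misses_hornP ord_max (val x)) (valP x)).
- move=> u; apply: natural_mb_lift.
  have [|||h hE] := @natural_mb_of _ all_simp all_simp all_simp
    (smap_comp u (to_simplex0 (simplex 1))).
  - by move=> x _; apply: (mb_map_marked u); right.
  - by move=> x _; apply: (mb_map_thin u); right.
  - by move=> x _; apply: (mb_map_thin u); right.
  by exists h => m x; rewrite hE /=; congr (u m _); apply: simplex0_uniq.
- move=> u; apply: natural_mb_lift; apply: natural_mb_extend => x _.
  + have t_thin : sc_thin (u 2 (did 2)) by apply: (mb_map_thin u); right.
    have [a [b ab]] : exists a b, x = edge 2 a b /\ a <= b <= 2.
      exists ((x : delta 1 2) (inord 0)), ((x : delta 1 2) (inord 1)); split.
        exact: deltaE.
      by have := delta_ok (x : delta 1 2); rewrite /= edge_ok.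
    case: ab => -> ab.
    (* An edge of Delta^2 is degenerate, one of the two marked ones, or their composite 02. *)
    have [ab1|] := boolP ((a == b) || (b == a.+1)).
      apply: (mb_map_marked u); case/orP: ab1 => /eqP e.
        left; exists 0, (dconst 1 ord0), (dlist 0 2 [:: a]); split=> //.
        rewrite /edge -e; symmetry; apply: dlist_eq => [|i]; first by rewrite edge_ok; lia.
        rewrite dcompE dlistE; last by rewrite /dlist_ok /= andbT; lia.
        by rewrite ffunE; case: i => -[|[|i]].
      right; apply: faces_dlist; first by rewrite edge_ok.
      by rewrite e; case: a ab e => [|[|a]] //; lia.
    move=> nab; have -> : edge 2 a b = edge 2 0 2 by congr (edge 2 _ _); lia.
    rewrite simplex_act; apply: special_comp => //; rewrite -simplex_act;
      by apply: (mb_map_marked u); right; apply: faces_dlist.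
  + by apply: (mb_map_thin u); right.
  + by apply: (mb_map_thin u); right.
- move=> u; apply: natural_mb_lift; apply: natural_mb_extend => // x _.
    by apply: (mb_map_lean u); right.
  by apply: (mb_map_lean u); right.
- move=> T u; apply: natural_mb_lift; apply: natural_mb_extend => // x Tx.
    by apply: (mb_map_thin u); right.
  have uU a b c : a <= b <= c -> c <= 3 -> [:: a; b; c] != [:: 0; 2; 3] ->
      sc_thin (act (tri 3 a b c) (u 3 (did 3))).
    move=> abc c3 ne; rewrite -simplex_act; apply: (mb_map_lean u); right.
    by rewrite /U1 /all_but faces_dlistE ?tri_ok ?abc // inE; apply/negP.
  rewrite simplex_act; apply: thin_faces; try exact: uU.
  by apply: (thin_d1 XP); exact: uU.
- move=> T u; apply: natural_mb_lift; apply: natural_mb_extend => // x Tx.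
    by apply: (mb_map_thin u); right.
  have uU a b c : a <= b <= c -> c <= 3 -> [:: a; b; c] != [:: 0; 1; 3] ->
      sc_thin (act (tri 3 a b c) (u 3 (did 3))).
    move=> abc c3 ne; rewrite -simplex_act; apply: (mb_map_lean u); right.
    by rewrite /U2 /all_but faces_dlistE ?tri_ok ?abc // inE; apply/negP.
  rewrite simplex_act; apply: thin_faces; try exact: uU.
  by apply: (thin_d2 XP); exact: uU.
- move=> u; apply: natural_mb_lift; apply: natural_mb_extend => // x _.
  pose f := smap_comp u (csimplex_proj 3).
  have uU a b c : a <= b <= c -> c <= 3 -> [:: a; b; c] != [:: 1; 2; 3] ->
      sc_thin (act (tri 3 a b c) (f 3 (did 3))).
    move=> abc c3 ne; rewrite -simplex_act; apply: (mb_map_lean u); right.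
    exists (tri 3 a b c) => //.
    by rewrite /U0 /all_but faces_dlistE ?tri_ok ?abc // inE; apply/negP.
  have [a ->] := csimplex_projP x; rewrite -[u 2 _]/(f 2 a) simplex_act.
  apply: thin_faces; try exact: uU.
  apply: (thin_collapsed_first XP); try exact: uU.
  have E (b : delta 1 3) : edge01 3 1 b -> f 1 b = u 1 None.
    by move=> b01; rewrite /f /= insubN // negbK.
  rewrite -!simplex_act !E //; apply/forallP => i; rewrite dlistE //;
    by case: i => -[|[|i]].
- move=> E u; apply: natural_mb_lift; apply: natural_mb_extend => // x Ex.
    by apply: (mb_map_marked u); right.
  have uU a b c : a <= b <= c -> c <= 3 -> [:: a; b; c] != [:: 0; 1; 2] ->
      sc_thin (act (tri 3 a b c) (u 3 (did 3))).
    move=> abc c3 ne; rewrite -simplex_act; apply: (mb_map_lean u); right.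
    by rewrite /U3 /all_but faces_dlistE ?tri_ok ?abc // inE; apply/negP.
  rewrite simplex_act; apply: thin_faces; try exact: uU.
  have e_special : special (@sc_thin X) (act (edge 3 2 3) (u 3 (did 3))).
    by rewrite -simplex_act; apply: (mb_map_marked u); right; apply: faces_dlist.
  by apply: e_special.2; try exact: uU.
move=> K K_kan u; apply: natural_mb_lift; apply: natural_mb_extend => x _.
(* The edge extends to J inside [K], so its image extends to J in [X], with thin triangles. *)
+ have [//|iso <- _] := @special_extend K all_simp _ x (kan_special x K_kan).
  apply: (@special_iso X _ XP (smap_comp u iso)) => w.
  by apply: (mb_map_thin u); right.
+ by apply: (mb_map_thin u); right.
+ by apply: (mb_map_thin u); right.
Qed.

End NaturalMarking.

(** * The Quillen equivalence *)

(** A marked edge of the cylinder is degenerate in [B], so it lies in the copy of J over a vertex of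
    [B], and (E) for J marks its image. *)
Lemma mb_fibrant_homotopy (B : scsset) (Y : mbsset)
    (H : scmap (sc_cyl B) (U_ob Y)) : two_cartesian_fibration (mb_to_point Y) ->
  exists H' : mbmap (mb_cyl (L_ob B)) Y, mb_smap H' = H.
Proof.
move=> Y_fib; unshelve eexists (@MbMap (mb_cyl (L_ob B)) Y H _ _ _) => //.
- case=> _ w [/= [[|m]] [f [b [// _ ->]]] _].
  pose c n (v : iso_nerve n) : sc_cyl B n := (act (dconst n ord0) b, v).
  have c_act m n (a : delta m n) (v : iso_nerve n) : c m (act a v) = act a (c n v).
    rewrite /c /=; congr pair; rewrite -act_comp; congr (act _ b).
    exact: (@simplex0_uniq m).
  rewrite (_ : f = dconst 1 ord0); last exact: (@simplex0_uniq 1).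
  apply: (mb_fibrant_kan Y_fib (f := smap_comp H (SMap c_act)) iso_nerve_kan) => {}w.
  apply: (sc_mapP H); split=> //; apply: sc_thin_deg.
  by exists 0, (dconst 2 ord0), b.
- by move=> x [tx _]; apply: (sc_mapP H).
- by move=> x [tx _]; apply/mb_thin_lean/(sc_mapP H).
Qed.

Lemma mb_fibrant_map (Y Z : mbsset) (g : scmap (U_ob Y) (U_ob Z)) :
  two_cartesian_fibration (mb_to_point Y) ->
  two_cartesian_fibration (mb_to_point Z) ->
  exists g' : mbmap Y Z, mb_smap g' = g.
Proof.
move=> Y_fib Z_fib; unshelve eexists (@MbMap Y Z g _ _ _) => //.
- move=> e e_marked.
  have [iso <- iso_thin] := special_extend (@mb_thin_deg Y)
    (mb_fibrant_special Y_fib e_marked).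
  apply: (mb_fibrant_kan Z_fib (f := smap_comp g iso) iso_nerve_kan) => w.
  by apply: (@sc_mapP (U_ob Y) (U_ob Z) g); apply: iso_thin.
- exact: (@sc_mapP (U_ob Y) (U_ob Z) g).
- by move=> x /(mb_fibrant_lean Y_fib) tx; apply/mb_thin_lean/(@sc_mapP (U_ob Y) (U_ob Z) g).
Qed.

Section QuillenEquivalence.
Variables (M : model_structure sc_cat) (N : model_structure mb_cat).
Hypothesis hM : is_lurie_model_structure M.
Hypothesis hN : is_mb_model_structure_over_point N.

Let cofM (X Y : scsset) (f : scmap X Y) :
  cof M (f : @hom sc_cat X Y) <-> forall n, injective (f n).
Proof. by split=> [/hM.1 /sc_mono_inj|f_inj]; [|apply/hM.1/sc_mono_inj]. Qed.

Let cofN (X Y : mbsset) (f : mbmap X Y) :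
  cof N (f : @hom mb_cat X Y) <-> forall n, injective (f n).
Proof.
split=> [/hN.1 /sset_mono_inj //|f_inj].
by apply/hN.1/inj_sset_mono.
Qed.

Let fibN (Y : mbsset) : fibrant N Y -> two_cartesian_fibration (mb_to_point Y).
Proof. by move/hN.2. Qed.

Lemma L_cof (X Y : sc_cat) (f : hom X Y) : cof M f -> cof N (fmap L f).
Proof. by move/cofM => f_inj; apply/cofN. Qed.

Lemma fibrant_underlying (Y : mb_cat) : fibrant N Y -> fibrant M (U Y).
Proof. by move/fibN/mb_fibrant_underlying => ?; apply/hM.2. Qed.

Lemma L_weq_of_tcof (X Y : sc_cat) (f : hom X Y) :
  cof M f -> weq M f -> weq N (fmap L f).
Proof.
move=> cf wf; apply: (mb_weq_of_extension cofN) => Z.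
  move=> u fZ; have fUZ := fibrant_underlying fZ.
  have [h hf] := extend_tcof sc_point_terminal
    (LU_adj_fun u : @hom sc_cat X (U_ob Z)) cf wf fUZ.
  exists (LU_adj_inv h); apply: mbmap_eq => n x.
  exact: (congr1 (fun k : scmap X (U_ob Z) => k n x) hf).
move=> u v fZ uv; have fUZ := fibrant_underlying fZ.
have uv' : (LU_adj_fun u : @hom sc_cat Y (U_ob Z)) \* f =
    (LU_adj_fun v : @hom sc_cat Y (U_ob Z)) \* f.
  apply: scmap_eq => n x; exact: (congr1 (fun k : mbmap (L_ob X) Z => k n x) uv).
have [H [H0 H1]] := sc_homotopic_of_tcof cofM cf wf fUZ uv'.
have [H' H'E] := mb_fibrant_homotopy H (fibN fZ).
exists H'; split; apply: mbmap_eq => n x; rewrite /= H'E.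
  exact: (congr1 (fun k : scmap Y (U_ob Z) => k n x) H0).
exact: (congr1 (fun k : scmap Y (U_ob Z) => k n x) H1).
Qed.

(** Ken Brown's argument: all scaled simplicial sets are cofibrant, so the trivial fibration [p] has
    a section [s], which is a trivial cofibration, and two-out-of-three applies to the image of
    [p \* s] under [L]. *)
Lemma L_weq (X Y : sc_cat) (f : hom X Y) : weq M f -> weq N (fmap L f).
Proof.
move=> wf; have [W [i [p [E ci fp wp]]]] := factor_cof_tfib M f.
have wi : weq M i by apply: (weq_cancell wp); rewrite -E.
have [e _] := sc_empty_initial Y; have [e' _] := sc_empty_initial W.
have ce : cof M e by apply/cofM => n [].
have sq : p \* e' = idm Y \* e by apply: scmap_eq => n [].
have [s [_ ps]] := lift_cof_tfib ce fp wp sq.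
have ws : weq M s by apply: (weq_cancell wp); rewrite ps; apply: weq_idm.
have cs : cof M s.
  apply/cofM => n; apply: (@can_inj _ _ _ ((p : scmap W Y) n)) => y.
  exact: (congr1 (fun k : scmap Y Y => k n y) ps).
rewrite E fmap_comp; apply: weq_comp; first exact: L_weq_of_tcof.
apply: (weq_cancelr (L_weq_of_tcof cs ws)).
by rewrite -fmap_comp ps fmap1; apply: weq_idm.
Qed.

(** The counit is the identity on simplices: extensions along it are unique, and they exist by
    [mb_fibrant_map]. *)
Lemma counit_weq (Y : mb_cat) : fibrant N Y ->
  weq N (adj_inv LU_adj (idm (U Y)) : hom (L (U Y)) Y).
Proof.
move=> fY; apply: (mb_weq_of_extension cofN) => Z.
  move=> u fZ; have [g gE] := mb_fibrant_map (LU_adj_fun u) (fibN fY) (fibN fZ).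
  by exists g; apply: mbmap_eq => n x; rewrite /= gE.
move=> u v fZ uv.
have -> : u = v.
  apply: mbmap_eq => n x.
  exact: (congr1 (fun k : mbmap (L_ob (U_ob Y)) Z => k n x) uv).
by apply: (@homotopic_refl mb_cat mb_cyl (mb_end false) (mb_end true)
  (fun X => mb_fst X mb_iso)) => X; apply: mbmap_eq.
Qed.

(** Extension and homotopy problems in an oo-bicategory are solved in its natural marking, along
    [fmap L i]; the solutions are then stripped of their markings. *)
Lemma L_reflects_tcof (X W : sc_cat) (i : hom X W) :
  cof M i -> weq N (fmap L i) -> weq M i.
Proof.
move=> ci wi; have cLi := L_cof ci.
have natural_fib (Z : scsset) (Zb : infty_bicategory Z) : fibrant N (natural_mb Zb).
  by apply/hN.2; apply: natural_mb_fibrant.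
apply: (sc_weq_of_extension cofM) => Z.
  move=> u /hM.2 Zb; pose u' := @ScMap X (U_ob (natural_mb Zb)) (u : scmap X Z) (sc_mapP u).
  have [h hi] := extend_tcof mb_point_terminal
    (LU_adj_inv u' : @hom mb_cat (L X) (natural_mb Zb)) cLi wi (natural_fib Z Zb).
  exists (@ScMap W Z h (mb_map_thin h)); apply: scmap_eq => n x.
  exact: (congr1 (fun k : mbmap (L_ob X) (natural_mb Zb) => k n x) hi).
move=> u v /hM.2 Zb uv.
pose u' := @ScMap W (U_ob (natural_mb Zb)) (u : scmap W Z) (sc_mapP u).
pose v' := @ScMap W (U_ob (natural_mb Zb)) (v : scmap W Z) (sc_mapP v).
have uv' : (LU_adj_inv u' : @hom mb_cat (L W) (natural_mb Zb)) \* fmap L i =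
    (LU_adj_inv v' : @hom mb_cat (L W) (natural_mb Zb)) \* fmap L i.
  apply: mbmap_eq => n x; exact: (congr1 (fun k : scmap X Z => k n x) uv).
have [H [H0 H1]] := mb_homotopic_of_tcof cofN cLi wi (natural_fib Z Zb) uv'.
have H_thin (x : sc_cyl W 2) : sc_thin x -> sc_thin (H 2 x : Z 2).
  exact: (mb_map_thin H).
exists (@ScMap (sc_cyl W) Z H H_thin); split; apply: scmap_eq => n x.
  exact: (congr1 (fun k : mbmap (L_ob W) (natural_mb Zb) => k n x) H0).
exact: (congr1 (fun k : mbmap (L_ob W) (natural_mb Zb) => k n x) H1).
Qed.

Lemma LU_quillen_equivalence : quillen_equivalence M N LU_adj.
Proof.
split=> [|X Y f _ fY].
  split=> [X Y f|X Y f cf wf]; first exact: L_cof.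
  by split; [apply: L_cof|apply: L_weq_of_tcof].
(* By the triangle identity [f] is the counit after the image of its adjunct under [L]. *)
have fE : f = adj_inv LU_adj (idm (U Y)) \* fmap L (adj LU_adj f).
  by apply: mbmap_eq.
split=> [wf|wg]; last first.
  by rewrite fE; apply: weq_comp (counit_weq fY); apply: L_weq.
have wLg : weq N (fmap L (adj LU_adj f)).
  by apply: weq_cancell (counit_weq fY) _; rewrite -fE.
(* Reflection has been shown for cofibrations, so the adjunct is replaced by the cofibration of a
   factorization. *)
have [W [i [p [E ci fp wp]]]] := factor_cof_tfib M (adj LU_adj f).
rewrite E; apply: (weq_comp _ wp); apply: L_reflects_tcof ci _.
by apply: weq_cancell (L_weq wp) _; rewrite -fmap_comp -E.
Qed.

End QuillenEquivalence.

Theorem theorem3p39 (M : model_structure sc_cat) (N : model_structure mb_cat)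
    (hM : is_lurie_model_structure M)
    (hN : is_mb_model_structure_over_point N) :
  quillen_equivalence M N LU_adj.
Proof. exact: LU_quillen_equivalence. Qed.
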